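(* Let $\Omega$ be a bounded domain in $\mathbb{C}^n$. Let $f \in C(\Omega \times \mathbb{R})$ be non-negative and such that for any fixed $z\in \Omega$, $f(z, \cdot )$ is non-decreasing. Assume that $u,v \in C(\overline{\Omega}) \cap PSH (\Omega)$ are, respectively, a viscosity subsolution and a viscosity supersolution in $\Omega$ of the equation $M_{\mathbb{C}} (\cdot) = f(z, \cdot)$. Then $$u \leq v \ \text{ on } \partial \Omega \quad \Longrightarrow \quad u \leq v \ \text{ in } \Omega .$$
   Context: $PSH(\Omega)$ is the space of plurisubharmonic functions on $\Omega$. For a $C^2$ function $\varphi$, $M_{\mathbb{C}}(\varphi) := \det(2\varphi_{\bar j i})$, where $\varphi_{\bar j i} = \partial^2\varphi/\partial z^i\partial \bar z^j$. $T^+(n)$ is the set of polynomials $p(z) = \sum_{i,j} A_{\bar j i} z^i \bar z^j$ with $A=(A_{\bar j i})$ a non-negative Hermitian $n\times n$ matrix, so that $M_{\mathbb{C}}(p)=\det(2A)$ is constant. $H(n)$ is the space of holomorphic polynomials in $z^1,\dots,z^n$ of degree at most $2$. A continuous function $\varphi$ touches $u$ from above (resp. below) at $z_0$ if $\varphi(z_0)=u(z_0)$ and $\varphi\ge u$ (resp. $\varphi\le u$) in some open neighborhood of $z_0$. Viscosity sub/supersolutions: let $f:\Omega\times\mathbb{R}\to[0,\infty)$ be non-decreasing in the second variable. A continuous plurisubharmonic function $u$ on $\Omega$ is a viscosity subsolution (resp. supersolution) of $M_{\mathbb{C}}(\cdot)=f(z,\cdot)$ if: for any $p\in T^+(n)$,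 if there exists $h\in H(n)$ such that $p+\mathrm{Re}(h)$ touches $u$ from above (resp. below) at some $z_0\in\Omega$, then $M_{\mathbb{C}}(p)\ge f(z_0,u(z_0))$ (resp. $M_{\mathbb{C}}(p)\le f(z_0,u(z_0))$). *)

(* Defs.v *)
From HB Require Import structures.
From mathcomp Require Import all_boot all_order all_algebra.
From mathcomp Require Import all_classical all_reals all_analysis.
From mathcomp Require Import complex.
(* The notations of multinomials clash with those of MathComp-Analysis. *)
From mathcomp Require Import -(notations) mpoly.

Set Implicit Arguments.
Unset Strict Implicit.
Unset Printing Implicit Defensive.

Import Order.TTheory GRing.Theory Num.Theory numFieldNormedType.Exports.

Local Open Scope classical_set_scope.
Local Open Scope ring_scope.
Local Open Scope complex_scope.
Local Open Scope sesquilinear_scope.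

(* The library puts the norm topology on R[i]^o; the carrier R[i] itself gets
   the same structures, so that 'rV[R[i]]_n is a normed R[i]-module. *)
Set Warnings "-redundant-canonical-projection".
HB.instance Definition _ (R : rcfType) := GRing.ComAlgebra.copy R[i] R[i]^o.
HB.instance Definition _ (R : rcfType) := Vector.copy R[i] R[i]^o.
HB.instance Definition _ (R : rcfType) := NormedModule.copy R[i] R[i]^o.
Set Warnings "redundant-canonical-projection".

Definition is_domain {T : topologicalType} (Omega : set T) : Prop :=
  [/\ open Omega, connected Omega & Omega !=set0].

Definition boundary {T : topologicalType} (A : set T) : set T :=
  closure A `\` interior A.

Section ComplexMongeAmpere.
Context {R : realType} {n : nat}.
Local Notation C := R[i].
Local Notation Cn := 'rV[R[i]]_n.

(* Topology of [subspace Omega]: semicontinuity is only required on Omega. *)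
Definition psh (Omega : set Cn) (u : Cn -> \bar R) : Prop :=
  [/\ forall z, Omega z -> (u z < +oo)%E,
      lower_semicontinuous ((fun z => - u z)%E : subspace Omega -> \bar R)
    & forall a b : Cn,
        (forall t : C, `|t| <= 1 -> Omega (a + t *: b)) ->
        (u a <= ((2 * pi)^-1)%R%:E *
          \int[lebesgue_measure]_(theta in `[0%R, (2 * pi)%R])
            u (a + (cos theta +i* sin theta) *: b)%R)%E].

(* Derivative of g at z in the real direction v: the increment is real. *)
Definition real_deriv (v : Cn) (g : Cn -> C) (z : Cn) : C :=
  derive1 (fun t : R => complex.Re (g (z + t%:C *: v))) 0
  +i* derive1 (fun t : R => complex.Im (g (z + t%:C *: v))) 0.

Definition dz (i : 'I_n) (g : Cn -> C) (z : Cn) : C :=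
  (real_deriv (delta_mx 0 i) g z
   - 'i * real_deriv ('i *: delta_mx 0 i) g z) / 2.

Definition dzbar (j : 'I_n) (g : Cn -> C) (z : Cn) : C :=
  (real_deriv (delta_mx 0 j) g z
   + 'i * real_deriv ('i *: delta_mx 0 j) g z) / 2.

Definition complex_hessian (phi : Cn -> R) (z : Cn) : 'M[C]_n :=
  \matrix_(j, i) dz i (dzbar j (fun w => (phi w)%:C)) z.

(* For phi of class C^2 the complex Hessian is Hermitian, so that the
   determinant is real and taking its real part loses nothing. *)
Definition MC (phi : Cn -> R) (z : Cn) : R :=
  complex.Re (\det (2 *: complex_hessian phi z)).

Definition nonneg_hermitian (A : 'M[C]_n) : Prop :=
  A \is hermsymmx /\ forall v : 'cV[C]_n, 0 <= (v ^t* *m A *m v) 0 0.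

Definition Tplus : set (Cn -> R) :=
  [set p | exists A : 'M[C]_n, nonneg_hermitian A /\
     forall z : Cn, (p z)%:C = \sum_i \sum_j A j i * z 0 i * (z 0 j)^*].

(* mmeasure mdeg q, i.e. the library's msize q, is the total degree plus 1. *)
Definition Hol2 : set (Cn -> C) :=
  [set h | exists q : mpoly n C, (mmeasure mdeg q <= 3)%N /\
     forall z : Cn, h z = meval (fun i => z 0 i) q].

Definition touches_above (phi u : Cn -> R) (z0 : Cn) : Prop :=
  phi z0 = u z0 /\ \forall z \near z0, u z <= phi z.

Definition touches_below (phi u : Cn -> R) (z0 : Cn) : Prop :=
  phi z0 = u z0 /\ \forall z \near z0, phi z <= u z.

Definition viscosity_subsolution (Omega : set Cn) (f : Cn -> R -> R)
    (u : Cn -> R) : Prop :=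
  [/\ {within Omega, continuous u}, psh Omega (EFin \o u)
    & forall p, Tplus p -> forall z0, Omega z0 ->
        (exists2 h, Hol2 h &
           touches_above (fun z => p z + complex.Re (h z)) u z0) ->
        f z0 (u z0) <= MC p z0].

Definition viscosity_supersolution (Omega : set Cn) (f : Cn -> R -> R)
    (u : Cn -> R) : Prop :=
  [/\ {within Omega, continuous u}, psh Omega (EFin \o u)
    & forall p, Tplus p -> forall z0, Omega z0 ->
        (exists2 h, Hol2 h &
           touches_below (fun z => p z + complex.Re (h z)) u z0) ->
        MC p z0 <= f z0 (u z0)].

End ComplexMongeAmpere.

(* Main.v *)
(* Write [M xi] for the linear operator [w |-> sum_k H_w(xi_k, xi_k)],
   [H_w] the complex Hessian and [xi_k] the rows of a matrix with |det xi| = 1.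
   By the arithmetic-geometric mean inequality a viscosity subsolution of the
   Monge-Ampere equation is, for every such [xi], a viscosity subsolution of a
   linear constant coefficient equation in [M xi], and the determinant is
   recovered from all the [M xi] together.  For linear equations the notion is
   stable under sums (compare with polynomial solutions of the Dirichlet problem
   on a ball, the boundary values being approximated by Weierstrass' theorem) and
   under locally uniform limits, hence under Steklov averages.  So near an
   interior maximum of u + e |z|^2 - v, where u > v, the function u + (e/2) |z|^2
   can be replaced by a C^2 subsolution; at a nearby maximum its second order
   Taylor polynomial, minus a small quadratic, touches v from below and
   contradicts the supersolution property. *)

From HB Require Import structures.
Require Import Defs.
From mathcomp Require Import all_boot all_order all_algebra.
From mathcomp Require Import all_classical all_reals all_analysis.
From mathcomp Require Import complex ring lra zify.
From mathcomp Require Import -(notations) mpoly.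
Import Order.TTheory GRing.Theory Num.Theory numFieldNormedType.Exports.

Set Implicit Arguments.
Unset Strict Implicit.
Unset Printing Implicit Defensive.

Local Open Scope classical_set_scope.
Local Open Scope ring_scope.

(** For a non-negative Hermitian [A] the n-th root of det(2A) is the infimum, over |det xi| = 1, of
    the mean over k of the values of the form 2A at the rows xi_k. Hence a lower bound on the
    determinant is an intersection of linear conditions with constant coefficients, and each of
    these passes to averages. The average does not depend on xi, so one C^2 function satisfies all
    of them at once.

    The right-hand side varies and is frozen near the maximum: if [a] is the n-th root of f at that
    point, the n-th root of f stays between a - e/4 (or 0) and a + e/4 nearby, whereas (e/2) |z|^2
    raises each linear bound by e. The other half of e |z|^2 is left outside the average; it pays
    for the Taylor error and for localizing the maximum.

    Test polynomials must have a non-negative Hermitian part. For u touched from above this follows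
    from the sub-mean value property, for v touched from below it follows from the linear bounds for
    all xi. Apart from this sign, the functions p + Re h are exactly the real quadratic
    polynomials. *)

Lemma cvg_sumr (R : realType) (T : Type) (F : set_system T) {FF : Filter F}
    (I : Type) (r : seq I) (f : I -> T -> R) (l : I -> R) :
  (forall i, f i x @[x --> F] --> l i) ->
  \sum_(i <- r) f i x @[x --> F] --> \sum_(i <- r) l i.
Proof.
move=> fl; elim: r => [|i r IH].
  by under eq_fun do rewrite big_nil; rewrite big_nil; exact: cvg_cst.
by under eq_fun do rewrite big_cons; rewrite big_cons; exact: cvgD.
Qed.

(** * Second order jets *)

Section SecondOrder.
Context {R : realType} {N : nat}.
Local Notation V := 'rV[R]_N.
Implicit Types (x y h b : V) (H : 'M[R]_N).

Definition dotv x y : R := (x *m y^T) 0 0.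
(** There is no factor 1/2, and [H] may be any square matrix: the Hessian of [quad H] is [H + H^T],
    so its Laplacian is [2 * \tr H]. *)
Definition quad H x : R := (x *m H *m x^T) 0 0.
Definition sqn x : R := dotv x x.

Lemma normv_le x (e : R) : 0 <= e -> (forall k, `|x 0 k| <= e) -> `|x| <= e.
Proof.
move=> e0 xe; rewrite [leLHS]/Num.norm /= mx_normrE.
by apply: bigmax_le => //= -[i j] _ /=; rewrite ord1.
Qed.

Lemma normv_coord x k : `|x 0 k| <= `|x|.
Proof.
rewrite [leRHS]/Num.norm /= mx_normrE.
by apply: (le_bigmax _ (fun ij => `|x ij.1 ij.2|) (0, k)).
Qed.

Lemma norm_delta k : `|delta_mx 0 k : V| <= 1.
Proof.
by apply: normv_le => // i; rewrite mxE; case: (_ && _); rewrite ?normr1 ?normr0.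
Qed.

Lemma dotvE x y : dotv x y = \sum_k x 0 k * y 0 k.
Proof. by rewrite /dotv mxE; apply: eq_bigr => k _; rewrite mxE. Qed.

Lemma sqnE x : sqn x = \sum_k x 0 k ^+ 2.
Proof. by rewrite /sqn dotvE; apply: eq_bigr => k _; rewrite expr2. Qed.

Lemma dotvC x y : dotv x y = dotv y x.
Proof. by rewrite !dotvE; apply: eq_bigr => k _; rewrite mulrC. Qed.

Lemma dotvDl x y z : dotv (x + y) z = dotv x z + dotv y z.
Proof. by rewrite /dotv mulmxDl mxE. Qed.

Lemma dotvDr x y z : dotv z (x + y) = dotv z x + dotv z y.
Proof. by rewrite !(dotvC z) dotvDl. Qed.

Lemma dotvZl a x y : dotv (a *: x) y = a * dotv x y.
Proof. by rewrite /dotv -scalemxAl mxE. Qed.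

Lemma dotvZr a x y : dotv x (a *: y) = a * dotv x y.
Proof. by rewrite !(dotvC x) dotvZl. Qed.

Lemma dot0v x : dotv 0 x = 0.
Proof. by rewrite /dotv mul0mx mxE. Qed.

Lemma dotv0 x : dotv x 0 = 0.
Proof. by rewrite dotvC dot0v. Qed.

Lemma dotNv x y : dotv (- x) y = - dotv x y.
Proof. by rewrite -scaleN1r dotvZl mulN1r. Qed.

Lemma dotvN x y : dotv x (- y) = - dotv x y.
Proof. by rewrite dotvC dotNv dotvC. Qed.

Lemma sqn_ge0 x : 0 <= sqn x.
Proof. by rewrite sqnE sumr_ge0// => k _; rewrite sqr_ge0. Qed.

Lemma sqn0 : sqn 0 = 0.
Proof. exact: dotv0. Qed.

Lemma sqnN x : sqn (- x) = sqn x.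
Proof. by rewrite /sqn dotNv dotvN opprK. Qed.

Lemma sqnD x y : sqn (x + y) = sqn x + 2 * dotv x y + sqn y.
Proof. by rewrite /sqn !dotvDl !dotvDr (dotvC y x); ring. Qed.

Lemma sqnZ a x : sqn (a *: x) = a ^+ 2 * sqn x.
Proof. by rewrite /sqn dotvZl dotvZr mulrA expr2. Qed.

Lemma quadD H H' x : quad (H + H') x = quad H x + quad H' x.
Proof. by rewrite /quad mulmxDr mulmxDl mxE. Qed.

Lemma quadZ a H x : quad (a *: H) x = a * quad H x.
Proof. by rewrite /quad -scalemxAr -scalemxAl mxE. Qed.

Lemma quad1 x : quad 1%:M x = sqn x.
Proof. by rewrite /quad mulmx1. Qed.

Lemma quad0 H : quad H 0 = 0.
Proof. by rewrite /quad !mul0mx mxE. Qed.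

Lemma quadN H x : quad H (- x) = quad H x.
Proof. by rewrite /quad linearN /= mulmxN !mulNmx opprK. Qed.

Lemma quadZr a H x : quad H (a *: x) = a ^+ 2 * quad H x.
Proof.
by rewrite /quad linearZ /= -scalemxAr -!scalemxAl scalerA mxE expr2.
Qed.

Lemma quadDr H x h :
  quad H (x + h) = quad H x + quad H h + dotv (x *m (H + H^T)) h.
Proof.
rewrite /quad /dotv linearD /= mulmxDr !mulmxDl mulmxDr mulmxDl.
have -> : h *m H *m x^T = (x *m H^T *m h^T)^T by rewrite !trmx_mul !trmxK mulmxA.
set a := x *m H *m x^T; set c := h *m H *m h^T.
set d := x *m H *m h^T; set f := x *m H^T *m h^T.
by rewrite !mxE; ring.
Qed.

Lemma quad_rank1 b b' x : quad (b^T *m b') x = dotv b x * dotv b' x.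
Proof.
rewrite /quad mulmxA -mulmxA mxE big_ord1 dotvC /dotv; congr (_ * _).
Qed.

Lemma quad_delta H k : quad H (delta_mx 0 k) = H k k.
Proof.
by rewrite /quad -rowE trmx_delta -colE !mxE.
Qed.

Lemma sqn_delta k : sqn (delta_mx 0 k) = 1.
Proof. by rewrite -quad1 quad_delta mxE eqxx. Qed.

Lemma sqn_coord x k : x 0 k ^+ 2 <= sqn x.
Proof.
rewrite sqnE (bigD1 k)//= lerDl sumr_ge0// => j _; exact: sqr_ge0.
Qed.

(** The norm of row vectors is the sup norm, while [sqn] is the squared Euclidean norm. Passing from
    Euclidean to sup balls costs nothing; the converse below costs the factor [N]. *)
Lemma norm_le_sqn x (r : R) : 0 <= r -> sqn x <= r ^+ 2 -> `|x| <= r.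
Proof.
move=> r0 xr; apply: normv_le => // k; rewrite -ler_sqr ?nnegrE//.
by rewrite real_normK ?num_real// (le_trans (sqn_coord _ _)).
Qed.

Lemma sqn_le_norm x (r : R) : `|x| <= r -> sqn x <= N%:R * r ^+ 2.
Proof.
move=> xr; rewrite sqnE mulr_natl -[X in _ *+ X]card_ord -sumr_const.
apply: ler_sum => i _; rewrite -real_normK ?num_real//.
by apply: lerXn2r; rewrite ?nnegrE// ?(le_trans (normv_coord _ _))// (le_trans _ xr).
Qed.

Lemma quadE H x : quad H x = \sum_i \sum_j H i j * x 0 i * x 0 j.
Proof.
rewrite /quad mxE exchange_big; apply: eq_bigr => j _ /=.
rewrite !mxE mulr_suml; apply: eq_bigr => i _ /=; ring.
Qed.

Lemma quad_le_sqn H : exists2 C, 0 <= C & forall x, `|quad H x| <= C * sqn x.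
Proof.
exists (\sum_i \sum_j `|H i j|).
  by rewrite sumr_ge0// => i _; rewrite sumr_ge0.
move=> x; rewrite quadE mulr_suml.
apply: le_trans (ler_norm_sum _ _ _) _; apply: ler_sum => i _.
rewrite mulr_suml; apply: le_trans (ler_norm_sum _ _ _) _.
apply: ler_sum => j _; rewrite -mulrA normrM; apply: ler_wpM2l => //.
have hi := sqn_coord x i; have hj := sqn_coord x j.
rewrite ler_norml; apply/andP; split; nra.
Qed.

Lemma continuous_dotv b : continuous (dotv b : V -> R).
Proof.
move=> x; rewrite (_ : dotv b = fun h => \sum_k b 0 k * h 0 k); last first.
  by apply/funext => h; rewrite dotvE.
apply: (@cvg_sumr _ _ (nbhs x)) => k; apply: cvgM; first exact: cvg_cst.
exact: coord_continuous.
Qed.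

Lemma continuous_quad H : continuous (quad H : V -> R).
Proof.
move=> x; rewrite (_ : quad H = fun h => \sum_i \sum_j H i j * h 0 i * h 0 j).
  apply: (@cvg_sumr _ _ (nbhs x)) => i /=; apply: (@cvg_sumr _ _ (nbhs x)) => j /=; apply: cvgM.
    by apply: cvgM; [exact: cvg_cst|exact: coord_continuous].
  exact: coord_continuous.
by apply/funext => h; rewrite quadE.
Qed.

Lemma continuous_sqn : continuous (sqn : V -> R).
Proof.
move=> x; rewrite (_ : sqn = quad 1%:M); first exact: continuous_quad.
by apply/funext => y; rewrite quad1.
Qed.

Definition o2 (g : V -> R) : Prop :=
  forall e : R, 0 < e -> \forall h \near (0 : V), `|g h| <= e * sqn h.

Lemma o2D g k : o2 g -> o2 k -> o2 (fun h => g h + k h).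
Proof.
move=> og ok e e0; have e2 : 0 < e / 2 by lra.
near=> h; have h1 : `|g h| <= e / 2 * sqn h by near: h; exact: og.
have h2 : `|k h| <= e / 2 * sqn h by near: h; exact: ok.
have := ler_normD (g h) (k h); lra.
Unshelve. all: by end_near. Qed.

Lemma o2M_bounded g k (l : R) : o2 g -> k @ (0 : V) --> l ->
  o2 (fun h => g h * k h).
Proof.
move=> og kl e e0.
have l0 : 0 < `|l| + 1 by rewrite ltr_wpDl.
have el : 0 < e / (`|l| + 1) by rewrite divr_gt0.
near=> h.
have h1 : `|g h| <= e / (`|l| + 1) * sqn h by near: h; exact: og.
have h2 : `|l - k h| < 1 by near: h; move/cvgrPdist_lt : kl; apply.
have h3 : `|k h| <= `|l| + 1.
  have := ler_normB l (l - k h); rewrite opprB addrC subrK; lra.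
rewrite normrM; apply: le_trans (ler_pM _ _ h1 h3) _ => //.
by rewrite mulrAC divfK// gt_eqF.
Unshelve. all: by end_near. Qed.

Lemma o2_quadM H s : s @ (0 : V) --> (0 : R) -> o2 (fun h => quad H h * s h).
Proof.
move=> s0 e e0; have [C C0 HC] := quad_le_sqn H.
have C1 : 0 < C + 1 by lra.
have eC : 0 < e / (C + 1) by rewrite divr_gt0.
near=> h.
have h1 : `|s h| <= e / (C + 1).
  near: h; move/cvgrPdist_le : s0 => /(_ _ eC).
  by apply: filterS => h; rewrite sub0r normrN.
rewrite normrM.
have h2 := HC h; have h3 := sqn_ge0 h.
apply: le_trans (ler_pM _ _ h2 h1) _ => //.
have -> : C * sqn h * (e / (C + 1)) = (C / (C + 1)) * (e * sqn h) by ring.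
apply: ler_piMl; first by rewrite mulr_ge0// ltW.
by rewrite ler_pdivrMr// mul1r; lra.
Unshelve. all: by end_near. Qed.

(** The slack [e * sqn h] replaces o(|h|^2): replacing [H] by [H + e%:M] turns the jet into a
    polynomial that really touches from above. *)
Definition superjet (w : V -> R) x b H : Prop := forall e : R, 0 < e ->
  \forall h \near (0 : V), w (x + h) <= w x + dotv b h + quad H h + e * sqn h.

(** An expansion in the sense of Peano at the single point [x]; [w] need not be differentiable
    elsewhere. *)
Definition taylor2 (w : V -> R) x b H : Prop :=
  o2 (fun h => w (x + h) - w x - dotv b h - quad H h).

Lemma taylor2_superjet w x b H : taylor2 w x b H -> superjet w x b H.
Proof.
move=> wt e e0; have := wt e e0; apply: filterS => h.
rewrite ler_norml => /andP[_]; lra.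
Qed.

Lemma taylor2_cst c x : taylor2 (fun _ => c) x 0 0.
Proof.
move=> e e0; near=> h; rewrite /= dot0v /quad mulmx0 mul0mx [X in _ - X]mxE !subr0 subrr.
by rewrite normr0 mulr_ge0 ?sqn_ge0// ltW.
Unshelve. all: by end_near. Qed.

Lemma taylor2_coord k x : taylor2 (fun y => y 0 k) x (delta_mx 0 k) 0.
Proof.
move=> e e0; near=> h; rewrite /= /quad mulmx0 mul0mx [X in _ - X]mxE.
rewrite /dotv -rowE !mxE [x 0 k + _]addrC addrK subrr subr0 normr0.
by rewrite mulr_ge0 ?sqn_ge0// ltW.
Unshelve. all: by end_near. Qed.

Lemma taylor2_ext w w' x b H : w =1 w' -> taylor2 w x b H -> taylor2 w' x b H.
Proof. by move=> /funext ->. Qed.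

Lemma o2_ext g g' : g =1 g' -> o2 g -> o2 g'.
Proof. by move=> /funext ->. Qed.

Lemma taylor2D w w' x b b' H H' : taylor2 w x b H -> taylor2 w' x b' H' ->
  taylor2 (fun y => w y + w' y) x (b + b') (H + H').
Proof.
move=> t t'; apply: o2_ext (o2D t t') => h.
by rewrite /= dotvDl quadD; ring.
Qed.

Lemma taylor2_cvg w x b H : taylor2 w x b H -> (fun h => w (x + h)) @ (0 : V) --> w x.
Proof.
move=> t.
rewrite (_ : (fun h => w (x + h)) = (fun h =>
  (w (x + h) - w x - dotv b h - quad H h) * 1 + w x + dotv b h + quad H h)).
  suff : (fun h => (w (x + h) - w x - dotv b h - quad H h) * 1 + w x +
      dotv b h + quad H h) @ (0 : V) --> 0 + w x + dotv b 0 + quad H 0.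
    by rewrite dotv0 quad0 !addr0 add0r.
  have cd : dotv b h @[h --> (0 : V)] --> dotv b 0 by exact: continuous_dotv.
  have cq : quad H h @[h --> (0 : V)] --> quad H 0 by exact: continuous_quad.
  apply: (cvgD (cvgD (cvgD _ (cvg_cst _)) cd) cq).
  apply/cvgrPdist_le => e e0.
  near=> h; rewrite sub0r normrN mulr1.
  have h1 : `|w (x + h) - w x - dotv b h - quad H h| <= e * sqn h.
    by near: h; exact: t.
  apply: le_trans h1 _; rewrite ger_pMr//.
  near: h; have /cvgrPdist_le/(_ 1 ltr01) := @continuous_sqn 0.
  apply: filterS => h; rewrite sqn0 sub0r normrN ger0_norm// sqn_ge0//.
by apply/funext => h; ring.
Unshelve. all: by end_near. Qed.

(** The product of the two linear terms is the quadratic form of the rank one matrix [b^T *m b'],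
    which is not symmetric in general. What remains is each remainder times a function with a limit,
    and each quadratic form times a function tending to 0. *)
Lemma taylor2M w w' x b b' H H' : taylor2 w x b H -> taylor2 w' x b' H' ->
  taylor2 (fun y => w y * w' y) x (w x *: b' + w' x *: b)
    (w x *: H' + w' x *: H + b^T *m b').
Proof.
move=> t t'.
have cw' := taylor2_cvg t'.
have ct : (fun h => w x + dotv b h + quad H h) @ (0 : V) --> w x + dotv b 0 + quad H 0.
  have cd : dotv b h @[h --> (0 : V)] --> dotv b 0 by exact: continuous_dotv.
  have cq : quad H h @[h --> (0 : V)] --> quad H 0 by exact: continuous_quad.
  exact: (cvgD (cvgD (cvg_cst _) cd) cq).
have h1 := o2M_bounded t cw'; have h2 := o2M_bounded t' ct.
have s1 : (fun h => dotv b' h + quad H' h) @ (0 : V) --> (0 : R).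
  have -> : (0 : R) = dotv b' 0 + quad H' 0 by rewrite dotv0 quad0 addr0.
  have cd : dotv b' h @[h --> (0 : V)] --> dotv b' 0 by exact: continuous_dotv.
  have cq : quad H' h @[h --> (0 : V)] --> quad H' 0 by exact: continuous_quad.
  exact: (cvgD cd cq).
have s2 : (fun h => dotv b h) @ (0 : V) --> (0 : R).
  by rewrite -(dotv0 b); exact: continuous_dotv.
have h3 := o2_quadM H s1; have h4 := o2_quadM H' s2.
apply: o2_ext (o2D (o2D h1 h2) (o2D h3 h4)) => h.
by rewrite /= !quadD !quadZ quad_rank1 dotvDl !dotvZl; ring.
Qed.

(* On a line the first order terms at [t] and [- t] cancel. *)
Lemma jet_max b H :
  (forall e : R, 0 < e -> \forall h \near (0 : V),
     dotv b h + quad H h <= e * sqn h) -> \tr H <= 0.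
Proof.
move=> bH; apply: sumr_le0 => k _.
apply/ler_addgt0Pl => e e0; rewrite addr0.
have /nbhs_ballP[d /= d0 dP] := bH e e0.
have d2 : 0 < d / 2 by lra.
pose h : V := (d / 2) *: delta_mx 0 k.
have hb s : s = 1 \/ s = -1 -> ball (0 : V) d (s *: h).
  move=> sE; rewrite -ball_normE /= sub0r normrN normrZ.
  have -> : `|s| = 1 by case: sE => ->; rewrite ?normrN normr1.
  rewrite mul1r normrZ gtr0_norm//.
  have := norm_delta k; nra.
have := dP _ (hb 1 (or_introl erefl)); have := dP _ (hb (-1) (or_intror erefl)).
rewrite /= scale1r scaleN1r dotvN quadN sqnN.
rewrite /h quadZr sqnZ quad_delta sqn_delta.
set t := dotv _ _; set a := H k k => h1 h2.
have : 0 < (d / 2) ^+ 2 by rewrite exprn_gt0.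
nra.
Qed.

End SecondOrder.

(** * Polynomials: Taylor expansion, Laplacian and the identity principle *)

Section Polynomials.
Context {R : realType} {N : nat}.
Local Notation V := 'rV[R]_N.
Local Notation pol := (mpoly N R).
Implicit Types (x y h b : V) (p q s : pol).

Definition peval p x : R := meval (fun i => x 0 i) p.
Definition mlap p : pol := \sum_i mderiv i (mderiv i p).
Definition Xv (i : 'I_N) : pol := mpolyX R (mnm1 i).
Definition msq : pol := \sum_i Xv i ^+ 2.

Lemma mlapD p q : mlap (p + q) = mlap p + mlap q.
Proof. by rewrite /mlap -big_split; apply: eq_bigr => i _; rewrite /= !mderivD. Qed.

Lemma mlapZ c p : mlap (c *: p) = c *: mlap p.
Proof. by rewrite /mlap scaler_sumr; apply: eq_bigr => i _; rewrite !mderivZ. Qed.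

Lemma mlapM p q : mlap (p * q) =
  p * mlap q + q * mlap p + (\sum_i mderiv i p * mderiv i q) *+ 2.
Proof.
rewrite /mlap !mulr_sumr -sumrMnl -!big_split; apply: eq_bigr => i _ /=.
by rewrite !mderivM !mderivD !mderivM; ring.
Qed.

Lemma mderiv_Xv i j : mderiv i (Xv j) = (i == j)%:R.
Proof.
rewrite /Xv mderivX mnm1E eq_sym; case: eqVneq => [->|_].
  by rewrite scale1r (_ : mnm_sub _ _ = @mnm0 N) ?mpolyX0//; apply/mnmP => k;
    rewrite mnmBE mnm0E subnn.
by rewrite scale0r.
Qed.

Lemma peval_msq x : peval msq x = sqn x.
Proof.
rewrite /peval raddf_sum sqnE; apply: eq_bigr => i _.
by rewrite /= rmorphXn /= /Xv mevalXU.
Qed.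

(** The property holds for constants and variables and is stable under sums and products. The trace
    identity must be part of the induction: in a product, the trace of the rank one term gives the
    scalar product of the gradients. *)
Lemma taylor2_peval p x : exists H,
  taylor2 (peval p) x (\row_i peval (mderiv i p) x) H /\
  2 * \tr H = peval (mlap p) x.
Proof.
pose P p := forall x : V, exists H,
  taylor2 (peval p) x (\row_i peval (mderiv i p) x) H /\
  2 * \tr H = peval (mlap p) x.
suff: P p by apply.
have PC c : P (mpolyC N c).
  move=> {}x; exists 0; split; last first.
    rewrite mxtrace0 mulr0 /mlap big1 ?/peval ?meval0// => i _.
    by rewrite mderivC mderiv0.
  rewrite (_ : \row__ _ = 0); last first.
    by apply/rowP => i; rewrite !mxE mderivC /peval meval0.
  apply: taylor2_ext (taylor2_cst c x) => y.
  by rewrite /peval mevalC.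
have PD q1 q2 : P q1 -> P q2 -> P (q1 + q2).
  move=> P1 P2 {}x; have [H1 [t1 r1]] := P1 x; have [H2 [t2 r2]] := P2 x.
  exists (H1 + H2); split.
    rewrite (_ : \row__ _ = (\row_i peval (mderiv i q1) x) +
        (\row_i peval (mderiv i q2) x)); last first.
      by apply/rowP => i; rewrite !mxE mderivD /peval mevalD.
    apply: taylor2_ext (taylor2D t1 t2) => y.
    by rewrite /peval mevalD.
  by rewrite mxtraceD mulrDr r1 r2 mlapD /peval mevalD.
have PM q1 q2 : P q1 -> P q2 -> P (q1 * q2).
  move=> P1 P2 {}x; have [H1 [t1 r1]] := P1 x; have [H2 [t2 r2]] := P2 x.
  have t := taylor2M t1 t2.
  eexists; split.
    rewrite (_ : \row__ _ = peval q1 x *: (\row_i peval (mderiv i q2) x) +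
        peval q2 x *: (\row_i peval (mderiv i q1) x)); last first.
      by apply/rowP => i; rewrite !mxE mderivM /peval mevalD !mevalM; ring.
    apply: taylor2_ext t => y.
    by rewrite /peval mevalM.
  rewrite !mxtraceD !mxtraceZ !mulrDr !(mulrCA 2) r1 r2 mlapM.
  rewrite mxtrace_mulC trace_mx11 -/(dotv _ _) dotvE.
  rewrite /peval mevalD mevalMn mevalD !mevalM.
  rewrite mulr_natl; congr (_ + _ *+ 2).
  rewrite raddf_sum; apply: eq_bigr => i _ /=.
  by rewrite !mxE mevalM mulrC.
have PX i : P (Xv i).
  move=> {}x; exists 0; split.
    rewrite (_ : \row__ _ = delta_mx 0 i); last first.
      apply/rowP => j; rewrite !mxE mderiv_Xv eqxx /=.
      by case: eqP => _; rewrite /peval ?meval1 ?meval0.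
    apply: taylor2_ext (taylor2_coord i x) => y.
    by rewrite /peval /Xv mevalXU.
  rewrite mxtrace0 mulr0 /mlap big1 ?/peval ?meval0// => j _.
  by rewrite mderiv_Xv; case: (_ == _); rewrite ?mderiv0 // -mpolyC1 mderivC.
elim/mpolyind: p => [|c m p _ _ IH].
  by rewrite -mpolyC0; exact: PC.
apply: PD => //; rewrite -mul_mpolyC; apply: (PM); first exact: PC.
rewrite mpolyXE_id; apply: big_ind => [||i _].
- by rewrite -mpolyC1; exact: PC.
- exact: PM.
elim: (m i) => [|k IHk]; first by rewrite expr0 -mpolyC1; exact: PC.
by rewrite exprS; apply: (PM) IHk; exact: PX.
Qed.

Lemma continuous_peval p : continuous (peval p).
Proof.
move=> x; have [H [t _]] := taylor2_peval p x.
have /cvgrPdist_lt c := taylor2_cvg t.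
apply/(@cvgrPdist_lt _ _ _ (nbhs x)) => e e0.
have := c e e0; rewrite !near_simpl => /nbhs_ballP[d /= d0 dP].
apply/nbhs_ballP; exists d => //= y xy.
rewrite -[y](subrK x) [y - x + x]addrC; apply: dP.
by move: xy; rewrite -!ball_normE /= sub0r normrN distrC.
Qed.

(** At t e_k and - t e_k the quadratic terms agree, so subtracting leaves |b_k| <= t for all small t
    > 0. *)
Lemma jet_eq0 b H :
  (\forall h \near (0 : V), `|dotv b h + quad H h| <= sqn h) -> b = 0.
Proof.
move=> /nbhs_ballP[d /= d0 dP]; apply/rowP => k; rewrite mxE.
apply/eqP; rewrite -normr_le0; apply/ler_addgt0Pl => e e0; rewrite addr0.
pose t := Num.min (d / 2) e.
have t0 : 0 < t by rewrite lt_min e0 andbT; lra.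
have td : t <= d / 2 by rewrite ge_min lexx.
have te : t <= e by rewrite ge_min lexx orbT.
have hb (s : R) : s = 1 \/ s = -1 -> ball (0 : V) d (s *: (t *: delta_mx 0 k)).
  move=> sE; rewrite -ball_normE /= sub0r normrN normrZ.
  have -> : `|s| = 1 by case: sE => ->; rewrite ?normrN normr1.
  rewrite mul1r normrZ gtr0_norm//.
  have := @norm_delta R N k; nra.
have := dP _ (hb 1 (or_introl erefl)); have := dP _ (hb (-1) (or_intror erefl)).
rewrite /= scale1r scaleN1r dotvN quadN sqnN quadZr sqnZ quad_delta sqn_delta.
rewrite dotvZr dotvC /dotv -rowE !mxE.
rewrite !ler_norml => /andP[h1 h2] /andP[h3 h4].
apply/andP; split; nra.
Qed.

Lemma msize_mderiv i p k : (msize p <= k.+1)%N -> (msize (mderiv i p) <= k)%N.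
Proof.
move=> pk; rewrite msizeE; apply/bigmax_leqP_seq => m mp _.
have : mcoeff m (mderiv i p) != 0 by rewrite -mcoeff_msupp.
rewrite mcoeff_deriv => h.
have : mcoeff (mnm_add m (mnm1 i)) p != 0.
  by apply: contra h => /eqP ->; rewrite mul0rn.
rewrite -mcoeff_msupp => /msize_mdeg_lt; rewrite mdegD mdeg1 addn1 => h'.
by have := leq_trans h' pk.
Qed.

(** Induction on the degree: where [p] vanishes locally its gradient does too, so all partial
    derivatives vanish as polynomials and [p] is constant. *)
Lemma peval_eq0_near p x : (\forall y \near x, peval p y = 0) -> p = 0.
Proof.
have [k] := ubnP (msize p); elim: k p => // k IH p pk px.
have [//|p0] := eqVneq p 0.
have hx y : peval p y = 0 -> (\forall z \near y, peval p z = 0) ->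
    forall i, peval (mderiv i p) y = 0.
  move=> y0 yn i; have [H [t _]] := taylor2_peval p y.
  have : (\row_i peval (mderiv i p) y) = 0.
    have sh : \forall h \near (0 : V), peval p (y + h) = 0.
      move: yn => /nbhs_ballP[d /= d0 dP].
      apply/nbhs_ballP; exists d => //= h yh; apply: dP.
      by move: yh; rewrite -!ball_normE /= sub0r normrN opprD addNKr normrN.
    apply: (@jet_eq0 _ H); apply: filterS2 sh (t 1 ltr01) => h -> /=.
    by rewrite y0 mul1r subrr sub0r -opprD normrN.
  by move=> /rowP/(_ i); rewrite !mxE.
have d0 i : mderiv i p = 0.
  apply: IH => //.
    rewrite ltnS in pk; case: k pk => [|k] pk; last first.
      by rewrite ltnS; exact: msize_mderiv.
    by move: pk; rewrite leqn0 msize_poly_eq0 (negPf p0).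
  move: (px) => /near_join; apply: filterS => y py.
  by apply: hx => //; exact: nbhs_singleton py.
(* A coefficient of a monomial containing the variable [i] reappears in [mderiv i p], multiplied by
   a positive integer. *)
have pC : p = mpolyC N (mcoeff mnm0 p).
  apply/mpolyP => m; rewrite mcoeffC; case: eqVneq => [->|m0]; first by rewrite mulr1.
  rewrite mulr0; have [i mi] : exists i, m i != 0%N.
    apply/existsP; apply: contraR m0; rewrite negb_exists => /forallP mi.
    by apply/eqP/mnmP => i; rewrite mnm0E; apply/eqP; have := mi i; rewrite negbK.
  have : mcoeff (mnm_sub m (mnm1 i)) (mderiv i p) = 0 by rewrite d0 mcoeff0.
  rewrite mcoeff_deriv submK ?lep1mP// => /eqP.
  by rewrite mulrn_eq0 /= => /eqP.
have := nbhs_singleton px.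
by rewrite {1}pC /peval mevalC => c0; rewrite pC c0 mpolyC0.
Qed.

End Polynomials.

(** * The Dirichlet problem with polynomial data *)

Section Dirichlet.
Context {R : realType} {N : nat}.
Local Notation V := 'rV[R]_N.
Local Notation pol := (mpoly N R).
Implicit Types (x y h b : V) (p q s : pol) (r : R).

(** Euclidean balls are used because the sphere is the zero set of the polynomial r^2 - |x|^2, on
    which the Dirichlet problem below is built. *)
Lemma compact_eball r : compact [set x : V | sqn x <= r ^+ 2].
Proof.
apply: bounded_closed_compact.
  exists `|r|; split; first by rewrite num_real.
  move=> M rM x /= xr; apply: le_trans (ltW rM); apply: norm_le_sqn => //.
  by rewrite real_normK ?num_real.
rewrite (_ : mkset _ = sqn @^-1` [set t | t <= r ^+ 2])//.
by apply: closed_comp; [move=> x _; exact: continuous_sqn|exact: closed_le].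
Qed.

Lemma eball_max (w : V -> R) r : continuous w -> exists2 y,
  sqn y <= r ^+ 2 & forall x, sqn x <= r ^+ 2 -> w x <= w y.
Proof.
move=> cw.
have b0 : [set x : V | sqn x <= r ^+ 2] !=set0.
  by exists 0 => /=; rewrite sqn0 sqr_ge0.
have [y] := compact_EVT_max b0 (@compact_eball r) (continuous_subspaceT cw).
by rewrite inE => yr ym; exists y => // x xr; apply: ym; rewrite inE.
Qed.

Lemma near_translate x (P : V -> Prop) :
  (\forall y \near x, P y) <-> \forall h \near (0 : V), P (x + h).
Proof.
split=> /nbhs_ballP[d /= d0 dP]; apply/nbhs_ballP; exists d => //= y.
  rewrite -ball_normE /= sub0r normrN => yd; apply: dP.
  by rewrite -ball_normE /= opprD addNKr normrN.
rewrite -ball_normE /= distrC => yd.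
rewrite -[y](subrK x) addrC; apply: dP.
by rewrite -ball_normE /= sub0r normrN.
Qed.

Lemma continuous_dist_lt (w : V -> R) y (e : R) : continuous w -> 0 < e ->
  \forall x \near y, `|w y - w x| < e.
Proof. by move=> cw e0; move: (cw y) => /cvgrPdist_lt; exact. Qed.

Lemma eball_near y r : sqn y < r ^+ 2 ->
  \forall h \near (0 : V), sqn (y + h) <= r ^+ 2.
Proof.
move=> yr; apply: (near_translate y (fun z => sqn z <= r ^+ 2)).1.
move: yr; rewrite -subr_gt0 => /(continuous_dist_lt y (@continuous_sqn R N)).
apply: filterS => x.
by rewrite ltr_norml => /andP[+ _]; lra.
Qed.

Lemma near0_sqn (P : V -> Prop) : (\forall h \near (0 : V), P h) <->
  exists2 r : R, 0 < r & forall h, sqn h <= r ^+ 2 -> P h.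
Proof.
split=> [/nbhs_ballP[d /= d0 dP]|[r r0 rP]].
  exists (d / 2) => [|h hd]; first by rewrite divr_gt0.
  apply: dP; rewrite -ball_normE /= sub0r normrN.
  apply: (@le_lt_trans _ _ (d / 2)); last by lra.
  by apply: norm_le_sqn hd; lra.
have r2 : 0 < r ^+ 2 by rewrite exprn_gt0.
have := continuous_dist_lt 0 (@continuous_sqn R N) r2.
apply: filterS => h; rewrite sqn0 sub0r normrN ger0_norm ?sqn_ge0// => hr.
exact: rP (ltW hr).
Qed.

(* An interior maximum would contradict the second derivative test. *)
Lemma jet_max_sphere (g : V -> R) r : continuous g ->
  (forall x, sqn x <= r ^+ 2 -> exists b H, taylor2 g x b H /\ 0 < \tr H) ->
  forall x, sqn x <= r ^+ 2 -> exists2 y, sqn y = r ^+ 2 & g x <= g y.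
Proof.
move=> cg lg x xr; have [y yr ym] := eball_max r cg.
exists y; last exact: ym.
apply/eqP; rewrite eq_le yr /= leNgt; apply/negP => yr'.
have [b [H [t]]] := lg y yr; apply/negP; rewrite -leNgt.
apply: (@jet_max _ _ b) => e e0.
near=> h.
have h1 : `|g (y + h) - g y - dotv b h - quad H h| <= e * sqn h.
  by near: h; exact: t.
have h2 : g (y + h) <= g y.
  by apply: ym; near: h; exact: eball_near.
by move: h1; rewrite ler_norml => /andP[+ _]; lra.
Unshelve. all: by end_near. Qed.

Lemma subharmonic_max p r :
  (forall x, sqn x <= r ^+ 2 -> 0 < peval (mlap p) x) ->
  forall x, sqn x <= r ^+ 2 -> exists2 y, sqn y = r ^+ 2 & peval p x <= peval p y.
Proof.
move=> lp; apply: jet_max_sphere; first exact: continuous_peval.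
move=> x xr; have [H [t tr]] := taylor2_peval p x.
by do 2!eexists; split; [exact: t|have := lp x xr; lra].
Qed.

Lemma mderiv_msq i : mderiv i (@msq R N) = Xv i *+ 2.
Proof.
have d j : mderiv i (Xv j ^+ 2 : pol) = Xv j *+ 2 *+ (i == j).
  by rewrite expr2 mderivM mderiv_Xv; case: eqVneq => _; rewrite ?mulr1n; ring.
have -> : mderiv i (@msq R N) = \sum_j mderiv i (Xv j ^+ 2).
  exact: (raddf_sum (mderiv i)).
rewrite (eq_bigr _ (fun j _ => d j)) (bigD1 i)//= eqxx big1 ?addr0// => j ji.
by rewrite eq_sym (negPf ji).
Qed.

Lemma mlap_msq : mlap (@msq R N) = mpolyC N (2 * N%:R).
Proof.
rewrite /mlap (eq_bigr (fun=> 2)); last first.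
  by move=> i _; rewrite mderiv_msq mderivMn mderiv_Xv eqxx.
by rewrite sumr_const card_ord rmorphM /= !rmorph_nat mulr_natr.
Qed.

(** Adding [d *: msq] makes the Laplacian the positive constant 2 d N, so the strict maximum
    principle applies; [d] is chosen so that the boundary values rise by at most [e]. *)
Lemma harmonic_le0 p r : (0 < N)%N -> mlap p = 0 ->
  (forall x, sqn x = r ^+ 2 -> peval p x = 0) ->
  forall x, sqn x <= r ^+ 2 -> peval p x <= 0.
Proof.
move=> N0 lp p0 x xr; apply/ler_addgt0Pl => e e0; rewrite addr0.
have r1 : 0 < r ^+ 2 + 1 by rewrite ltr_wpDl// sqr_ge0.
pose d := e / (r ^+ 2 + 1); have d0 : 0 < d by rewrite divr_gt0.
have [|y yr] := @subharmonic_max (p + d *: msq) r _ x xr.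
  move=> y _; rewrite mlapD mlapZ lp add0r mlap_msq /peval mevalZ mevalC.
  by apply: mulr_gt0 => //; apply: mulr_gt0 => //; rewrite ltr0n.
rewrite /peval !mevalD !mevalZ -!/(peval _ _) !peval_msq (p0 y)// add0r yr => h.
have : d * r ^+ 2 <= e.
  by rewrite /d mulrAC ler_pdivrMr// ler_pM2l// lerDl.
by have := mulr_ge0 (ltW d0) (sqn_ge0 x); lra.
Qed.

Lemma harmonic_eq0 p r : (0 < N)%N -> mlap p = 0 ->
  (forall x, sqn x = r ^+ 2 -> peval p x = 0) ->
  forall x, sqn x <= r ^+ 2 -> peval p x = 0.
Proof.
move=> N0 lp p0 x xr; apply/eqP; rewrite eq_le (harmonic_le0 N0 lp p0)//=.
rewrite -oppr_le0 /peval -mevalN; apply: harmonic_le0 xr => //.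
  by rewrite -scaleN1r mlapZ lp scaler0.
by move=> y yr; rewrite /peval mevalN -/(peval _ _) p0// oppr0.
Qed.

(** Fischer's operator. The factor r^2 - |x|^2 vanishes on the sphere and raises the degree by two,
    which the Laplacian takes back, so each space of polynomials of bounded degree is mapped to
    itself. *)
Definition dirichlet_op r s : pol := mlap ((mpolyC N (r ^+ 2) - msq) * s).

Lemma peval_bump r s x :
  peval ((mpolyC N (r ^+ 2) - msq) * s) x = (r ^+ 2 - sqn x) * peval s x.
Proof. by rewrite /peval mevalM mevalB mevalC -[meval _ msq]/(peval msq x) peval_msq. Qed.

(** If the image is 0, then (r^2 - |x|^2) s is harmonic and vanishes on the sphere, hence in the
    ball. The factor is positive inside, so [s] vanishes near 0. *)
Lemma dirichlet_op_inj r s : (0 < N)%N -> 0 < r -> dirichlet_op r s = 0 -> s = 0.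
Proof.
move=> N0 r0 s0; apply: (@peval_eq0_near _ _ _ 0).
have r2 : 0 < r ^+ 2 by rewrite exprn_gt0.
have := continuous_dist_lt 0 (@continuous_sqn R N) r2.
apply: filterS => x; rewrite sqn0 sub0r normrN ger0_norm ?sqn_ge0// => xr.
have : peval ((mpolyC N (r ^+ 2) - msq) * s) x = 0.
  apply: harmonic_eq0 (ltW xr) => // y yr.
  by rewrite peval_bump yr subrr mul0r.
by move/eqP; rewrite peval_bump mulf_eq0 subr_eq0 (gt_eqF xr) => /eqP.
Qed.

(** [msize] is the degree plus one, and 0 for the zero polynomial; taking predecessors gives a bound
    on the degree that covers zero factors as well. *)
Lemma msizeM_pred p q : ((msize (p * q)).-1 <= (msize p).-1 + (msize q).-1)%N.
Proof.
have [->|nz_p] := eqVneq p 0; first by rewrite mul0r msize0.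
have [->|nz_q] := eqVneq q 0; first by rewrite mulr0 msize0.
have [->|nz_pq] := eqVneq (p * q) 0; first by rewrite msize0.
rewrite -!mlead_deg //=.
by have /lemc_mdeg := mleadM_le p q; rewrite mdegD.
Qed.

Lemma msize_msq : (msize (@msq R N) <= 3)%N.
Proof.
rewrite /msq; apply: leq_trans (mmeasure_sum _ _ _ _) _.
apply/bigmax_leqP => i _.
have := msizeM_pred (@Xv R N i) (Xv i).
rewrite -expr2 /Xv !msizeX /= !mdeg1.
by case: mmeasure => [|m].
Qed.

Lemma msize_dirichlet_op r s k :
  (msize s <= k)%N -> (msize (dirichlet_op r s) <= k)%N.
Proof.
have [->|s0] := eqVneq s 0.
  by rewrite /dirichlet_op mulr0 /mlap big1 ?msize0// => i _; rewrite !mderiv0.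
move=> sk; rewrite /dirichlet_op /mlap.
apply: leq_trans (mmeasure_sum _ _ _ _) _; apply/bigmax_leqP => i _.
apply: msize_mderiv; apply: msize_mderiv.
have := msizeM_pred (mpolyC N (r ^+ 2) - msq) s.
have h3 : (msize (mpolyC N (r ^+ 2) - @msq R N) <= 3)%N.
  apply: leq_trans (msizeD_le _ _) _; rewrite geq_max msizeN msize_msq andbT.
  by rewrite msizeC; case: (_ != _).
have : (0 < msize s)%N by rewrite lt0n msize_poly_eq0.
move: h3 sk.
move: (mmeasure _ (_ * _)) (mmeasure _ (_ - _)) (mmeasure _ s) => a b c.
lia.
Qed.

(** An injective endomorphism of a finite-dimensional space is onto. The space is that of
    coefficient vectors indexed by the monomials of degree less than [k]; [P] and [C] translate to
    polynomials and back. *)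
Lemma dirichlet_op_surj r k p : (0 < N)%N -> 0 < r -> (msize p <= k)%N ->
  exists s, dirichlet_op r s = p.
Proof.
move=> N0 r0 pk.
pose E := {ffun bmultinom N k -> R^o}.
pose P (c : E) : pol := \sum_(m : bmultinom N k) (c m : R) *: mpolyX R (bmnm m).
pose C (q : pol) : E := [ffun m : bmultinom N k => mcoeff (bmnm m) q].
have PK c : C (P c) = c.
  apply/ffunP => m; rewrite ffunE /P.
  rewrite raddf_sum (bigD1 m)//= big1 ?addr0 => [|m' mm'].
    by rewrite mcoeffZ mcoeffX eqxx mulr1.
  by rewrite mcoeffZ mcoeffX -bmeqP (negPf mm') mulr0.
have CK q : (msize q <= k)%N -> P (C q) = q.
  move=> qk; rewrite [RHS](mpolywE qk) /P; apply: eq_bigr => m _.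
  by rewrite ffunE.
have Pk c : (msize (P c) <= k)%N.
  apply: leq_trans (mmeasure_sum _ _ _ _) _; apply/bigmax_leqP => m _.
  by apply: leq_trans (mmeasureZ_le _ _ _) _; rewrite mmeasureX; exact: bmdeg.
have Plin : linear P.
  move=> a c d; rewrite /P scaler_sumr -big_split; apply: eq_bigr => m _ /=.
  by rewrite !ffunE scalerDl scalerA.
have Clin : linear C.
  by move=> a q q'; apply/ffunP => m; rewrite !ffunE mcoeffD mcoeffZ.
have Dlin a q q' : dirichlet_op r (a *: q + q') =
    a *: dirichlet_op r q + dirichlet_op r q'.
  by rewrite /dirichlet_op mulrDr -scalerAr mlapD mlapZ.
pose T (c : E) : E := C (dirichlet_op r (P c)).
have Tlin : linear T by move=> a c d; rewrite /T Plin Dlin Clin.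
pose T' : {linear E -> E} := HB.pack T (GRing.isLinear.Build R E E _ T Tlin).
pose f : 'End(E) := linfun T'.
have f0 : lker f == 0%VS.
  apply/lker0P => c d; rewrite !lfunE /= /T => cd.
  have : dirichlet_op r (P c) = dirichlet_op r (P d).
    by rewrite -(CK (dirichlet_op r (P c))) ?msize_dirichlet_op// cd CK// msize_dirichlet_op.
  move/eqP; rewrite -subr_eq0 => /eqP cd0.
  rewrite -(PK c) -(PK d); congr C; apply/eqP; rewrite -subr_eq0; apply/eqP.
  apply: dirichlet_op_inj N0 r0 _.
  by rewrite addrC -scaleN1r Dlin scaleN1r addrC.
exists (P (f^-1%VF (C p))).
rewrite -[RHS](CK p)// -[X in _ = P X](lker0_lfunVK f0) [in RHS]lfunE /= /T.
by rewrite CK// msize_dirichlet_op.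
Qed.

(** The solution is q + (r^2 - |x|^2) s, where [s] is chosen so that the second term has Laplacian c
    minus that of [q]. *)
Lemma dirichlet_pol q (c : R) r : (0 < N)%N -> 0 < r -> exists p,
  (forall x, sqn x = r ^+ 2 -> peval p x = peval q x) /\ mlap p = mpolyC N c.
Proof.
move=> N0 r0.
have [s sE] := dirichlet_op_surj N0 r0 (leqnn (msize (mpolyC N c - mlap q))).
exists (q + (mpolyC N (r ^+ 2) - msq) * s); split.
  by move=> x xr; rewrite {1}/peval mevalD -/(peval q x)
    -[X in _ + X]/(peval _ x) peval_bump xr subrr mul0r addr0.
by rewrite mlapD -/(dirichlet_op r s) sE addrC subrK.
Qed.

End Dirichlet.

(** * Weierstrass approximation *)

Section Weierstrass.
Context {R : realType} {N : nat}.
Local Notation V := 'rV[R]_N.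
Local Notation pol := (mpoly N R).
Implicit Types (x y z h b : V) (p q : pol) (r s : R) (f g w : V -> R) (l : seq 'I_N).

(** The radius found near each point also works for pairs based at neighbouring points, and
    compactness makes it uniform. Only [x] is confined to [K]. *)
Lemma compact_uniform_continuity (K : set V) w : compact K -> continuous w ->
  forall e : R, 0 < e -> exists2 d : R, 0 < d &
    forall x y, K x -> `|x - y| < d -> `|w x - w y| < e.
Proof.
move=> /compact_near_coveringP cK cw e e0.
have e2 : 0 < e / 2 by lra.
have /(_ _) := cK R (0^'+) (fun d x => forall y, `|x - y| < d -> `|w x - w y| < e) _.
case=> [x Kx|]; last first.
  move=> d /= d0 dP.
  exists (d / 2); first by rewrite divr_gt0.
  move=> x y Kx; apply: (dP (d / 2)) => //=; last by rewrite divr_gt0.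
  by rewrite sub0r normrN gtr0_norm ?divr_gt0//; lra.
have /nbhs_ballP[d /= d0 dP] := continuous_dist_lt x cw e2.
have d2 : 0 < d / 2 by lra.
exists (ball x (d / 2), [set t : R | t < d / 2]) => /=.
  split; first exact: nbhsx_ballx.
  exact: nbhs_right_lt.
move=> [x' t] /= [xx' td] y x'y.
have h1 : `|w x - w x'| < e / 2.
  by apply: dP; apply: le_ball xx'; lra.
have h2 : `|w x - w y| < e / 2.
  apply: dP; rewrite -ball_normE /=.
  move: xx'; rewrite -ball_normE /= => xx'.
  by have := ler_distD x' x y; lra.
rewrite distrC in h1.
by have := ler_distD (w x) (w x') (w y); lra.
Qed.

(* [walk_mean y s f l z] is the expectation of [f] at the end of the random walk
   that starts at [z] and, for each [i] in [l], moves by [s] along the [i]-th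
   axis with probability [y i]; with [m] steps along each axis its law is the
   one of the Bernstein polynomials. *)
Fixpoint walk_mean y s f l z : R := if l is i :: l' then
    y 0 i * walk_mean y s f l' (z + s *: delta_mx 0 i) +
    (1 - y 0 i) * walk_mean y s f l' z
  else f z.

(** The expectation as a polynomial in x, for the probabilities (x_i + r) / (2 r), which lie in
    [0, 1] when x is in the cube of half-side [r]. *)
Fixpoint walk_pol r s f l z : pol := if l is i :: l' then
    ((2 * r)^-1 *: (Xv i + mpolyC N r)) * walk_pol r s f l' (z + s *: delta_mx 0 i) +
    (1 - (2 * r)^-1 *: (Xv i + mpolyC N r)) * walk_pol r s f l' z
  else mpolyC N (f z).

Lemma peval_walk r s f l z x : peval (walk_pol r s f l z) x =
  walk_mean (\row_i ((2 * r)^-1 * (x 0 i + r))) s f l z.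
Proof.
elim: l z => [|i l IH] z /=; first by rewrite /peval mevalC.
rewrite -!IH !mxE /peval mevalD !mevalM mevalB meval1 mevalZ mevalD /Xv mevalXU.
by rewrite mevalC.
Qed.

Lemma walk_mean_affine y s f a c l z :
  walk_mean y s (fun t => a + c * f t) l z = a + c * walk_mean y s f l z.
Proof. by elim: l z => [|i l IH] z //=; rewrite !IH; ring. Qed.

Lemma walk_mean_le y s f g l z : (forall i, 0 <= y 0 i <= 1) ->
  (forall t, f t <= g t) -> walk_mean y s f l z <= walk_mean y s g l z.
Proof.
move=> y01 fg; elim: l z => [|i l IH] z //=.
have /andP[y0 y1] := y01 i.
by apply: lerD; apply: ler_wpM2l => //; lra.
Qed.

(** The steps are independent, so the mean squared distance to [c] is the squared distance of the
    mean end point plus the sum of the variances of the steps. *)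
Lemma walk_mean_sqn y s c l z :
  walk_mean y s (fun t => sqn (t - c)) l z =
  sqn (z + s *: (\sum_(i <- l) y 0 i *: delta_mx 0 i) - c) +
  s ^+ 2 * \sum_(i <- l) y 0 i * (1 - y 0 i).
Proof.
elim: l z => [|i l IH] z /=; first by rewrite !big_nil scaler0 addr0 mulr0 addr0.
rewrite !IH !big_cons scalerDr.
set D := z + s *: (\sum_(j <- l) y 0 j *: delta_mx 0 j) - c.
set A := \sum_(j <- l) y 0 j * _.
have -> : z + s *: delta_mx 0 i + s *: (\sum_(j <- l) y 0 j *: delta_mx 0 j) - c =
    D + s *: delta_mx 0 i :> V by rewrite /D -!addrA; congr (_ + _); rewrite addrCA [- c + _]addrC !addrA.
have -> : z + (s *: (y 0 i *: delta_mx 0 i) +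
    s *: (\sum_(j <- l) y 0 j *: delta_mx 0 j)) - c = D + s *: (y 0 i *: delta_mx 0 i) :> V.
  by rewrite /D -!addrA; congr (_ + _); rewrite addrCA [- c + _]addrC !addrA.
by rewrite !sqnD !sqnZ !dotvZr sqn_delta; ring.
Qed.

Lemma big_iter_enum (U : nmodType) (F : 'I_N -> U) m :
  \sum_(i <- iter m (cat (enum 'I_N)) [::]) F i = (\sum_i F i) *+ m.
Proof.
elim: m => [|m IH] /=; first by rewrite big_nil mulr0n.
by rewrite big_cat IH mulrS /= big_enum.
Qed.

(** Bernstein's argument: |f x - f z| is at most e/2 when z is close to x and at most 2 B always,
    hence at most e/2 + C |z - x|^2. Taking the mean over end points z leaves the variance, which is
    O(1/m). *)
Lemma weierstrass_bounded f (r e B : R) : 0 < r -> 0 < e -> continuous f ->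
  (forall x, `|f x| <= B) ->
  exists p, forall x, sqn x <= r ^+ 2 -> `|f x - peval p x| <= e.
Proof.
move=> r0 e0 cf fB.
have B0 : 0 <= B by apply: le_trans (fB 0).
have e2 : 0 < e / 2 by lra.
have [d d0 dP] := compact_uniform_continuity (@compact_eball R N r) cf e2.
have d2 : 0 < (d / 2) ^+ 2 by rewrite exprn_gt0// divr_gt0.
pose C := 2 * B / (d / 2) ^+ 2.
have C0 : 0 <= C by apply: divr_ge0; [exact: mulr_ge0|exact: ltW].
have fC x z : sqn x <= r ^+ 2 -> `|f x - f z| <= e / 2 + C * sqn (z - x).
  move=> xr; have [zx|zx] := ltP (sqn (z - x)) ((d / 2) ^+ 2).
    apply: (@le_trans _ _ (e / 2)); last by rewrite lerDl; exact: mulr_ge0 (sqn_ge0 _).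
    apply/ltW/dP => //; rewrite -normrN opprB.
    apply: (@le_lt_trans _ _ (d / 2)); last by lra.
    by apply: norm_le_sqn (ltW zx); lra.
  apply: (@le_trans _ _ (2 * B)).
    by have := ler_normB (f x) (f z); have := fB x; have := fB z; lra.
  apply: (@le_trans _ _ (C * sqn (z - x))); last by lra.
  rewrite /C -mulrA ler_peMr ?mulr_ge0// mulrC ler_pdivlMr// mul1r//.
have [m m0 mC] : exists2 m : nat, 0 < m%:R :> R &
    C * (4 * r ^+ 2 * N%:R) / (e / 2) <= m%:R.
  exists (Num.bound (C * (4 * r ^+ 2 * N%:R) / (e / 2))).+1; first by rewrite ltr0n.
  have X0 : 0 <= C * (4 * r ^+ 2 * N%:R) / (e / 2).
    apply: divr_ge0; last exact: ltW.
    apply: mulr_ge0 => //; apply: mulr_ge0 => //; apply: mulr_ge0 => //.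
    exact/exprn_ge0/ltW.
  by apply: ltW; apply: lt_le_trans (archi_boundP X0) _; rewrite ler_nat.
(* With [m] steps of this length along each axis, the walk that starts at the corner (-r, ..., -r)
   has mean end point exactly x. *)
pose s := 2 * r / m%:R.
pose p := walk_pol r s f (iter m (cat (enum 'I_N)) [::]) (const_mx (- r)).
exists p => x xr.
rewrite /p peval_walk; set y := \row_i _; set z0 := const_mx _; set l := iter _ _ _.
have y01 i : 0 <= y 0 i <= 1.
  rewrite mxE mulrC; have := le_trans (sqn_coord x i) xr.
  rewrite -real_normK ?num_real// ler_sqr ?nnegrE ?(ltW r0)// ler_norml => /andP[h1 h2].
  by rewrite ler_pdivlMr ?ler_pdivrMr ?mulr_gt0//; apply/andP; split; lra.
have V0 : walk_mean y s (fun t => sqn (t - x)) l z0 <= 4 * r ^+ 2 * N%:R / m%:R.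
  rewrite walk_mean_sqn !big_iter_enum.
  rewrite (_ : z0 + _ - x = 0) ?sqn0 ?add0r.
    set S := \sum_i _; rewrite -(mulr_natl S) [leLHS]mulrA /s.
    have -> : (2 * r / m%:R) ^+ 2 * m%:R = 4 * r ^+ 2 / m%:R :> R by field; rewrite gt_eqF.
    rewrite -[leRHS]mulrA [N%:R / _]mulrC [leRHS]mulrA ler_wpM2l//.
      by rewrite !mulr_ge0// ?invr_ge0 ?ltW// exprn_gt0.
    rewrite -[X in _ <= X%:R]card_ord -sumr_const; apply: ler_sum => i _.
    have /andP[h1 h2] := y01 i; nra.
  apply/rowP => k; rewrite !mxE mulmxnE summxE.
  rewrite (bigD1 k)//= big1 => [|j jk].
    rewrite !mxE !eqxx mulr1 addr0 /s -[X in _ * X]mulr_natl.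
    by field; rewrite !gt_eqF.
  by rewrite !mxE eq_sym (negPf jk) andbF mulr0.
have V1 : C * walk_mean y s (fun t => sqn (t - x)) l z0 <= e / 2.
  apply: le_trans (ler_wpM2l C0 V0) _.
  by rewrite mulrA ler_pdivrMr// -ler_pdivrMl// mulrC.
rewrite ler_norml; apply/andP; split.
  rewrite lerBrDl.
  have h : forall t, f t <= f x + e / 2 + C * sqn (t - x).
    by move=> t; have := fC x t xr; rewrite ler_norml => /andP[+ _]; lra.
  have := walk_mean_le s l z0 y01 h.
  rewrite (walk_mean_affine y s (fun t => sqn (t - x))); lra.
have h : forall t, f x - e / 2 + (- C) * sqn (t - x) <= f t.
  by move=> t; have := fC x t xr; rewrite ler_norml => /andP[_]; lra.
have := walk_mean_le s l z0 y01 h.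
rewrite (walk_mean_affine y s (fun t => sqn (t - x))); lra.
Qed.

(** Truncation at the bounds [- B] and [B] of [w] on the ball makes the function bounded everywhere
    and does not change it on the ball. *)
Lemma weierstrass_eball w (r e : R) : 0 < r -> 0 < e -> continuous w ->
  exists p, forall x, sqn x <= r ^+ 2 -> `|w x - peval p x| <= e.
Proof.
move=> r0 e0 cw.
have [y1 _ h1] := eball_max r cw.
have cNw : continuous (fun x => - w x) by move=> x; apply: continuousN; exact: cw.
have [y2 _ h2] := eball_max r cNw.
pose B := Num.max `|w y1| `|w y2|.
pose f x := Num.max (- B) (Num.min B (w x)).
have B0 : 0 <= B by rewrite le_max normr_ge0.
have fw x : sqn x <= r ^+ 2 -> f x = w x.
  move=> xr; have h3 : w x <= B.
    by rewrite le_max (le_trans (h1 x xr))// ler_norm.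
  have h4 : - B <= w x.
    rewrite lerNl le_max; apply/orP; right.
    by rewrite (le_trans (h2 x xr))// -normrN ler_norm.
  by rewrite /f (min_idPr h3) (max_idPr h4).
have fB x : `|f x| <= B.
  rewrite ler_norml /f le_max lexx /= ge_max ge_min lexx /= andbT.
  by rewrite -subr_ge0 opprK addr_ge0.
have cf : continuous f.
  move=> x.
  have c1 : {for x, continuous (cst B \min w : V -> R^o)}.
    exact: continuous_min (@cst_continuous _ _ B x) (cw x).
  exact: (@continuous_max _ _ (cst (- B)) _ x (@cst_continuous _ _ _ x) c1).
have [p pP] := weierstrass_bounded r0 e0 cf fB.
by exists p => x xr; rewrite -fw//; exact: pP.
Qed.

End Weierstrass.

(** * Viscosity subsolutions of linear equations *)

Section LinearViscosity.
Context {R : realType} {N : nat}.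
Local Notation V := 'rV[R]_N.
Local Notation pol := (mpoly N R).
Implicit Types (x y z h b : V) (p q : pol) (r : R) (w : V -> R) (H M : 'M[R]_N) (W : set V).

(** The inequality tr(M D^2 w M^T) >= c in the viscosity sense, the factor 2 coming from D^2 = H +
    H^T. For the identity matrix the operator is the Laplacian. *)
Definition visc M (c : R) (W : set V) w : Prop := forall x b H,
  W x -> superjet w x b H -> c <= 2 * \tr (M *m H *m M^T).

Lemma pevalD p q x : peval (p + q) x = peval p x + peval q x.
Proof. exact: mevalD. Qed.

Lemma pevalC (c : R) x : peval (mpolyC N c) x = c.
Proof. exact: mevalC. Qed.

Lemma taylor2_quad H x : taylor2 (quad H) x (x *m (H + H^T)) H.
Proof.
apply: (@o2_ext _ _ (fun=> 0)) => [h|e e0]; last first.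
  by near=> h; rewrite normr0 mulr_ge0 ?sqn_ge0// ltW.
by rewrite quadDr; ring.
Unshelve. all: by end_near. Qed.

Lemma taylor2_dotv b x : taylor2 (dotv b) x b 0.
Proof.
apply: (@o2_ext _ _ (fun=> 0)) => [h|e e0]; last first.
  by near=> h; rewrite normr0 mulr_ge0 ?sqn_ge0// ltW.
by rewrite dotvDr /quad mulmx0 mul0mx [X in _ - X]mxE; ring.
Unshelve. all: by end_near. Qed.

Lemma taylor2Z a w x b H : taylor2 w x b H ->
  taylor2 (fun y => a * w y) x (a *: b) (a *: H).
Proof.
have ca : (fun=> a) @ (0 : V) --> a by exact: (@cst_continuous V R a 0).
move=> t; apply: o2_ext (o2M_bounded t ca) => h /=.
by rewrite dotvZl quadZ; ring.
Qed.

Lemma continuous_translate x w : continuous w -> continuous (fun y => w (x + y)).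
Proof.
move=> cw y; apply: continuous_comp; last exact: cw.
by apply: continuousD; [exact: cst_continuous|exact: (@cvg_id _ (nbhs y))].
Qed.

Lemma continuous_translater x w : continuous w -> continuous (fun y => w (y + x)).
Proof.
move=> /(continuous_translate (x := x)) cw y; have := cw y.
by under eq_fun do rewrite addrC; rewrite /continuous_at addrC.
Qed.

Lemma visc_shift M c W w x : visc M c W w ->
  visc M c [set y | W (x + y)] (fun y => w (x + y)).
Proof.
move=> wv y b H /= Wy yj; apply: (wv (x + y) b) => // e e0.
by apply: filterS (yj e e0) => h; rewrite addrA.
Qed.

Lemma visc_subset M c W W' w : W' `<=` W -> visc M c W w -> visc M c W' w.
Proof. by move=> WW wv y b H /WW; exact: wv. Qed.

(** At an interior maximum of w - p the second order jet of [p] is a superjet of [w], which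
    contradicts the strict inequality on the Laplacian of [p]. *)
Lemma visc_cmp w (c r : R) p : continuous w ->
  visc 1%:M c [set y | sqn y < r ^+ 2] w ->
  (forall x, sqn x = r ^+ 2 -> w x <= peval p x) ->
  (forall x, peval (mlap p) x < c) ->
  forall x, sqn x <= r ^+ 2 -> w x <= peval p x.
Proof.
move=> cw wv wp lp x xr.
have cg : continuous (fun y => w y - peval p y).
  by move=> y; apply: continuousB; [exact: cw|exact: continuous_peval].
have [y yr ym] := eball_max r cg.
rewrite -subr_le0; apply: le_trans (ym x xr) _.
rewrite leNgt; apply/negP => y0.
have yr' : sqn y < r ^+ 2.
  by rewrite lt_neqAle yr andbT; apply/negP => /eqP /wp; lra.
have [H [t tr]] := taylor2_peval p y.
suff /(wv y _ H yr') : superjet w y (\row_i peval (mderiv i p) y) H.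
  by rewrite trmx1 mulmx1 mul1mx; have := lp y; lra.
move=> e e0; near=> h.
have h1 : peval p (y + h) <= peval p y + dotv (\row_i peval (mderiv i p) y) h
    + quad H h + e * sqn h by near: h; exact: taylor2_superjet t _ e0.
have h2 : w (y + h) - peval p (y + h) <= w y - peval p y.
  by apply: ym; near: h; exact: eball_near.
lra.
Unshelve. all: by end_near. Qed.

(** A superjet of the sum says nothing about superjets of the summands. Each summand is therefore
    bounded above on a small ball by a polynomial with prescribed Laplacian and nearly the same
    boundary values; if the claim failed, the sum of these polynomials minus the jet would violate
    the maximum principle. *)
Lemma visc1_add0 (c1 c2 : R) W w1 w2 b H : (0 < N)%N ->
  continuous w1 -> continuous w2 -> nbhs (0 : V) W ->
  visc 1%:M c1 W w1 -> visc 1%:M c2 W w2 ->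
  superjet (fun y => w1 y + w2 y) 0 b H -> c1 + c2 <= 2 * \tr H.
Proof.
move=> N0 cw1 cw2 W0 v1 v2 j; rewrite leNgt; apply/negP => gap0.
pose g := c1 + c2 - 2 * \tr H; have g0 : 0 < g by rewrite subr_gt0.
have N1 : 0 < N%:R :> R by rewrite ltr0n.
(* With this choice 4 e N = g/4; it bounds the Laplacian of the term 2 e |x|^2 subtracted in [G]. *)
pose e := g / (16 * N%:R); have e0 : 0 < e by rewrite divr_gt0// mulr_gt0.
have eN : 16 * (e * N%:R) = g by rewrite /e; field; rewrite gt_eqF.
have /near0_sqn[r r0 rP] : \forall h \near (0 : V), W h /\ 
    w1 h + w2 h <= w1 0 + w2 0 + dotv b h + quad H h + e * sqn h.
  near=> h; split; first by near: h.
  by have := near (j e e0) h; rewrite add0r; apply.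
have er0 : 0 < e * r ^+ 2 / 8 by rewrite divr_gt0// mulr_gt0// exprn_gt0.
have [q1 q1P] := weierstrass_eball r0 er0 cw1.
have [q2 q2P] := weierstrass_eball r0 er0 cw2.
(* On the sphere [q1] is within e r^2/8 of [w1], so the raised data lie between [w1] and w1 + e
   r^2/4. *)
have [p1 [p1r p1l]] := dirichlet_pol (q1 + mpolyC N (e * r ^+ 2 / 8)) (c1 - g / 8) N0 r0.
have [p2 [p2r p2l]] := dirichlet_pol (q2 + mpolyC N (e * r ^+ 2 / 8)) (c2 - g / 8) N0 r0.
have sub : [set y : V | sqn y < r ^+ 2] `<=` W by move=> y /= /ltW /rP[].
have r20 : sqn (0 : V) <= r ^+ 2 by rewrite sqn0 sqr_ge0.
have h1 : w1 0 <= peval p1 0.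
  apply: (visc_cmp cw1 (visc_subset sub v1)) r20 => [x xr|x].
    rewrite p1r// pevalD pevalC.
    by have := q1P x; rewrite xr lexx => /(_ isT); rewrite ler_norml => /andP[_]; lra.
  by rewrite p1l pevalC; lra.
have h2 : w2 0 <= peval p2 0.
  apply: (visc_cmp cw2 (visc_subset sub v2)) r20 => [x xr|x].
    rewrite p2r// pevalD pevalC.
    by have := q2P x; rewrite xr lexx => /(_ isT); rewrite ler_norml => /andP[_]; lra.
  by rewrite p2l pevalC; lra.
pose G x := peval (p1 + p2) x + (-1) * (dotv b x + quad (H + (2 * e)%:M) x).
have cG : continuous G.
  move=> x; apply: continuousD; first exact: continuous_peval.
  apply: continuousM; first exact: cst_continuous.
  by apply: continuousD; [exact: continuous_dotv|exact: continuous_quad].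
(* The Laplacian of [G] is g - 2 (g/8) - 4 e N = g/2 > 0. On the sphere, however, [G] is at most w1
   0 + w2 0 + e r^2 + e r^2/2 - 2 e r^2, which is less than [G 0]. *)
have [y yr yG] : exists2 y, sqn y = r ^+ 2 & G 0 <= G y.
  apply: (jet_max_sphere cG) r20 => x xr.
  have [K [t tr]] := taylor2_peval (p1 + p2) x.
  have t' := taylor2Z (-1) (taylor2D (taylor2_dotv b x) (taylor2_quad (H + (2 * e)%:M) x)).
  do 2!eexists; split; first exact: taylor2D t t'.
  move: tr; rewrite mxtraceD mxtraceZ !mxtraceD mxtrace0 mxtrace_scalar.
  rewrite mlapD p1l p2l pevalD !pevalC => tr.
  have : \tr K = (c1 - g / 8 + (c2 - g / 8)) / 2 by lra.
  move=> ->; rewrite -mulr_natr; rewrite /g in eN *; lra.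
have := rP y; rewrite yr lexx => /(_ isT)[_ yw].
move: yG; rewrite /G !quadD !pevalD dotv0 !quad0 (p1r y)// (p2r y)//.
rewrite !pevalD !pevalC.
have -> : quad (2 * e)%:M y = 2 * e * r ^+ 2.
  by rewrite -scalemx1 quadZ quad1 yr.
have := q1P y; rewrite yr lexx => /(_ isT); rewrite ler_norml => /andP[k1 _].
have := q2P y; rewrite yr lexx => /(_ isT); rewrite ler_norml => /andP[k2 _].
lra.
Unshelve. all: by end_near. Qed.

Lemma visc1_add (c1 c2 : R) W w1 w2 : (0 < N)%N ->
  continuous w1 -> continuous w2 -> open W ->
  visc 1%:M c1 W w1 -> visc 1%:M c2 W w2 ->
  visc 1%:M (c1 + c2) W (fun y => w1 y + w2 y).
Proof.
move=> N0 cw1 cw2 oW v1 v2 x b H Wx j; rewrite trmx1 mulmx1 mul1mx.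
apply: (visc1_add0 (b := b) N0 (continuous_translate (x := x) cw1)
  (continuous_translate (x := x) cw2) _ (visc_shift (x := x) v1)
  (visc_shift (x := x) v2)).
- exact: (near_translate x W).1 (open_nbhs_nbhs (conj oW Wx)).
- by move=> e e0; have := j e e0; apply: filterS => h; rewrite add0r addr0.
Qed.

Lemma sqn_mulmx M h : sqn (h *m M) = quad (M *m M^T) h.
Proof. by rewrite /sqn /dotv /quad trmx_mul !mulmxA. Qed.

Lemma superjet_comp w M x b H : superjet w (x *m M) b H ->
  superjet (fun y => w (y *m M)) x (b *m M^T) (M *m H *m M^T).
Proof.
have [C C0 HC] := quad_le_sqn (M *m M^T).
have C1 : 0 < C + 1 by lra.
have MC h : sqn (h *m M) <= (C + 1) * sqn h.
  rewrite sqn_mulmx; have := HC h; rewrite ler_norml => /andP[_]; have := sqn_ge0 h; lra.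
move=> j e e0.
have e1 : 0 < e / (C + 1) by rewrite divr_gt0.
have /near0_sqn[r r0 rP] := j _ e1.
apply/near0_sqn; exists (r / Num.sqrt (C + 1)).
  by rewrite divr_gt0// sqrtr_gt0.
move=> h; rewrite expr_div_n sqr_sqrtr ?(ltW C1)// ler_pdivlMr// => hr.
rewrite mulmxDl.
have /rP hM : sqn (h *m M) <= r ^+ 2.
  by apply: le_trans (MC h) _; rewrite mulrC.
apply: le_trans hM _.
rewrite (_ : dotv b (h *m M) = dotv (b *m M^T) h); last first.
  by rewrite /dotv trmx_mul mulmxA.
rewrite (_ : quad H (h *m M) = quad (M *m H *m M^T) h); last first.
  by rewrite /quad trmx_mul !mulmxA.
rewrite lerD2l -mulrA ler_pM2l// ler_pdivrMl//; exact: MC.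
Qed.

(** The linear substitution x -> x M turns the operator of [M] into the Laplacian, so additivity has
    to be proved only for the latter. *)
Lemma visc_comp M c W w : M \in unitmx ->
  visc M c W w <-> visc 1%:M c [set x | W (x *m M)] (fun x => w (x *m M)).
Proof.
move=> uM; split=> wv x b H /= Wx j.
  rewrite trmx1 mulmx1 mul1mx.
  have j' : superjet (fun y => w (y *m M)) (x *m M *m invmx M) b H.
    by rewrite mulmxK.
  have {}j' := superjet_comp j'.
  have := wv (x *m M) _ _ Wx (_ : superjet w _ _ _).
  have wE : (fun y => w (y *m invmx M *m M)) = w.
    by apply/funext => y; rewrite mulmxKV.
  rewrite wE in j'.
  move=> /(_ _ _ j'); rewrite !mulmxA mulmxV// mul1mx.
  by rewrite -mulmxA -trmx_mul mulmxV// trmx1 mulmx1.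
have j' : superjet w (x *m invmx M *m M) b H by rewrite mulmxKV.
have := wv (x *m invmx M) _ _ _ (superjet_comp j').
by rewrite /= mulmxKV// trmx1 mulmx1 mul1mx; apply.
Qed.

Lemma continuous_mulmxr M : continuous (fun x : V => x *m M).
Proof.
move=> x; apply/(@cvgrPdist_lt _ _ _ (nbhs x)) => e e0.
have [C C0 HC] := quad_le_sqn (M *m M^T).
apply/(near_translate x (fun y => `|x *m M - y *m M| < e)).
have C1 : 0 < C + 1 by lra.
apply/near0_sqn; exists (e / 2 / Num.sqrt (C + 1)).
  by rewrite !divr_gt0// sqrtr_gt0.
move=> h; rewrite expr_div_n sqr_sqrtr ?(ltW C1)// ler_pdivlMr// => hr.
rewrite mulmxDl opprD addNKr normrN.
apply: (@le_lt_trans _ _ (e / 2)); last by lra.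
apply: norm_le_sqn; first by lra.
rewrite sqn_mulmx.
by have := HC h; rewrite ler_norml => /andP[_]; have := sqn_ge0 h; lra.
Qed.

Lemma visc_add M (c1 c2 : R) W w1 w2 : (0 < N)%N -> M \in unitmx ->
  continuous w1 -> continuous w2 -> open W ->
  visc M c1 W w1 -> visc M c2 W w2 ->
  visc M (c1 + c2) W (fun y => w1 y + w2 y).
Proof.
move=> N0 uM cw1 cw2 oW /(visc_comp _ _ _ uM) v1 /(visc_comp _ _ _ uM) v2.
have cM w : continuous w -> continuous (fun x => w (x *m M)).
  by move=> cw x; apply: continuous_comp; [exact: continuous_mulmxr|exact: cw].
apply/(visc_comp _ _ _ uM); apply: visc1_add v1 v2 => //; try exact: cM.
by apply: open_comp oW => x _; exact: continuous_mulmxr.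
Qed.

Lemma visc_scale M (c a : R) W w : 0 < a -> visc M c W w ->
  visc M (a * c) W (fun y => a * w y).
Proof.
move=> a0 wv x b H Wx j.
have : superjet w x (a^-1 *: b) (a^-1 *: H).
  move=> e e0; have := j _ (mulr_gt0 a0 e0); apply: filterS => h.
  rewrite dotvZl quadZ => h1; rewrite -(ler_pM2l a0) !mulrDr.
  by rewrite !mulrA divff ?gt_eqF// !mul1r.
move/(wv _ _ _ Wx); rewrite -scalemxAr -scalemxAl mxtraceZ.
by rewrite mulrCA ler_pdivlMl.
Qed.

Lemma visc_sum M (c : R) W w m (s : nat -> V) : (0 < N)%N -> M \in unitmx ->
  continuous w -> open W ->
  (forall j, visc M c W (fun x => w (s j + x))) ->
  visc M (m.+1%:R * c) W (fun x => \sum_(j < m.+1) w (s j + x)).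
Proof.
move=> N0 uM cw oW wv; elim: m => [|m IH].
  rewrite mul1r (_ : (fun x => _) = fun x => w (s 0%N + x)); first exact: wv.
  by apply/funext => x; rewrite big_ord1.
rewrite -natr1 mulrDl mul1r.
rewrite (_ : (fun x => _) = fun x => \sum_(j < m.+1) w (s j + x) + w (s m.+1 + x)).
  apply: visc_add => //; last exact: continuous_translate.
  move=> x; apply: (@cvg_sumr _ _ (nbhs x)) => j /=; exact: continuous_translate.
by apply/funext => x; rewrite big_ord_recr.
Qed.

(** Steepening the jet by 2 d |h|^2 keeps the maximum of w' minus the polynomial inside a small ball
    once w' is close to [w]; the jet found there has second order part H + 2d. *)
Lemma visc_lim M (c : R) W w : open W ->
  (forall e : R, 0 < e -> exists w', [/\ continuous w', visc M c W w' &
     forall x, W x -> `|w x - w' x| <= e]) ->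
  visc M c W w.
Proof.
move=> oW wl x b H Wx j.
apply/ler_addgt0Pl => e e0.
have [D D0 HD] : exists2 D : R, 0 < D & 2 * \tr (M *m M^T) <= D.
  exists (Num.max 1 (2 * \tr (M *m M^T))); last by rewrite le_max lexx orbT.
  by rewrite lt_max ltr01.
(* Adding 2 d times the identity to [H] raises the value of the operator by 2 d times 2 tr(M M^T),
   hence by at most 2 d D = e. *)
pose d := e / D / 2; have d0 : 0 < d by rewrite !divr_gt0.
have /near0_sqn[r r0 rP] : \forall h \near (0 : V), W (x + h) /\
    w (x + h) <= w x + dotv b h + quad H h + d * sqn h.
  near=> h; split; near: h; last exact: j.
  by apply: (near_translate x W).1; exact: open_nbhs_nbhs.
have er0 : 0 < d * r ^+ 2 / 4 by rewrite divr_gt0// mulr_gt0// exprn_gt0.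
have [w' [cw' v' ww']] := wl _ er0.
pose g h := w' (x + h) - (dotv b h + quad (H + (2 * d)%:M) h).
have cg : continuous g.
  move=> y; apply: (@continuousB _ _ _ (fun h => w' (x + h))
    (fun h => dotv b h + quad (H + (2 * d)%:M) h)); first exact: continuous_translate.
  by apply: continuousD; [exact: continuous_dotv|exact: continuous_quad].
have [y yr ym] := eball_max r cg.
have [Wy jy] := rP y yr.
(* On the sphere the jet inequality loses d r^2 against 2 d r^2, and the two approximation errors
   amount to at most d r^2/2. *)
have yr' : sqn y < r ^+ 2.
  rewrite lt_neqAle yr andbT; apply/negP => /eqP yE.
  have := ym 0; rewrite sqn0 sqr_ge0 => /(_ isT); rewrite /g dotv0 quad0 addr0.
  have := ww' x Wx; have := ww' _ Wy; rewrite !ler_norml => /andP[k1 k2] /andP[k3 k4].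
  by rewrite quadD -scalemx1 quadZ quad1 yE in jy *; lra.
pose K := H + (2 * d)%:M.
have t' := taylor2D (taylor2_dotv b y) (taylor2_quad K y).
have /(v' _ _ _ Wy) : superjet w' (x + y) (b + y *m (K + K^T)) (0 + K).
  move=> e1 e10; near=> h.
  have h1 : dotv b (y + h) + quad K (y + h) <= dotv b y + quad K y +
      dotv (b + y *m (K + K^T)) h + quad (0 + K) h + e1 * sqn h.
    by near: h; exact: (taylor2_superjet t').
  have h2 : g (y + h) <= g y.
    by apply: ym; near: h; exact: eball_near.
  by rewrite /g -/K addrA in h2; lra.
rewrite /K.
rewrite add0r mulmxDr mulmxDl mxtraceD -scalemx1 -scalemxAr mulmx1 -scalemxAl mxtraceZ.
move=> h; apply: le_trans h _; rewrite mulrDr addrC lerD2r.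
rewrite mulrCA.
apply: le_trans (ler_wpM2l _ HD) _; first by rewrite mulr_ge0// ltW.
rewrite /d; have -> : 2 * (e / D / 2) * D = e; last by [].
by field; rewrite gt_eqF.
Unshelve. all: by end_near. Qed.

End LinearViscosity.

(** * Steklov averages *)

Section Mean.
Context {R : realType}.
Implicit Types (f g F : R -> R) (a b d s t : R).

Lemma continuous_primitive f a : continuous f ->
  exists F, forall t, a < t -> is_derive t 1 F (f t).
Proof.
move=> cf; exists (fun x => (\int[lebesgue_measure]_(t in `[a, x]) (f t))%R).
move=> t at_.
have fi : lebesgue_measure.-integrable `[a, t + 1] (EFin \o f).
  apply: continuous_compact_integrable; first exact: segment_compact.
  exact: continuous_subspaceT.
have [|dF FE] := @continuous_FTC1_closed R f a t (t + 1) _ fi at_ (cf t).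
  by rewrite ltrDl.
by split => //; rewrite -derive1E.
Qed.

Lemma MVT0 F f s : (forall t, `|t| <= `|s| -> is_derive t 1 F (f t)) ->
  exists2 c, `|c| <= `|s| & F s - F 0 = f c * s.
Proof.
move=> Ff; have cF t : `|t| <= `|s| -> {for t, continuous F}.
  by move=> /Ff tF; apply/differentiable_continuous/derivable1_diffP/ex_derive.
have [s0|s0|->] := ltgtP s 0; last by exists 0 => //; rewrite subrr mulr0.
  have [||c] := @MVT R F f s 0 s0.
  - by move=> x; rewrite in_itv /= => /andP[x1 x2]; apply: Ff; rewrite !ltr0_norm//; lra.
  - apply: continuous_in_subspaceT => x; rewrite inE /= in_itv /= => /andP[x1 x2].
    by apply: cF; rewrite ler0_norm// ltr0_norm//; lra.
  rewrite in_itv /= => /andP[c1 c2] cE; exists c; last by lra.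
  by rewrite !ltr0_norm//; lra.
have [||c] := @MVT R F f 0 s s0.
- by move=> x; rewrite in_itv /= => /andP[x1 x2]; apply: Ff; rewrite !gtr0_norm//; lra.
- apply: continuous_in_subspaceT => x; rewrite inE /= in_itv /= => /andP[x1 x2].
  by apply: cF; rewrite ger0_norm// gtr0_norm//; lra.
rewrite in_itv /= => /andP[c1 c2] cE; exists c; last by lra.
by rewrite !gtr0_norm//; lra.
Qed.

Definition mean d f : R := (\int[lebesgue_measure]_(t in `[0%R, d]) (f t))%R / d.

Lemma mean_primitive d a f F : 0 < d -> a < 0 -> continuous f ->
  (forall t, a < t -> is_derive t 1 F (f t)) -> mean d f = (F d - F 0) / d.
Proof.
move=> d0 a0 cf dF; congr (_ / _).
have cF t : a < t -> {for t, continuous F}.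
  by move=> /dF tF; apply/differentiable_continuous/derivable1_diffP/ex_derive.
rewrite /Rintegral (@continuous_FTC2 R f F 0 d)//.
- exact: continuous_subspaceT.
- split.
  + move=> x; rewrite in_itv /= => /andP[x0 xd].
    by apply/ex_derive/dF; lra.
  + by apply: cvg_at_right_filter; apply: cF.
  + by apply: cvg_at_left_filter; apply: cF; lra.
- move=> x; rewrite in_itv /= => /andP[x0 xd].
  by have ax : a < x by [lra]; have ? := dF x ax; rewrite derive1E derive_val.
Qed.

(** The mean value theorem for the difference of the primitives yields one common point [c], so
    pointwise estimates of f - g pass to the means directly. *)
Lemma mean_diff d f g : 0 < d -> continuous f -> continuous g ->
  exists2 c, 0 <= c <= d & mean d f - mean d g = f c - g c.
Proof.
move=> d0 cf cg.
have [F dF] := continuous_primitive (-1) cf.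
have [G dG] := continuous_primitive (-1) cg.
have N1 : -1 < 0 :> R by lra.
rewrite (mean_primitive d0 N1 cf dF) (mean_primitive d0 N1 cg dG).
have dFG t : -1 < t -> is_derive t 1 (F - G) (f t - g t).
  by move=> t1; have ? := dF t t1; have ? := dG t t1; exact: is_deriveB.
have [||c] := @MVT R (F - G) (fun t => f t - g t) 0 d d0.
- by move=> x; rewrite in_itv /= => /andP[x1 x2]; apply: dFG; lra.
- apply: continuous_in_subspaceT => x; rewrite inE /= in_itv /= => /andP[x1 x2].
  have /dFG xFG : -1 < x by lra.
  by apply/differentiable_continuous/derivable1_diffP/ex_derive.
rewrite in_itv /= => /andP[c1 c2] cE; exists c; first by rewrite !ltW.
rewrite -mulrBl; apply: (@mulIf _ d); first by rewrite gt_eqF.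
rewrite divfK ?gt_eqF// -[in RHS](subr0 d) -cE !fctE; ring.
Qed.

Lemma mean_cst d c : 0 < d -> mean d (fun=> c) = c.
Proof.
move=> d0; have N1 : -1 < 0 :> R by lra.
have h (t : R) : -1 < t -> is_derive t 1 (c \*: id) c.
  by move=> _; have := is_deriveZ c (is_derive_id t 1); rewrite [_ *: 1]mulr1.
rewrite (mean_primitive d0 N1 (@cst_continuous R R c) h).
by rewrite /= -scalerBr subr0 [_ *: _]/(c * d) mulfK// gt_eqF.
Qed.

Lemma mean_mid d f : 0 < d -> continuous f ->
  exists2 c, 0 <= c <= d & mean d f = f c.
Proof.
move=> d0 cf; have [c cd] := mean_diff d0 cf (@cst_continuous R R 0).
by rewrite mean_cst// !subr0; exists c.
Qed.

Lemma meanD d f g : 0 < d -> continuous f -> continuous g ->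
  mean d (fun t => f t + g t) = mean d f + mean d g.
Proof.
move=> d0 cf cg.
have [F dF] := continuous_primitive (-1) cf.
have [G dG] := continuous_primitive (-1) cg.
have N1 : -1 < 0 :> R by lra.
rewrite (mean_primitive d0 N1 cf dF) (mean_primitive d0 N1 cg dG).
have h t : -1 < t -> is_derive t 1 (F + G) (f t + g t).
  by move=> t1; have ? := dF t t1; have ? := dG t t1; exact: is_deriveD.
have cfg : continuous (fun t => f t + g t).
  by move=> t; apply: continuousD; [exact: cf|exact: cg].
by rewrite (mean_primitive d0 N1 cfg h) !fctE; ring.
Qed.

Lemma meanZ d f c : 0 < d -> continuous f ->
  mean d (fun t => c * f t) = c * mean d f.
Proof.
move=> d0 cf.
have [F dF] := continuous_primitive (-1) cf.
have N1 : -1 < 0 :> R by lra.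
rewrite (mean_primitive d0 N1 cf dF).
have h t : -1 < t -> is_derive t 1 (c \*: F) (c * f t).
  by move=> t1; have ? := dF t t1; exact: is_deriveZ.
have ccf : continuous (fun t => c * f t).
  by move=> t; apply: continuousM; [exact: cst_continuous|exact: cf].
by rewrite (mean_primitive d0 N1 ccf h) /= -[X in X / d]scalerBr [_ *: _]/(_ * _) mulrA.
Qed.

Lemma is_derive_shift_comp F x s a : is_derive (x + s) 1 F a ->
  is_derive x 1 (F \o shift s) a.
Proof.
move=> h; have h' : is_derive (shift s x) 1 F a := h.
by have := is_derive1_comp h' (is_derive_shift x 1 s); rewrite mulr1.
Qed.

(** With a primitive F the moving average is (F (s + d) - F s) / d. Averaging thus gains one
    derivative, which is again a difference quotient of [f]. *)
Lemma is_derive_mean d f t : 0 < d -> continuous f ->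
  is_derive t 1 (fun s => mean d (fun x => f (s + x))) ((f (t + d) - f t) / d).
Proof.
move=> d0 cf.
have [F dF] := continuous_primitive (t - 2) cf.
have E : \forall s \near t, mean d (fun x => f (s + x)) = (F (s + d) - F s) / d.
  near=> s.
  have st : t - 1 < s by near: s; apply: lt_nbhsr; lra.
  have cfs : continuous (fun x => f (s + x)).
    move=> x; apply: continuous_comp; last exact: cf.
    by apply: continuousD; [exact: cst_continuous|exact: (@cvg_id _ (nbhs x))].
  have ts : t - 2 - s < 0 by lra.
  have h x : t - 2 - s < x -> is_derive x 1 (F \o shift s) (f (s + x)).
    move=> x1; have h1 : is_derive (x + s) 1 F (f (s + x)).
      by rewrite [s + x]addrC; apply: dF; lra.
    exact: is_derive_shift_comp.
  by rewrite (mean_primitive d0 ts cfs h) /= /shift /= [d + s]addrC add0r.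
have h1 : is_derive t 1 F (f t) by apply: dF; lra.
have h2 : is_derive (t + d) 1 F (f (t + d)) by apply: dF; lra.
have := is_deriveZ d^-1 (is_deriveB (is_derive_shift_comp h2) h1).
rewrite [_ *: _]mulrC; apply: near_eq_is_derive.
by apply: filterS E => s ->; rewrite !fctE [RHS]mulrC.
Unshelve. all: by end_near. Qed.

End Mean.

Section Steklov.
Context {R : realType} {N : nat}.
Local Notation V := 'rV[R]_N.
Local Notation "''e' k" := (delta_mx 0 k : 'rV[R]_N) (at level 10, k at level 8).
Implicit Types (x y z h b : V) (r d e : R) (w g : V -> R) (H M : 'M[R]_N)
  (W : set V) (k l : 'I_N) (L : seq 'I_N).

Lemma primitive_MVT (f F : R -> R) (a s d : R) : a < s -> 0 < d ->
  (forall t, a < t -> is_derive t 1 F (f t)) ->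
  exists2 c, s <= c <= s + d & F (s + d) - F s = f c * d.
Proof.
move=> as_ d0 dF; have sd : s < s + d by rewrite ltrDl.
have [||c] := @MVT R F f s (s + d) sd.
- by move=> t; rewrite in_itv /= => /andP[t1 _]; apply: dF; lra.
- apply: continuous_in_subspaceT => t; rewrite inE /= in_itv /= => /andP[t1 _].
  have /dF ? : a < t by lra.
  by apply/differentiable_continuous/derivable1_diffP/ex_derive.
rewrite in_itv /= => /andP[c1 c2] cE; exists c; first by rewrite !ltW.
by rewrite cE; congr (_ * _); ring.
Qed.

(** On each cell the increment of the primitive is [f] at an intermediate point times the mesh, so
    the error is the oscillation of [f] on a cell. *)
Lemma mean_riemann (f : R -> R) d e m : 0 < d -> continuous f ->
  (forall s t, 0 <= s -> s <= t -> t <= s + d / m.+1%:R -> t <= d -> `|f s - f t| <= e) ->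
  `|mean d f - m.+1%:R^-1 * \sum_(j < m.+1) f (j%:R * (d / m.+1%:R))| <= e.
Proof.
move=> d0 cf fe.
have [F dF] := continuous_primitive (-1) cf.
have N1 : -1 < 0 :> R by lra.
have m0 : 0 < m.+1%:R :> R by rewrite ltr0n.
rewrite (mean_primitive d0 N1 cf dF).
set q := d / m.+1%:R; have q0 : 0 < q by rewrite divr_gt0.
have -> : F d - F 0 = \sum_(0 <= j < m.+1) (F (j.+1%:R * q) - F (j%:R * q)).
  rewrite telescope_sumr// mul0r; congr (F _ - _).
  by rewrite /q mulrC divfK// gt_eqF.
rewrite big_mkord.
have -> : (\sum_(j < m.+1) (F (j.+1%:R * q) - F (j%:R * q))) / d -
   m.+1%:R^-1 * \sum_(j < m.+1) f (j%:R * q) =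
   m.+1%:R^-1 * \sum_(j < m.+1) ((F (j.+1%:R * q) - F (j%:R * q)) / q - f (j%:R * q)).
  rewrite [in RHS]sumrB -[in RHS]mulr_suml [in RHS]mulrBr; congr (_ - _).
  rewrite /q; set S := \sum_(i < _) _; field.
  by rewrite !gt_eqF.
rewrite normrM gtr0_norm ?invr_gt0// mulrC ler_pdivrMr//.
apply: le_trans (ler_norm_sum _ _ _) _.
apply: (@le_trans _ _ (\sum_(j < m.+1) e)); last first.
  by rewrite sumr_const card_ord mulr_natr.
apply: ler_sum => j _.
have jq : 0 <= j%:R * q by rewrite mulr_ge0// ltW.
have j1 : -1 < j%:R * q by lra.
have [c /andP[c1 c2]] := primitive_MVT j1 q0 dF.
have -> : j.+1%:R * q = j%:R * q + q by rewrite -natr1 mulrDl mul1r.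
move=> ->; rewrite mulfK ?gt_eqF// distrC.
apply: fe => //.
apply: le_trans c2 _; rewrite -[X in _ + X]mul1r -mulrDl natr1.
rewrite /q mulrA ler_pdivrMr// mulrC ler_pM2l// ler_nat; exact: ltn_ord.
Qed.

(** A forward average over a segment in the direction of axis [k]; its derivative in that direction
    is a difference quotient of [w]. *)
Definition stek d k w x : R := mean d (fun s => w (x + s *: 'e k)).
Definition steks d L w : V -> R := foldr (stek d) w L.

Lemma continuous_line w x k : continuous w -> continuous (fun s : R => w (x + s *: 'e k)).
Proof.
move=> cw s; apply: continuous_comp; last exact: cw.
apply: continuousD; first exact: cst_continuous.
exact: scalel_continuous.
Qed.

Lemma eball_shift x k s r d : sqn x <= r ^+ 2 -> 0 <= r -> 0 <= s -> s <= d ->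
  sqn (x + s *: 'e k) <= (2 * (r + d)) ^+ 2.
Proof.
move=> xr r0 s0 sd.
have h1 := sqn_ge0 (x - s *: 'e k); rewrite !sqnD sqnN dotvN in h1.
rewrite sqnD; rewrite !sqnZ sqn_delta in h1 *.
have : s ^+ 2 <= d ^+ 2 by rewrite ler_sqr ?nnegrE// (le_trans s0).
nra.
Qed.

(** Riemann sums are means of finitely many translates. Their uniform convergence on balls carries
    over what is known for translates: being a subsolution, and commuting with another average. *)
Lemma stek_uniform_riemann w d k r e : 0 < d -> 0 <= r -> 0 < e -> continuous w ->
  exists m0, forall m x, (m0 <= m)%N -> sqn x <= r ^+ 2 ->
  `|stek d k w x - m.+1%:R^-1 * \sum_(j < m.+1) w (x + (j%:R * (d / m.+1%:R)) *: 'e k)| <= e.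
Proof.
move=> d0 r0 e0 cw.
have [a a0 aP] := compact_uniform_continuity (@compact_eball R N (2 * (r + d))) cw e0.
exists (Num.bound (d / a)) => m x m0m xr.
apply: (@mean_riemann (fun s => w (x + s *: 'e k))) => //; first exact: continuous_line.
move=> s t s0 st tq td; apply/ltW/aP.
  by apply: eball_shift => //; lra.
rewrite opprD addrACA subrr add0r -scalerBl normrZ.
apply: (@le_lt_trans _ _ `|s - t|); first by rewrite ler_piMr// norm_delta.
rewrite ler0_norm ?subr_le0//.
apply: (@le_lt_trans _ _ (d / m.+1%:R)); first by rewrite opprB lerBlDl.
rewrite ltr_pdivrMr ?ltr0n// mulrC -ltr_pdivrMr//.
have da0 : 0 <= d / a by rewrite divr_ge0// ltW.
apply: lt_le_trans (archi_boundP da0) _; rewrite ler_nat.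
exact: leqW.
Qed.

Lemma continuous_stek w d k : 0 < d -> continuous w -> continuous (stek d k w).
Proof.
move=> d0 cw x; apply/(@cvgrPdist_le _ _ _ (nbhs x)) => e e0.
pose r := Num.sqrt (sqn x); have r0 : 0 <= r by exact: sqrtr_ge0.
have xr : sqn x <= r ^+ 2 by rewrite sqr_sqrtr// sqn_ge0.
have [a a0 aP] := compact_uniform_continuity (@compact_eball R N (2 * (r + d))) cw e0.
apply/nbhs_ballP; exists a => //= y; rewrite -ball_normE /= => xy.
have [c /andP[c0 cd] ->] := mean_diff d0 (continuous_line (x := x) (k := k) cw)
  (continuous_line (x := y) (k := k) cw).
apply/ltW/aP; first exact: eball_shift.
by rewrite opprD addrACA subrr addr0.
Qed.

Lemma mean_le_dist (f g : R -> R) d e : 0 < d -> continuous f -> continuous g ->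
  (forall c, 0 <= c -> c <= d -> `|f c - g c| <= e) -> `|mean d f - mean d g| <= e.
Proof.
move=> d0 cf cg fg; have [c /andP[c0 cd] ->] := mean_diff d0 cf cg; exact: fg.
Qed.

Lemma stek_sum (m : nat) (a : R) (s : nat -> V) w d k x : 0 < d -> continuous w ->
  stek d k (fun y => a * \sum_(j < m) w (y + s j)) x =
  a * \sum_(j < m) stek d k w (x + s j).
Proof.
move=> d0 cw; rewrite /stek.
have cl j : continuous (fun t : R => w (x + s j + t *: 'e k)) by exact: continuous_line.
have E : mean d (fun t => \sum_(j < m) w (x + s j + t *: 'e k)) =
    \sum_(j < m) mean d (fun t => w (x + s j + t *: 'e k)).
  elim: m => [|m IH].
    under eq_fun do rewrite big_ord0.
    by rewrite big_ord0 mean_cst.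
  under eq_fun do rewrite big_ord_recr.
  rewrite big_ord_recr /= meanD// ?IH//.
  by move=> t; apply: (@cvg_sumr _ _ (nbhs t)) => j; exact: cl.
rewrite -E -meanZ//.
  congr (mean d _); apply/funext => t; congr (_ * _); apply: eq_bigr => j _.
  by rewrite addrAC.
by move=> t; apply: (@cvg_sumr _ _ (nbhs t)) => j; exact: cl.
Qed.

Lemma continuous_avg w (a : R) m (s : nat -> V) : continuous w ->
  continuous (fun x => a * \sum_(j < m) w (x + s j)).
Proof.
move=> cw x.
have h : \sum_(j < m) w (y + s j) @[y --> x] --> \sum_(j < m) w (x + s j).
  by apply: (@cvg_sumr _ _ (nbhs x)) => j; exact: continuous_translater.
exact: (cvgM (@cst_continuous V R a x) h).
Qed.

(** Fubini for the two averages: the one along [k] is replaced by a Riemann sum, through which the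
    one along [l] passes term by term. *)
Lemma stekC w d k l x : 0 < d -> continuous w ->
  stek d k (stek d l w) x = stek d l (stek d k w) x.
Proof.
move=> d0 cw; apply/eqP; rewrite -subr_eq0 -normr_le0.
apply/ler_addgt0Pl => e e0; rewrite addr0.
have e2 : 0 < e / 2 by lra.
pose r := Num.sqrt (sqn x); have r0 : 0 <= r by exact: sqrtr_ge0.
have xr : sqn x <= r ^+ 2 by rewrite sqr_sqrtr// sqn_ge0.
have rd0 : 0 <= 2 * (r + d) by lra.
have [m1 h1] := stek_uniform_riemann k d0 r0 e2 (continuous_stek (k := l) d0 cw).
have [m2 h2] := stek_uniform_riemann k d0 rd0 e2 cw.
pose m := maxn m1 m2.
have {}h1 := h1 m x (leq_maxl _ _) xr.
pose A y := m.+1%:R^-1 * \sum_(j < m.+1) w (y + (j%:R * (d / m.+1%:R)) *: 'e k).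
have cA : continuous A.
  exact: (continuous_avg (s := fun j => (j%:R * (d / m.+1%:R)) *: 'e k)).
have h3 : `|stek d l (stek d k w) x - stek d l A x| <= e / 2.
  apply: mean_le_dist => //; try exact: continuous_line.
    by apply: continuous_line; exact: continuous_stek.
  move=> c c0 cd; apply: h2; first exact: leq_maxr.
  exact: eball_shift.
move: h3; rewrite (stek_sum _ _ (fun j => (j%:R * (d / m.+1%:R)) *: 'e k))//.
rewrite distrC => h3.
by have := ler_distD (m.+1%:R^-1 * \sum_(j < m.+1) stek d l w (x + (j%:R * (d / m.+1%:R)) *: 'e k)) (stek d k (stek d l w) x) (stek d l (stek d k w) x); lra.
Qed.

Lemma continuous_steks w d L : 0 < d -> continuous w -> continuous (steks d L w).
Proof. by move=> d0 cw; elim: L => //= k L; exact: continuous_stek. Qed.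

Lemma steks_rem w d L k : 0 < d -> continuous w -> k \in L ->
  steks d L w = stek d k (steks d (rem k L) w).
Proof.
move=> d0 cw; elim: L => //= l L IH; rewrite inE eq_sym.
case: eqVneq => [->//|lk /= kL].
apply/funext => x; rewrite (IH kL).
exact: stekC d0 (continuous_steks d0 cw).
Qed.

(** Each average is attained at an intermediate point, so the iterated one is a value of [w] at a
    point displaced by at most [d] per average. *)
Lemma steks_near w d L x : 0 < d -> continuous w ->
  exists2 y : V, `|y| <= (size L)%:R * d & steks d L w x = w (x + y).
Proof.
move=> d0 cw; elim: L x => [|k L IH] x /=.
  by exists 0; rewrite ?normr0 ?mul0r ?addr0.
have [c /andP[c0 cd] cE] := mean_mid d0 (continuous_line (x := x) (k := k) (continuous_steks (L := L) d0 cw)).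
have [y yL yE] := IH (x + c *: 'e k).
exists (c *: 'e k + y); last by rewrite /stek cE yE addrA.
rewrite -nat1r mulrDl mul1r; apply: le_trans (ler_normD _ _) _.
apply: lerD => //; rewrite normrZ ger0_norm//.
by apply: le_trans cd; rewrite ler_piMr// norm_delta.
Qed.

Lemma is_derive_stek w d k x : 0 < d -> continuous w ->
  is_derive (0 : R) 1 (fun t => stek d k w (x + t *: 'e k))
    ((w (x + d *: 'e k) - w x) / d).
Proof.
move=> d0 cw.
have := is_derive_mean 0 d0 (continuous_line (x := x) (k := k) cw).
rewrite add0r scale0r addr0.
congr is_derive; apply/funext => t; rewrite /stek; congr (mean d _).
by apply/funext => s; rewrite scalerDl addrA.
Qed.

(** Translates of a subsolution are subsolutions, hence so are their means, hence so is the uniform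
    limit of the Riemann sums. *)
Lemma visc_stek M (c : R) W W' w d k r : (0 < N)%N -> M \in unitmx ->
  0 < d -> 0 <= r -> continuous w -> open W' ->
  (forall x, W' x -> sqn x <= r ^+ 2) ->
  (forall x s, W' x -> 0 <= s -> s <= d -> W (x + s *: 'e k)) ->
  visc M c W w -> visc M c W' (stek d k w).
Proof.
move=> N0 uM d0 r0 cw oW W'r W'W wv; apply: visc_lim => // e e0.
have [m h] := stek_uniform_riemann k d0 r0 e0 cw.
have m0 : 0 < m.+1%:R :> R by rewrite ltr0n.
(* [visc_sum] takes a sequence indexed by all naturals; capping the index at [m] keeps every shift
   in [0, d]. *)
pose s j : V := ((minn j m)%:R * (d / m.+1%:R)) *: 'e k.
exists (fun x => m.+1%:R^-1 * \sum_(j < m.+1) w (s j + x)); split.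
- rewrite (_ : (fun x => _) = fun x => m.+1%:R^-1 * \sum_(j < m.+1) w (x + s j)).
    exact: continuous_avg.
  by apply/funext => x; congr (_ * _); apply: eq_bigr => j _; rewrite addrC.
- have -> : c = m.+1%:R^-1 * (m.+1%:R * c) by rewrite mulrA mulVf ?mul1r// gt_eqF.
  apply: visc_scale; first by rewrite invr_gt0.
  apply: visc_sum => // j.
  apply: visc_subset (visc_shift (x := s j) wv) => x /= W'x.
  rewrite addrC; apply: W'W => //; first by rewrite mulr_ge0// divr_ge0// ltW.
  rewrite mulrA ler_pdivrMr// mulrC ler_pM2l// ler_nat.
  by rewrite (leq_trans (geq_minr _ _)).
move=> x /W'r xr; have := h m x (leqnn _) xr.
rewrite (eq_bigr (fun j : 'I_m.+1 => w (s j + x)))// => j _.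
by rewrite addrC /s (minn_idPl _)// -ltnS ltn_ord.
Qed.

Lemma visc_steks M (c : R) w d L x0 r : (0 < N)%N -> M \in unitmx ->
  0 < d -> continuous w ->
  visc M c [set x | `|x - x0| < r] w ->
  visc M c [set x | `|x - x0| < r - (size L)%:R * d] (steks d L w).
Proof.
move=> N0 uM d0 cw wv; elim: L => [|k L IH] /=.
  by rewrite mul0r subr0.
have [r0|r0] := leP r 0.
  move=> x b H /= xr; have := normr_ge0 (x - x0).
  have : 0 <= (size L).+1%:R * d by rewrite mulr_ge0// ltW.
  lra.
pose r' : R := Num.sqrt (N%:R * (r + `|x0|) ^+ 2).
apply: (visc_stek (r := r') _ _ _ _ _ _ _ _ IH) => //.
- exact: sqrtr_ge0.
- exact: continuous_steks.
- rewrite (_ : mkset _ = (fun x => `|x - x0|) @^-1` [set t | t < r - (size L).+1%:R * d])//.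
  apply: open_comp; last exact: open_lt.
  move=> x _; apply: continuous_comp; last exact: norm_continuous.
  by apply: continuousB; [exact: (@cvg_id _ (nbhs x))|exact: cst_continuous].
- move=> x /= xr.
  have q0 : 0 <= N%:R * (r + `|x0|) ^+ 2 by apply: mulr_ge0 => //; exact: sqr_ge0.
  rewrite sqr_sqrtr//; apply: sqn_le_norm.
  have : 0 <= (size L).+1%:R * d by rewrite mulr_ge0// ltW.
  by have := ler_normD (x - x0) x0; rewrite subrK; lra.
- move=> x s /= xr s0 sd; rewrite addrAC.
  apply: le_lt_trans (ler_normD _ _) _.
  have : `|s *: 'e k| <= d.
    by rewrite normrZ ger0_norm//; apply: le_trans sd; rewrite ler_piMr// norm_delta.
  by move: xr; rewrite -nat1r mulrDl mul1r; lra.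
Qed.

End Steklov.

(** * Second order expansion of iterated averages *)

Section Regularization.
Context {R : realType} {N : nat}.
Local Notation V := 'rV[R]_N.
Local Notation "''e' k" := (delta_mx 0 k : 'rV[R]_N) (at level 10, k at level 8).
Implicit Types (x y z h b : V) (r d e : R) (w G : V -> R) (H M : 'M[R]_N)
  (W : set V) (k l : 'I_N) (L : seq 'I_N).

Definition partial_deriv G k (G' : V -> R) : Prop :=
  forall x, is_derive (0 : R) 1 (fun t => G (x + t *: 'e k)) (G' x).

Lemma partial_deriv_line G k G' x (t : R) : partial_deriv G k G' ->
  is_derive t 1 (fun s => G (x + s *: 'e k)) (G' (x + t *: 'e k)).
Proof.
move=> dG.
have h : is_derive (t + - t) 1 (fun s => G (x + t *: 'e k + s *: 'e k)) (G' (x + t *: 'e k)).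
  by rewrite subrr; exact: dG.
have := is_derive_shift_comp h.
congr is_derive; apply/funext => s; rewrite /shift /=.
by rewrite -addrA -scalerDl [t + _]addrC subrK.
Qed.

(** The vertices of the path from 0 to [h] that runs along the axes one after the other. *)
Definition pre h (m : nat) : V := \row_i (if (i < m)%N then h 0 i else 0).

Lemma pre0 h : pre h 0 = 0.
Proof. by apply/rowP => i; rewrite !mxE. Qed.

Lemma preN h : pre h N = h.
Proof. by apply/rowP => i; rewrite !mxE ltn_ord. Qed.

Lemma preS h k : pre h k.+1 = pre h k + h 0 k *: 'e k.
Proof.
apply/rowP => i; rewrite !mxE eqxx /= ltnS leq_eqVlt -val_eqE /=.
have [/ord_inj ->|ik] := eqVneq (i : nat) k; first by rewrite ltnn mulr1 add0r.
by rewrite mulr0 addr0.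
Qed.

Lemma pre_norm h k (t : R) : `|t| <= `|h 0 k| -> `|pre h k + t *: 'e k| <= `|h|.
Proof.
move=> th; apply: normv_le => // i; rewrite !mxE eqxx /= -val_eqE /=.
case: ltngtP => ik; rewrite ?mulr0 ?addr0 ?add0r ?normr0//.
  exact: normv_coord.
by rewrite mulr1; apply: le_trans th _; exact: normv_coord.
Qed.

Lemma sum_ltS (F : 'I_N -> R) k :
  \sum_(i < N | (i < k.+1)%N) F i = \sum_(i < N | (i < k)%N) F i + F k.
Proof.
rewrite (bigD1 k)//= addrC; congr (_ + _); apply: eq_bigl => i.
by rewrite ltnS -val_eqE /= ltn_neqAle andbC.
Qed.

(** The increments along the edges of the path telescope, and on each edge the mean value theorem
    compares with the derivative at [x]. *)
Lemma first_order G (G' : 'I_N -> V -> R) x h e :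
  (forall l, partial_deriv G l (G' l)) ->
  (forall l z, `|z| <= `|h| -> `|G' l (x + z) - G' l x| <= e) ->
  forall m, (m <= N)%N ->
  `|G (x + pre h m) - G x - \sum_(l < N | (l < m)%N) h 0 l * G' l x| <=
  e * \sum_(l < N | (l < m)%N) `|h 0 l|.
Proof.
move=> dG eG; elim=> [_|m IH mN].
  by rewrite pre0 !big1// ?mulr0 addr0 !subrr ?subr0 normr0.
pose k := Ordinal mN; rewrite -[m]/(nat_of_ord k) in IH *.
rewrite !sum_ltS preS addrA.
have {}IH := IH (ltnW mN).
have [t th tE] := MVT0 (s := h 0 k) (fun s _ => partial_deriv_line (x + pre h k) s (dG k)).
rewrite /= scale0r addr0 in tE.
have e1 : `|G' k (x + (pre h k + t *: 'e k)) - G' k x| <= e by apply: eG; exact: pre_norm.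
have -> : G (x + pre h k + h 0 k *: 'e k) - G x -
    (\sum_(i < N | (i < k)%N) h 0 i * G' i x + h 0 k * G' k x) =
   (G (x + pre h k) - G x - \sum_(i < N | (i < k)%N) h 0 i * G' i x) +
   (G' k (x + (pre h k + t *: 'e k)) - G' k x) * h 0 k.
  by move: tE; rewrite addrA => tE; rewrite mulrBl -tE; ring.
rewrite mulrDr; apply: le_trans (ler_normD _ _) _; apply: lerD => //.
by rewrite normrM ler_wpM2r.
Qed.

(** Along edge [k] the gradient at the vertex is itself expanded to first order, which involves only
    the coordinates l < k already travelled. *)
Lemma second_order w (g : 'I_N -> V -> R) (gg : 'I_N -> 'I_N -> V -> R) x h e :
  (forall k, partial_deriv w k (g k)) ->
  (forall k l, partial_deriv (g k) l (gg k l)) ->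
  (forall k l z, `|z| <= `|h| -> `|gg k l (x + z) - gg k l x| <= e) ->
  forall m, (m <= N)%N ->
  `|w (x + pre h m) - w x - \sum_(k < N | (k < m)%N) (h 0 k * g k x +
      (h 0 k * (\sum_(l < N | (l < k)%N) h 0 l * gg k l x) +
       h 0 k ^+ 2 / 2 * gg k k x))| <=
  e * (\sum_(l < N | (l < m)%N) `|h 0 l|) * \sum_l `|h 0 l|.
Proof.
move=> dw dg eg; elim=> [_|m IH mN].
  have E0 (F : 'I_N -> R) : \sum_(i < N | (i < 0)%N) F i = 0 by rewrite big1.
  by rewrite pre0 !E0 mulr0 mul0r addr0 subrr subr0 normr0.
pose k := Ordinal mN; rewrite -[m]/(nat_of_ord k) in IH *.
rewrite !sum_ltS preS addrA.
have {}IH := IH (ltnW mN).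
have e0 : 0 <= e by have := eg k k 0; rewrite normr0 normr_ge0 => /(_ isT); apply: le_trans.
set s := h 0 k.
set y := x + pre h k.
set c := gg k k x.
have A := first_order (dg k) (eg k) (ltnW mN).
rewrite -[m]/(nat_of_ord k) -/y in A.
(* The one-variable second order remainder on the edge: the mean value theorem is applied to the
   remainder [psi] and then to its derivative. *)
have B : `|w (y + s *: 'e k) - w y - s * g k y - s ^+ 2 / 2 * c| <= e * `|s| * `|s|.
  pose psi (t : R) := w (y + t *: 'e k) - t * g k y - t ^+ 2 / 2 * c.
  have dpsi (t : R) : is_derive t 1 psi (g k (y + t *: 'e k) - g k y - t * c).
    have h1 := partial_deriv_line y t (dw k).
    have regZ (p q : R) : p *: (q : R^o) = p * q by [].
    have h2 : is_derive t 1 (g k y \*: id) (g k y *: 1) by exact: is_deriveZ.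
    have h3 : is_derive t 1 ((c / 2) \*: (id ^+ 2)) ((c / 2) *: ((2 * t ^+ 1) *: 1)).
      by apply: is_deriveZ; exact: is_deriveX.
    have := is_deriveB (is_deriveB h1 h2) h3.
    rewrite (_ : _ - _ - _ = psi); last first.
      by apply/funext => a; rewrite /psi !fctE /= !regZ; ring.
    rewrite (_ : _ - _ - _ = g k (y + t *: 'e k) - g k y - t * c)//.
    by rewrite !regZ; field.
  have [t th tE] := MVT0 (s := s) (fun t _ => dpsi t).
  have [t' th' tE'] := MVT0 (s := t) (fun s _ => partial_deriv_line y s (dg k k)).
  rewrite /= scale0r addr0 in tE'.
  have -> : w (y + s *: 'e k) - w y - s * g k y - s ^+ 2 / 2 * c = psi s - psi 0.
    by rewrite /psi scale0r addr0; ring.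
  rewrite tE normrM; apply: ler_wpM2r => //.
  rewrite tE' (_ : _ - _ = (gg k k (y + t' *: 'e k) - c) * t); last by ring.
  rewrite normrM; apply: ler_pM => //.
  by rewrite /y -addrA; apply: eg; apply: pre_norm; apply: le_trans th.
set a := \sum_(l < N | (l < k)%N) h 0 l * gg k l x in A *.
set S := \sum_(l < N | (l < k)%N) `|h 0 l| in A IH *.
set T := \sum_l `|h 0 l| in IH *.
have ST : S + `|s| <= T.
  rewrite /S /T -sum_ltS [leRHS](bigID (fun l : 'I_N => (l < k.+1)%N)) /=.
  by rewrite lerDl sumr_ge0.
have C : `|s * (g k y - g k x - a)| <= `|s| * (e * S).
  by rewrite normrM ler_wpM2l.
set Q := \sum_(i < N | (i < k)%N) _ in IH *.
have -> : w (y + s *: 'e k) - w x - (Q + (s * g k x + (s * a + s ^+ 2 / 2 * gg k k x))) =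
   (w y - w x - Q) + s * (g k y - g k x - a) +
   (w (y + s *: 'e k) - w y - s * g k y - s ^+ 2 / 2 * c) by rewrite /c; ring.
apply: le_trans (ler_normD _ _) _.
apply: le_trans (lerD (le_trans (ler_normD _ _) (lerD IH C)) B) _.
have := ler_wpM2l (mulr_ge0 e0 (normr_ge0 s)) ST; lra.
Qed.

(** [H] is lower triangular: each mixed derivative enters once, in the order in which the path meets
    the axes, and the diagonal carries the factor 1/2. *)
Lemma C2_taylor2 w (g : 'I_N -> V -> R) (gg : 'I_N -> 'I_N -> V -> R) x :
  (forall k, partial_deriv w k (g k)) ->
  (forall k l, partial_deriv (g k) l (gg k l)) ->
  (forall k l, continuous (gg k l)) ->
  exists b H, taylor2 w x b H.
Proof.
move=> dw dg cg.
pose H : 'M[R]_N := \matrix_(k, l) (if (l < k)%N then gg k l x else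
  if l == k then gg k k x / 2 else 0).
exists (\row_k g k x), H => e e0.
(* The square of the sum of the |h_l| is at most N^2 |h|^2; adding 1 keeps the divisor visibly
   positive. *)
pose e1 := e / (N%:R ^+ 2 + 1).
have N1 : 0 < N%:R ^+ 2 + 1 :> R by rewrite ltr_wpDl// sqr_ge0.
have e10 : 0 < e1 by rewrite divr_gt0.
have near_all (P : 'I_N -> 'I_N -> V -> Prop) :
    (forall k l, \forall h \near (0 : V), P k l h) ->
    \forall h \near (0 : V), forall k l, P k l h.
  move=> Pn; apply: (@filter_forall _ _ _ (nbhs (0 : V)) _) => k; apply: (@filter_forall _ _ _ (nbhs (0 : V)) _) => l; exact: Pn.
have /near_all : forall k l, \forall h \near (0 : V), `|gg k l (x + h) - gg k l x| <= e1.
  move=> k l; apply: (near_translate x (fun y => `|gg k l y - gg k l x| <= e1)).1.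
  have := continuous_dist_lt x (cg k l) e10.
  by apply: filterS => y; rewrite distrC; exact: ltW.
move=> /nbhs_ballP[d /= d0 dP].
apply/nbhs_ballP; exists d => //= h; rewrite -ball_normE /= sub0r normrN => hd.
have eg k l z : `|z| <= `|h| -> `|gg k l (x + z) - gg k l x| <= e1.
  by move=> zh; apply: dP; rewrite -ball_normE /= sub0r normrN; exact: le_lt_trans hd.
have := second_order dw dg eg (leqnn N); rewrite preN.
have E (F : 'I_N -> R) : \sum_(l < N | (l < N)%N) F l = \sum_l F l.
  by apply: eq_bigl => l; rewrite ltn_ord.
rewrite !E big_split /=.
have -> : \sum_i h 0 i * g i x = dotv (\row_k g k x) h.
  by rewrite dotvE; apply: eq_bigr => i _; rewrite mxE mulrC.
have -> : \sum_(k < N) (h 0 k * (\sum_(l < N | (l < k)%N) h 0 l * gg k l x) +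
    h 0 k ^+ 2 / 2 * gg k k x) = quad H h.
  rewrite quadE; apply: eq_bigr => k _.
  rewrite [RHS](bigID (fun l : 'I_N => (l < k)%N)) /= mulr_sumr; congr (_ + _).
    by apply: eq_bigr => l lk; rewrite mxE lk; ring.
  rewrite (bigD1 k) ?ltnn//= mxE ltnn eqxx big1 ?addr0; first by field.
  by move=> l /andP[lk lk']; rewrite mxE (negPf lk) (negPf lk') !mul0r.
rewrite opprD addrA => /le_trans; apply.
set T := \sum_l _.
have -> : e1 * T * T = e * (T * T / (N%:R ^+ 2 + 1)) by rewrite /e1; ring.
rewrite ler_pM2l// ler_pdivrMr// mulr_suml.
apply: (@le_trans _ _ (\sum_(i < N) \sum_(j < N) sqn h)).
  apply: ler_sum => i _; rewrite mulr_sumr; apply: ler_sum => j _.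
  have hi := sqn_coord h i; have hj := sqn_coord h j.
  rewrite -[h 0 i ^+ 2]real_normK ?num_real// in hi.
  rewrite -[h 0 j ^+ 2]real_normK ?num_real// in hj.
  have := sqr_ge0 (`|h 0 i| - `|h 0 j|); nra.
rewrite !sumr_const card_ord -(mulr_natr (sqn h *+ N)) -(mulr_natr (sqn h)).
by have := sqn_ge0 h; nra.
Qed.

(** [U] is chosen before [M] and [c], so a single smooth approximation inherits every linear
    inequality satisfied by [w]. *)
Lemma regularization w x0 r e : (0 < N)%N -> continuous w -> 0 < r -> 0 < e ->
  exists U : V -> R, [/\ continuous U,
    forall x, exists b H, taylor2 U x b H,
    forall x, `|x - x0| <= r -> `|U x - w x| <= e &
    forall M (c : R), M \in unitmx -> visc M c [set x | `|x - x0| < r] w ->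
      visc M c [set x | `|x - x0| < r / 2] U].
Proof.
move=> N0 cw r0 e0.
(* Every axis occurs twice: after removing one average along [k], one along any [l], even l = k, is
   still available. Second derivatives are then second difference quotients of continuous
   functions. *)
pose L := enum 'I_N ++ enum 'I_N.
pose r' : R := Num.sqrt (N%:R * (r + `|x0|) ^+ 2).
have xr' x : `|x - x0| <= r -> sqn x <= r' ^+ 2.
  move=> xr; have q0 : 0 <= N%:R * (r + `|x0|) ^+ 2 by apply: mulr_ge0 => //; exact: sqr_ge0.
  rewrite sqr_sqrtr//; apply: sqn_le_norm.
  by have := ler_normD (x - x0) x0; rewrite subrK; lra.
have [a a0 aP] := compact_uniform_continuity (@compact_eball R N r') cw e0.
have L0 : 0 <= (size L)%:R :> R by [].
have L1 : 0 < (size L)%:R + 1 :> R by rewrite ltr_wpDl.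
(* The total displacement [(size L)%:R * d] stays below [a], which controls the approximation, and
   below r/2, which controls the loss of domain. *)
pose d := Num.min a (r / 2) / ((size L)%:R + 1).
have m0 : 0 < Num.min a (r / 2) by rewrite lt_min a0 divr_gt0.
have d0 : 0 < d by rewrite divr_gt0.
have dm : (size L)%:R * d < Num.min a (r / 2).
  rewrite /d mulrA ltr_pdivrMr// mulrC ltr_pM2l//; lra.
have da : (size L)%:R * d < a by apply: lt_le_trans dm _; rewrite ge_min lexx.
have dr : (size L)%:R * d < r / 2 by apply: lt_le_trans dm _; rewrite ge_min lexx orbT.
have Lk k : k \in L by rewrite mem_cat mem_enum.
have Lkl k l : l \in rem k L.
  rewrite -has_pred1 has_count.
  have := (permP (perm_to_rem (Lk k))) (pred1 l); rewrite count_cat /=.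
  set c := count _ (rem k L); set c' := count _ (enum _).
  have : (0 < count (pred1 l) (enum 'I_N))%N by rewrite -has_count has_pred1 mem_enum.
  by rewrite -/c'; case: (k == l); clear; move: c c' => c c'; lia.
exists (steks d L w); split.
- exact: continuous_steks.
- move=> x.
  pose U1 k := steks d (rem k L) w.
  pose U2 k l := steks d (rem l (rem k L)) w.
  pose g k x := (U1 k (x + d *: 'e k) - U1 k x) / d.
  pose g2 k l x := (U2 k l (x + d *: 'e l) - U2 k l x) / d.
  pose gg k l x := (g2 k l (x + d *: 'e k) - g2 k l x) / d.
  have cU2 k l : continuous (U2 k l) by exact: continuous_steks.
  have dU1 k l : partial_deriv (U1 k) l (g2 k l).
    move=> y; rewrite /U1 (steks_rem d0 cw (Lkl k l)); apply: is_derive_stek => //.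
    exact: cU2.
  apply: (@C2_taylor2 _ g gg).
  + move=> k y; rewrite (steks_rem d0 cw (Lk k)); apply: is_derive_stek => //.
    exact: continuous_steks.
  + move=> k l y.
    have h1 := dU1 k l (y + d *: 'e k); have h2 := dU1 k l y.
    have := is_deriveZ d^-1 (is_deriveB h1 h2).
    rewrite (_ : d^-1 \*: _ = fun t => g k (y + t *: 'e l)); last first.
      by apply/funext => t; rewrite /g !fctE /= [_ *: _]/(_ * _) mulrC addrAC.
    have regZ (p q : R) : p *: (q : R^o) = q * p by exact: mulrC.
    by rewrite regZ.
  + move=> k l.
    have cdiff (G : V -> R) (z : V) : continuous G ->
        continuous (fun y => (G (y + z) - G y) / d).
      move=> cG y.
      have cGz := continuous_translater (x := z) cG.
      have h : G (t + z) - G t @[t --> y] --> G (y + z) - G y.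
        exact: (cvgB (cGz y) (cG y)).
      exact: (cvgM h (@cst_continuous V R d^-1 y)).
    by apply: (cdiff (g2 k l)); exact: cdiff.
- move=> x xr; have [y yd ->] := steks_near L x d0 cw.
  rewrite distrC; apply/ltW/aP; first exact: xr'.
  by rewrite opprD addNKr normrN; apply: le_lt_trans da.
- move=> M c uM wv; apply: visc_subset (visc_steks N0 uM d0 (L := L) cw wv) => x /=.
  lra.
Qed.

End Regularization.

(** * Hermitian forms *)

Section HermitianForms.
Context {R : realType} {n : nat}.
Local Notation C := R[i].
Local Notation Cn := 'rV[R[i]]_n.
Local Notation Re := (@complex.Re _).
Local Notation Im := (@complex.Im _).
Implicit Types (A B : 'M[C]_n) (z : Cn) (xi : 'M[C]_n).

Definition conjmx m p (A : 'M[C]_(m, p)) : 'M[C]_(m, p) := map_mx Num.conj A.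

(** The index order is that of the polynomials in [Tplus]: the row index of [A] goes with the
    conjugated variable. *)
Definition hform A z : C := \sum_i \sum_j A j i * z 0 i * Num.conj (z 0 j).

Lemma hformE A z : hform A z = (conjmx z *m A *m z^T) 0 0.
Proof.
rewrite /hform mxE; apply: eq_bigr => i _; rewrite !mxE mulr_suml.
by apply: eq_bigr => j _; rewrite !mxE; ring.
Qed.

Lemma hermsymmxP A : A \is hermsymmx <-> forall i j, A i j = Num.conj (A j i).
Proof.
split=> [/is_hermitianmxP hA i j|hA].
  by rewrite {1}hA expr0 scale1r !mxE.
apply/is_hermitianmxP; rewrite expr0 scale1r; apply/matrixP => i j.
by rewrite !mxE -hA.
Qed.

Lemma hform_conj A z : A \is hermsymmx -> Num.conj (hform A z) = hform A z.
Proof.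
move=> /hermsymmxP hA; rewrite /hform [in LHS]exchange_big /= rmorph_sum.
apply: eq_bigr => j _; rewrite rmorph_sum; apply: eq_bigr => i _.
by rewrite !rmorphM /= conjCK -hA; ring.
Qed.

Lemma real_conj (c : C) : Num.conj c = c -> c = (Re c)%:C%C.
Proof. by case: c => a b [] /eqP; rewrite eqNr => /eqP ->. Qed.

Lemma hform_real A z : A \is hermsymmx -> hform A z = (Re (hform A z))%:C%C.
Proof. by move=> hA; apply/real_conj/hform_conj. Qed.

Lemma ReM_real (c : R) (z : C) : Re (c%:C%C * z) = c * Re z.
Proof. by case: z => a b /=; ring. Qed.

Lemma Re_sum (I : Type) (r : seq I) (P : pred I) (F : I -> C) :
  Re (\sum_(i <- r | P i) F i) = \sum_(i <- r | P i) Re (F i).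
Proof. by rewrite (@big_morph _ _ Re 0 +%R 0 +%R) // => -[a b] [c d]. Qed.

Lemma real_complex_prod (I : Type) (r : seq I) (F : I -> R) :
  \prod_(i <- r) (F i)%:C%C = (\prod_(i <- r) F i)%:C%C.
Proof. by rewrite rmorph_prod. Qed.

Let P A := spectralmx A.
Let lam A k : R := Re (spectral_diag A 0 k).

Lemma spectral_real A k : A \is hermsymmx -> spectral_diag A 0 k = (lam A k)%:C%C.
Proof.
move=> hA; have /mxOverP/(_ 0 k) := hermitian_spectral_diag_real hA.
by move/RRe_real.
Qed.

Lemma spectral_mul_adj A : P A *m (conjmx (P A))^T = 1%:M.
Proof.
have /unitarymxP := spectral_unitarymx A; rewrite map_trmx.
by [].
Qed.

Lemma spectral_inv A : invmx (P A) = (conjmx (P A))^T.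
Proof.
by rewrite -[RHS](mulKmx (spectral_unit A)) spectral_mul_adj mulmx1.
Qed.

Lemma spectral_decomp A : A \is hermsymmx ->
  A = (conjmx (P A))^T *m diag_mx (spectral_diag A) *m P A.
Proof.
by move=> /hermitian_normalmx /orthomx_spectralP; rewrite -spectral_inv.
Qed.

Lemma spectral_det A : A \is hermsymmx -> \det A = (\prod_k lam A k)%:C%C.
Proof.
move=> hA; rewrite {1}(spectral_decomp hA) !det_mulmx det_diag mulrAC mulrC.
rewrite -det_mulmx -spectral_inv mulVmx ?spectral_unit// det1 mulr1.
by rewrite -real_complex_prod; apply: eq_bigr => k _; exact: spectral_real.
Qed.

Lemma spectral_tr A : A \is hermsymmx -> \tr A = (\sum_k lam A k)%:C%C.
Proof.
move=> hA; rewrite {1}(spectral_decomp hA) mxtrace_mulC mulmxA spectral_mul_adj mul1mx.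
rewrite mxtrace_diag rmorph_sum; apply: eq_bigr => k _; exact: spectral_real.
Qed.

Lemma conjmxM m p q (A : 'M[C]_(m, p)) (B : 'M[C]_(p, q)) :
  conjmx (A *m B) = conjmx A *m conjmx B.
Proof. exact: map_mxM. Qed.

Lemma conjmxK m p (A : 'M[C]_(m, p)) : conjmx (conjmx A) = A.
Proof. by apply/matrixP => i j; rewrite !mxE conjCK. Qed.

Lemma conj_scale_real (a : R) (c : C) : Num.conj (a%:C%C * c) = a%:C%C * Num.conj c.
Proof. by case: c => x y; rewrite /Num.conj /=; apply/eqP; rewrite eq_complex /=; apply/andP; split; apply/eqP; ring. Qed.

Lemma mul_conj (c : C) : c * Num.conj c = (Re c ^+ 2 + Im c ^+ 2)%:C%C.
Proof. by case: c => x y; rewrite /Num.conj /=; apply/eqP; rewrite eq_complex /=; apply/andP; split; apply/eqP; ring. Qed.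

Definition sqnormc (c : C) : R := Re c ^+ 2 + Im c ^+ 2.

Lemma sqnormc_ge0 c : 0 <= sqnormc c.
Proof. by rewrite addr_ge0// sqr_ge0. Qed.

Lemma sqnormcM (c d : C) : sqnormc (c * d) = sqnormc c * sqnormc d.
Proof. by case: c d => [a b] [c d]; rewrite /sqnormc /=; ring. Qed.

Lemma sqnormc_conj (c : C) : sqnormc (Num.conj c) = sqnormc c.
Proof. by case: c => a b; rewrite /sqnormc /Num.conj /= sqrrN. Qed.

Lemma hform_spectral A z : A \is hermsymmx ->
  Re (hform A z) = \sum_k lam A k * sqnormc ((z *m (P A)^T) 0 k).
Proof.
move=> hA; rewrite hformE {1}(spectral_decomp hA).
have -> : conjmx z *m ((conjmx (P A))^T *m diag_mx (spectral_diag A) *m P A) *m z^T =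
    conjmx (z *m (P A)^T) *m diag_mx (spectral_diag A) *m (z *m (P A)^T)^T.
  by rewrite trmx_mul trmxK conjmxM !mulmxA /conjmx -map_trmx.
move: (z *m (P A)^T) => y.
rewrite mxE Re_sum; apply: eq_bigr => k _.
rewrite mul_mx_diag !mxE spectral_real// mulrAC [_ * y 0 k]mulrC mul_conj mulrC.
by rewrite ReM_real.
Qed.

(* The test vectors are the conjugated rows of the unitary matrix [P A]. *)
Lemma hform_scaled_spectral A (t : 'I_n -> R) k : A \is hermsymmx ->
  Re (hform A (row k (\matrix_(i, j) ((t i)%:C%C * Num.conj (P A i j))))) =
  t k ^+ 2 * lam A k.
Proof.
move=> hA; rewrite hform_spectral// (bigD1 k)//= big1 ?addr0 => [|l lk].
  have -> : (row k (\matrix_(i, j) ((t i)%:C%C * Num.conj (P A i j))) *m (P A)^T) 0 k =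
      (t k)%:C%C.
    have := congr1 (fun M : 'M[C]_n => M k k) (spectral_mul_adj A); rewrite !mxE eqxx /= => E.
    rewrite -[RHS]mulr1 -[X in _ * X]E mulr_sumr; apply: eq_bigr => j _.
    by rewrite ?mxE -mulrA; congr (_ * _); rewrite mulrC.
  by rewrite /sqnormc /=; ring.
have -> : (row k (\matrix_(i, j) ((t i)%:C%C * Num.conj (P A i j))) *m (P A)^T) 0 l = 0.
  have := congr1 (fun M : 'M[C]_n => M l k) (spectral_mul_adj A); rewrite !mxE (negPf lk) /= => E.
  rewrite -[RHS](mulr0 (t k)%:C%C) -[X in _ * X]E mulr_sumr; apply: eq_bigr => j _.
  by rewrite ?mxE -mulrA; congr (_ * _); rewrite mulrC.
by rewrite /sqnormc /= expr0n addr0 mulr0.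
Qed.

Lemma sqnormc_det_unitary A : sqnormc (\det (P A)) = 1.
Proof.
have := congr1 determinant (spectral_mul_adj A).
rewrite det_mulmx det1 det_tr /conjmx det_map_mx mul_conj => /complexI.
by [].
Qed.

Lemma sqnormc_prod (I : finType) (F : I -> R) (c : C) :
  sqnormc ((\prod_i F i)%:C%C * c) = (\prod_i F i) ^+ 2 * sqnormc c.
Proof. by case: c => a b; rewrite /sqnormc /=; ring. Qed.

Lemma det_scaled_spectral A (t : 'I_n -> R) : \prod_i t i = 1 ->
  sqnormc (\det (\matrix_(i, j) ((t i)%:C%C * Num.conj (P A i j)))) = 1.
Proof.
move=> t1.
have -> : \matrix_(i, j) ((t i)%:C%C * Num.conj (P A i j)) =
    diag_mx (\row_i (t i)%:C%C) *m conjmx (P A).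
  by apply/matrixP => i j; rewrite mul_diag_mx !mxE.
rewrite det_mulmx det_diag (eq_bigr (fun i => (t i)%:C%C)); last by move=> i _; rewrite mxE.
rewrite real_complex_prod sqnormc_prod t1 expr1n mul1r.
by rewrite /conjmx det_map_mx sqnormc_conj sqnormc_det_unitary.
Qed.

Lemma lam_ge0 A k : A \is hermsymmx -> (forall z, 0 <= Re (hform A z)) -> 0 <= lam A k.
Proof.
move=> hA A0; have := hform_scaled_spectral (fun=> 1) k hA.
by rewrite expr1n mul1r => <-; exact: A0.
Qed.

(** Arithmetic-geometric mean inequality for the eigenvalues. *)
Lemma det_le_trace B : (0 < n)%N -> B \is hermsymmx ->
  (forall z, 0 <= Re (hform B z)) -> Re (\det B) <= (Re (\tr B) / n%:R) ^+ n.
Proof.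
move=> n0 hB B0; rewrite spectral_det// spectral_tr//=.
have := @leif_AGM R 'I_n predT (lam B).
rewrite /= cardT size_enum_ord => h.
by apply: (h _).1 => k _; exact: lam_ge0.
Qed.

Lemma hform_congr A xi z :
  hform (conjmx xi *m A *m xi^T) z = hform A (z *m xi).
Proof. by rewrite !hformE conjmxM trmx_mul !mulmxA. Qed.

(** The congruent matrix [B] has determinant |det xi|^2 det A, and its diagonal entries are the
    values of the form at the rows of [xi]; then trace against determinant. *)
Lemma det_le_sum_hform A xi : (0 < n)%N -> A \is hermsymmx ->
  (forall z, 0 <= Re (hform A z)) -> sqnormc (\det xi) = 1 ->
  Re (\det A) <= ((\sum_k Re (hform A (row k xi))) / n%:R) ^+ n.
Proof.
move=> n0 hA A0 xi1.
pose B := conjmx xi *m A *m xi^T.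
have hB : B \is hermsymmx.
  apply/is_hermitianmxP; rewrite expr0 scale1r.
  have /is_hermitianmxP := hA; rewrite expr0 scale1r => E.
  have T m p (X : 'M[C]_(m, p)) : conjmx X^T = (conjmx X)^T by rewrite /conjmx map_trmx.
  rewrite -[RHS]/(conjmx B^T) /B !trmx_mul trmxK !conjmxM (T _ _ (conjmx xi)) conjmxK mulmxA.
  by rewrite -[conjmx A^T]E.
have B0 z : 0 <= Re (hform B z) by rewrite hform_congr.
have := det_le_trace n0 hB B0.
rewrite /B !det_mulmx det_tr /conjmx det_map_mx -/(conjmx _).
have -> : Num.conj (\det xi) * \det A * \det xi = \det A.
  by rewrite mulrAC [_ * \det xi]mulrC mul_conj -/(sqnormc _) xi1 mul1r.
move/le_trans; apply; rewrite /mxtrace Re_sum.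
rewrite le_eqVlt; apply/orP; left; apply/eqP; congr (_ ^+ _); congr (_ / _).
apply: eq_bigr => k _; congr Re.
rewrite rowE -hform_congr hformE (_ : conjmx (delta_mx 0 k) = delta_mx 0 k).
  by rewrite -rowE trmx_delta -colE [RHS]mxE [RHS]mxE.
by apply/matrixP => i j; rewrite !mxE; case: (_ && _); rewrite ?rmorph1 ?rmorph0.
Qed.

Lemma nth_root (m : nat) (a : R) : (0 < m)%N -> 0 <= a -> exists2 b, 0 <= b & b ^+ m = a.
Proof.
move=> m0 a0; have [->|an0] := eqVneq a 0.
  by exists 0; rewrite ?expr0n ?gtn_eqF.
exists (a `^ (m%:R^-1)); first exact: powR_ge0.
by rewrite -powR_mulrn ?powR_ge0// -powRrM mulVf ?powRr1// pnatr_eq0 -lt0n.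
Qed.

(** If a_j <= 0, a small weight [s] on the other indices, compensated by the weight s^(1-n) at [j],
    makes the sum smaller than [m]. *)
Lemma weights_positive (a : 'I_n -> R) (m : R) : (0 < n)%N -> 0 < m ->
  (forall t : 'I_n -> R, \prod_i t i = 1 -> n%:R * m <= \sum_k t k ^+ 2 * a k) ->
  forall j, 0 < a j.
Proof.
move=> n0 m0 h j; rewrite ltNge; apply/negP => aj.
pose S := \sum_k `|a k| + 1; have S0 : 0 < S by rewrite ltr_wpDl// sumr_ge0.
pose s := Num.min 1 (m / S); have s0 : 0 < s by rewrite lt_min ltr01 divr_gt0.
pose t k := if k == j then s ^- n.-1 else s.
have t1 : \prod_i t i = 1.
  rewrite (bigD1 j)//= (eq_bigr (fun=> s)) => [|i /negPf ij]; last by rewrite /t ij.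
  by rewrite /t eqxx prodr_const cardC1 card_ord mulVf// expf_neq0// gt_eqF.
have := h t t1; apply/negP; rewrite -ltNge.
rewrite (bigD1 j)//=.
apply: (@le_lt_trans _ _ (s * \sum_k `|a k|)); last first.
  have s1 : s <= m / S by rewrite ge_min lexx orbT.
  have n1 : 1 <= n%:R :> R by rewrite ler1n.
  have : s * S <= m by rewrite -ler_pdivlMr.
  rewrite /S; nra.
have h1 : t j ^+ 2 * a j <= 0 by rewrite mulr_ge0_le0// sqr_ge0.
have h2 : \sum_(i < n | i != j) t i ^+ 2 * a i <= s * \sum_k `|a k|.
  rewrite mulr_sumr [leRHS](bigD1 j)//=; apply: ler_wpDl.
    by rewrite mulr_ge0// ltW.
  apply: ler_sum => k kj; rewrite /t (negPf kj).
  have s1 : s <= 1 by rewrite ge_min lexx.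
  rewrite expr2 -mulrA; apply: ler_wpM2l; first exact: ltW.
  by apply: le_trans (ler_norm _) _; rewrite normrM (gtr0_norm s0) ler_piMl.
lra.
Qed.

(** The weights t_k = sqrt(G / a_k), with G the geometric mean, are the equality case: every term of
    the sum becomes G. *)
Lemma weights_prod (a : 'I_n -> R) (m : R) : (0 < n)%N -> 0 < m ->
  (forall t : 'I_n -> R, \prod_i t i = 1 -> n%:R * m <= \sum_k t k ^+ 2 * a k) ->
  m ^+ n <= \prod_k a k.
Proof.
move=> n0 m0 h; have a0 := weights_positive n0 m0 h.
have p0 : 0 < \prod_k a k by apply: prodr_gt0.
have [G G0 Gn] := nth_root n0 (ltW p0).
have G1 : 0 < G.
  rewrite lt_neqAle G0 andbT eq_sym; apply/eqP => G00.
  by move: Gn p0; rewrite G00 expr0n gtn_eqF// => <-; rewrite ltxx.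
pose t k := Num.sqrt (G / a k).
have tt k : t k ^+ 2 = G / a k by rewrite sqr_sqrtr// divr_ge0// ltW.
have t1 : \prod_i t i = 1.
  have t0 : 0 <= \prod_i t i by rewrite prodr_ge0// => i _; exact: sqrtr_ge0.
  apply/eqP; rewrite -(@eqrXn2 _ 2)// expr1n -prodrXl.
  rewrite (eq_bigr (fun k => G * (a k)^-1)) => [|k _]; last by rewrite tt.
  by rewrite big_split /= prodr_const card_ord Gn prodfV divff// gt_eqF.
have := h t t1.
rewrite (eq_bigr (fun=> G)) => [|k _]; last by rewrite tt divfK// gt_eqF.
rewrite sumr_const card_ord -[G *+ n]mulr_natl ler_pM2l ?ltr0n// => mG.
by rewrite -Gn lerXn2r// nnegrE ltW.
Qed.

(** The converse of the trace inequality: among the test matrices are the eigenvectors rescaled by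
    weights of product 1, which reduces the claim to the eigenvalues. *)
Lemma hform_lower_bound A (m : R) : (0 < n)%N -> 0 < m -> A \is hermsymmx ->
  (forall xi : 'M[C]_n, sqnormc (\det xi) = 1 ->
     n%:R * m <= \sum_k Re (hform A (row k xi))) ->
  (forall z, 0 <= Re (hform A z)) /\ m ^+ n <= Re (\det A).
Proof.
move=> n0 m0 hA h.
have ht (t : 'I_n -> R) : \prod_i t i = 1 -> n%:R * m <= \sum_k t k ^+ 2 * lam A k.
  move=> t1; have := h _ (det_scaled_spectral A t1); congr (_ <= _).
  by apply: eq_bigr => k _; exact: hform_scaled_spectral.
split=> [z|].
  rewrite hform_spectral// sumr_ge0// => k _; rewrite mulr_ge0 ?sqnormc_ge0// ltW//.
  exact: (weights_positive n0 m0 ht).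
by rewrite spectral_det//=; exact: weights_prod.
Qed.

End HermitianForms.

(** * Real coordinates *)

Section RealCoordinates.
Context {R : realType} {n : nat}.
Local Notation C := R[i].
Local Notation Cn := 'rV[R[i]]_n.
Local Notation V := 'rV[R]_(n + n).
Local Notation Re := (@complex.Re _).
Local Notation Im := (@complex.Im _).
Local Notation li := (lshift n).
Local Notation ri := (@rshift n n).
Implicit Types (A B : 'M[C]_n) (z : Cn) (xi : 'M[C]_n) (x y h : V) (H : 'M[R]_(n + n)).

Definition toC x : Cn := \row_i (x 0 (li i) +i* x 0 (ri i))%C.
Definition toR z : V := row_mx (\row_i Re (z 0 i)) (\row_i Im (z 0 i)).

Lemma toR_l z i : toR z 0 (li i) = Re (z 0 i).
Proof. by rewrite row_mxEl mxE. Qed.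

Lemma toR_r z i : toR z 0 (ri i) = Im (z 0 i).
Proof. by rewrite row_mxEr mxE. Qed.

Lemma toCK x : toR (toC x) = x.
Proof.
apply/rowP => k; case: (splitP k) => j jE.
  have -> : k = li j by exact: val_inj.
  by rewrite toR_l mxE.
have -> : k = ri j by exact: val_inj.
by rewrite toR_r mxE.
Qed.

Lemma toRK z : toC (toR z) = z.
Proof. by apply/rowP => k; rewrite mxE toR_l toR_r; case: (z 0 k). Qed.

Lemma toCD x y : toC (x + y) = toC x + toC y.
Proof. by apply/rowP => k; rewrite !mxE. Qed.

(** The complex Hessian of [quad H] in the real coordinates, with the index order of
    [complex_hessian]. *)
Definition hermpart H : 'M[C]_n := \matrix_(j, i)
  ((H (li i) (li j) + H (ri i) (ri j) + H (li j) (li i) + H (ri j) (ri i)) / 4 +i*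
   ((H (li i) (ri j) - H (ri i) (li j) - H (li j) (ri i) + H (ri j) (li i)) / 4))%C.

(** Coefficients of the holomorphic quadratic polynomial whose real part is the pluriharmonic part
    of [quad H]. *)
Definition sympart H : 'M[C]_n := \matrix_(i, j)
  ((H (li i) (li j) - H (ri i) (ri j)) / 2 +i*
   (- (H (li i) (ri j) + H (ri i) (li j)) / 2))%C.

Definition symform (S : 'M[C]_n) z : C := \sum_i \sum_j S i j * z 0 i * z 0 j.

Lemma quad_toR H z :
  quad H (toR z) = Re (symform (sympart H) z) + Re (hform (hermpart H) z).
Proof.
pose T i j := (H (li i) (li j) + H (ri i) (ri j)) / 2 *
    (Re (z 0 i) * Re (z 0 j) + Im (z 0 i) * Im (z 0 j)) -
  (H (li i) (ri j) - H (ri i) (li j)) / 2 *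
    (Im (z 0 i) * Re (z 0 j) - Re (z 0 i) * Im (z 0 j)).
have -> : Re (hform (hermpart H) z) = \sum_i \sum_j T i j.
  transitivity (\sum_i \sum_j (T i j + T j i) / 2).
    rewrite /hform Re_sum; apply: eq_bigr => i _.
    rewrite Re_sum; apply: eq_bigr => j _; rewrite mxE /T.
    by case: (z 0 i) (z 0 j) => a b [c d]; rewrite /Num.conj /=; field.
  have E : \sum_i \sum_j T j i = \sum_i \sum_j T i j by rewrite exchange_big.
  have -> : \sum_i \sum_j (T i j + T j i) / 2 =
      (\sum_i \sum_j T i j + \sum_i \sum_j T j i) / 2.
    rewrite -big_split /= mulr_suml; apply: eq_bigr => i _.
    by rewrite -big_split /= mulr_suml.
  by rewrite E; field.
rewrite /symform Re_sum quadE big_split_ord.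
rewrite /= -!big_split; apply: eq_bigr => i _ /=.
rewrite Re_sum !big_split_ord /= -!big_split /=.
apply: eq_bigr => j _; rewrite [sympart H i j]mxE !toR_l !toR_r /T.
by case: (z 0 i) (z 0 j) => a b [c d] /=; field.
Qed.

Lemma symformZ (S : 'M[C]_n) (c : C) z : symform S (c *: z) = c ^+ 2 * symform S z.
Proof.
rewrite /symform mulr_sumr; apply: eq_bigr => i _.
by rewrite mulr_sumr; apply: eq_bigr => j _; rewrite !mxE; ring.
Qed.

Lemma hformZ A (c : C) z : hform A (c *: z) = c * Num.conj c * hform A z.
Proof.
rewrite /hform mulr_sumr; apply: eq_bigr => i _.
by rewrite mulr_sumr; apply: eq_bigr => j _; rewrite !mxE rmorphM /=; ring.
Qed.

Lemma hermpart_herm H : hermpart H \is hermsymmx.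
Proof.
apply/hermsymmxP => i j; rewrite !mxE /Num.conj /=; apply/eqP.
by rewrite eq_complex /=; apply/andP; split; apply/eqP; ring.
Qed.

(** Multiplication by i changes the sign of the pluriharmonic part and preserves the Hermitian
    part. *)
Lemma quad_toR_i H z : quad H (toR z) + quad H (toR ('i%C *: z)) =
  2 * Re (hform (hermpart H) z).
Proof.
rewrite !quad_toR symformZ hformZ sqr_i mulN1r mul_conj /= expr0n expr1n add0r mul1r.
by case: (symform _ _) (hform _ _) => a b [c d] /=; ring.
Qed.

(** Its rows are the real vectors of xi_k and of i xi_k, so that summing [quad H] over all rows
    leaves only the Hermitian part. *)
Definition dirmx xi : 'M[R]_(n + n) :=
  block_mx (map_mx Re xi) (map_mx Im xi) (- map_mx Im xi) (map_mx Re xi).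

Lemma row_dirmx_l xi k : row (li k) (dirmx xi) = toR (row k xi).
Proof.
rewrite /dirmx /block_mx rowKu /toR.
by rewrite row_row_mx; congr row_mx; apply/rowP => j; rewrite !mxE.
Qed.

Lemma row_dirmx_r xi k : row (ri k) (dirmx xi) = toR ('i%C *: row k xi).
Proof.
rewrite /dirmx /block_mx rowKd /toR.
rewrite row_row_mx; congr row_mx; apply/rowP => j; rewrite !mxE;
  by case: (xi k j) => a b /=; ring.
Qed.

Lemma tr_dirmx H xi : \tr (dirmx xi *m H *m (dirmx xi)^T) =
  2 * \sum_k Re (hform (hermpart H) (row k xi)).
Proof.
have E k : (dirmx xi *m H *m (dirmx xi)^T) k k = quad H (row k (dirmx xi)).
  rewrite /quad -row_mul; rewrite [LHS]mxE [RHS]mxE; apply: eq_bigr => j _.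
  by rewrite !mxE.
rewrite /mxtrace (eq_bigr _ (fun k _ => E k)) big_split_ord /= -big_split mulr_sumr.
by apply: eq_bigr => k _ /=; rewrite row_dirmx_l row_dirmx_r quad_toR_i.
Qed.

Lemma ReM (c d : C) : Re (c * d) = Re c * Re d - Im c * Im d.
Proof. by case: c d => a b [a' b']. Qed.

Lemma ImM (c d : C) : Im (c * d) = Re c * Im d + Im c * Re d.
Proof. by case: c d => a b [a' b'] /=; ring. Qed.

Lemma Im_sum (I : Type) (r : seq I) (P : pred I) (F : I -> C) :
  Im (\sum_(i <- r | P i) F i) = \sum_(i <- r | P i) Im (F i).
Proof. by rewrite (@big_morph _ _ Im 0 +%R 0 +%R) // => -[a b] [c d]. Qed.

Lemma dirmxM xi eta : dirmx xi *m dirmx eta = dirmx (xi *m eta).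
Proof.
have hRe : map_mx Re (xi *m eta) =
    map_mx Re xi *m map_mx Re eta - map_mx Im xi *m map_mx Im eta.
  apply/matrixP => i j; rewrite !mxE Re_sum -sumrB; apply: eq_bigr => k _.
  by rewrite !mxE ReM.
have hIm : map_mx Im (xi *m eta) =
    map_mx Re xi *m map_mx Im eta + map_mx Im xi *m map_mx Re eta.
  apply/matrixP => i j; rewrite !mxE Im_sum -big_split; apply: eq_bigr => k _.
  by rewrite !mxE ImM.
rewrite /dirmx mulmx_block hRe hIm !mulNmx !mulmxN.
by congr block_mx; rewrite ?opprD // addrC.
Qed.

Lemma dirmx1 : dirmx 1%:M = 1%:M.
Proof.
rewrite /dirmx scalar_mx_block; congr block_mx; apply/matrixP => i j; rewrite !mxE;
  by case: (_ == _); rewrite ?oppr0.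
Qed.

Lemma dirmx_unit xi : sqnormc (\det xi) = 1 -> dirmx xi \in unitmx.
Proof.
move=> xi1; have uxi : xi \in unitmx.
  rewrite unitmxE unitfE; apply: contra_eq_neq xi1 => ->.
  by rewrite /sqnormc /= expr0n addr0 eq_sym oner_neq0.
have /mulmx1_unit[] // : dirmx xi *m dirmx (invmx xi) = 1%:M.
by rewrite dirmxM mulmxV// dirmx1.
Qed.

Lemma normc_lt (c : C) (e : R) : `|Re c| < e / 2 -> `|Im c| < e / 2 -> `|c| < e%:C%C.
Proof.
move=> h1 h2; rewrite normc_def ltcR.
have e0 : 0 < e by have := normr_ge0 (Re c); lra.
rewrite -(ger0_norm (ltW e0)) -sqrtr_sqr ltr_sqrt; last by rewrite exprn_gt0.
rewrite -(real_normK (num_real (Re c))) -(real_normK (num_real (Im c))).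
have := normr_ge0 (Re c); have := normr_ge0 (Im c); nra.
Qed.

Lemma normc_Re (c : C) (e : R) : `|c| < e%:C%C -> `|Re c| < e /\ `|Im c| < e.
Proof.
rewrite normc_def ltcR => h.
have e0 : 0 < e by apply: le_lt_trans h; exact: sqrtr_ge0.
have {}h : Re c ^+ 2 + Im c ^+ 2 < e ^+ 2.
  by rewrite -ltr_sqrt ?exprn_gt0// sqrtr_sqr ger0_norm// ltW.
split; rewrite -ltr_sqr ?nnegrE ?(ltW e0)// real_normK ?num_real//.
  by have := sqr_ge0 (Im c); lra.
by have := sqr_ge0 (Re c); lra.
Qed.

Lemma complex_pos (e : C) : 0 < e -> exists2 e' : R, 0 < e' & e = e'%:C%C.
Proof.
by case: e => a b; rewrite ltcE /= => /andP[/eqP -> a0]; exists a.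
Qed.

(** Radii on the complex side are positive elements of [R[i]], hence real. A real box of half-width
    e/2 maps into the polydisc of radius e, and the modulus dominates both coordinates for the
    converse. *)
Lemma nbhs_toC x (Q : set Cn) : nbhs (toC x) Q <-> nbhs x (fun y => Q (toC y)).
Proof.
split=> /nbhs_ballP[e /= e0 eQ].
  have [e' e'0 eE] := complex_pos e0.
  apply/nbhs_ballP; exists (e' / 2) => /=; first by rewrite divr_gt0.
  move=> y [_ xy]; apply: eQ; split => // i j; rewrite eE ord1 -ball_normE /= !mxE.
  have h1 := xy 0 (li j); have h2 := xy 0 (ri j).
  by apply: normc_lt; move: h1 h2; rewrite -!ball_normE /=.
apply/nbhs_ballP; exists (e%:C)%C => /=; first by rewrite ltcR.
move=> z [_ xz]; rewrite -(toRK z); apply: eQ; split => // i k; rewrite ord1 -ball_normE /=.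
case: (splitP k) => j jE.
  have -> : k = li j by exact: val_inj.
  rewrite toR_l; have := xz 0 j; rewrite -ball_normE /= mxE => /normc_Re[].
  by case: (z 0 j).
have -> : k = ri j by exact: val_inj.
rewrite toR_r; have := xz 0 j; rewrite -ball_normE /= mxE => /normc_Re[].
by case: (z 0 j).
Qed.

Lemma continuous_toC : continuous toC.
Proof. by move=> x Q /nbhs_toC. Qed.

Lemma normrV_coord (z : Cn) (e : C) j : `|z| < e -> `|z 0 j| < e.
Proof.
move=> ze; have : ball_ (fun z : Cn => `|z|) (0 : Cn) e z.
  by rewrite /ball_ /= sub0r normrN.
rewrite -mx_norm_ball => -[_ /(_ 0 j)].
by rewrite -ball_normE /= mxE sub0r normrN.
Qed.

Lemma bounded_toC (W : set Cn) : bounded_set W -> bounded_set [set x | W (toC x)].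
Proof.
move=> [M [Mreal WM]].
have /complex_realP[M' M'E] := Mreal.
exists (Num.max M' 0 + 1); split; first exact: num_real.
move=> K MK x /= Wx.
have M'0 : M' <= Num.max M' 0 by rewrite le_max lexx.
have M0 : 0 <= Num.max M' 0 by rewrite le_max lexx orbT.
have MK' : M < (Num.max M' 0 + 1 / 2)%:C%C by rewrite M'E ltcR; lra.
have h := WM _ MK' (toC x) Wx.
have hk j : `|toC x 0 j| < K%:C%C.
  by apply: normrV_coord; apply: le_lt_trans h _; rewrite ltcR; lra.
apply: normv_le => [|k]; first by lra.
case: (splitP k) => j jE.
  have -> : k = li j by exact: val_inj.
  by have /normc_Re[+ _] := hk j; rewrite mxE /= => /ltW.
have -> : k = ri j by exact: val_inj.
by have /normc_Re[_] := hk j; rewrite mxE /= => /ltW.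
Qed.

(** Closed and bounded in real coordinates: a point of the closure is within 1 of a point of [W]. *)
Lemma compact_toC (W : set Cn) : bounded_set W -> compact [set x | closure W (toC x)].
Proof.
move=> bW; apply: bounded_closed_compact; last first.
  apply: (@closed_comp _ _ toC); last exact: closed_closure.
  by move=> x _; exact: continuous_toC.
have [M [Mreal WM]] := bounded_toC bW.
exists (M + 2); split; first exact: num_real.
move=> K MK x /= clx.
have : nbhs (toC x) [set z | ball x 1 (toR z)].
  apply/nbhs_toC; apply: (@filterS _ _ _ (ball x 1)); last exact: nbhsx_ballx.
  by move=> y; rewrite /= toCK.
move=> /clx[z [Wz]]; rewrite -ball_normE /= => xz.
have M1 : M < M + 1 by rewrite ltrDl.
have := WM _ M1 (toR z); rewrite /= toRK => /(_ Wz) zM.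
by have := ler_normD (x - toR z) (toR z); rewrite subrK; lra.
Qed.

Lemma open_toC (W : set Cn) : open W -> open [set x | W (toC x)].
Proof. by move=> oW; apply: open_comp oW => x _; exact: continuous_toC. Qed.

End RealCoordinates.

(** * Test polynomials from real jets, and the sign of the Hermitian part *)

Section ComplexJets.
Context {R : realType} {n : nat}.
Local Notation C := R[i].
Local Notation Cn := 'rV[R[i]]_n.
Local Notation V := 'rV[R]_(n + n).
Local Notation Re := (@complex.Re _).
Local Notation Im := (@complex.Im _).
Local Notation li := (lshift n).
Local Notation ri := (@rshift n n).
Implicit Types (A B : 'M[C]_n) (z : Cn) (xi : 'M[C]_n) (x y h b : V) (H : 'M[R]_(n + n)).

Definition hol_mpoly (c : C) (beta : 'I_n -> C) (S : 'M[C]_n) : mpoly n C :=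
  mpolyC n c + \sum_i beta i *: mpolyX C (mnm1 i) +
  \sum_i \sum_j S i j *: mpolyX C (mnm_add (mnm1 i) (mnm1 j)).

Lemma hol_mpoly_size c beta S : (mmeasure mdeg (hol_mpoly c beta S) <= 3)%N.
Proof.
rewrite /hol_mpoly; apply: leq_trans (mmeasureD_le _ _ _) _; rewrite geq_max; apply/andP; split.
  apply: leq_trans (mmeasureD_le _ _ _) _; rewrite geq_max; apply/andP; split.
    by rewrite mmeasureC; case: (_ != _).
  apply: leq_trans (mmeasure_sum _ _ _ _) _; apply/bigmax_leqP => i _.
  by apply: leq_trans (mmeasureZ_le _ _ _) _; rewrite mmeasureX /= mdeg1.
apply: leq_trans (mmeasure_sum _ _ _ _) _; apply/bigmax_leqP => i _.
apply: leq_trans (mmeasure_sum _ _ _ _) _; apply/bigmax_leqP => j _.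
by apply: leq_trans (mmeasureZ_le _ _ _) _; rewrite mmeasureX /= mdegD !mdeg1.
Qed.

Lemma hol_mpolyE c beta S z : meval (fun i => z 0 i) (hol_mpoly c beta S) =
  c + \sum_i beta i * z 0 i + symform S z.
Proof.
rewrite /hol_mpoly !mevalD mevalC; congr (_ + _ + _).
  by rewrite raddf_sum; apply: eq_bigr => i _; rewrite /= mevalZ mevalXU.
rewrite raddf_sum; apply: eq_bigr => i _; rewrite /= raddf_sum.
by apply: eq_bigr => j _; rewrite /= mevalZ mpolyXD mevalM !mevalXU mulrA.
Qed.

Lemma dotv_toR b z : dotv b (toR z) =
  Re (\sum_i (b 0 (li i) -i* b 0 (ri i))%C * z 0 i).
Proof.
rewrite dotvE big_split_ord /= Re_sum.
rewrite -big_split; apply: eq_bigr => i _ /=; rewrite toR_l toR_r.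
by case: (z 0 i) => a c /=; ring.
Qed.

(** The Hermitian polynomial is centred at the origin, so the jet at [z0] is expanded about 0; the
    constant, linear and pluriharmonic terms all go into [h]. *)
Lemma jet_decomposition (z0 : Cn) (c : R) b H : exists2 h : Cn -> C, Hol2 h &
  forall z, Re (hform (hermpart H) z) + Re (h z) =
    c + dotv b (toR z - toR z0) + quad H (toR z - toR z0).
Proof.
pose y0 := - toR z0.
pose b' := b + y0 *m (H + H^T).
pose q := hol_mpoly ((c + dotv b y0 + quad H y0)%:C%C)
  (fun i => (b' 0 (li i) -i* b' 0 (ri i))%C) (sympart H).
exists (fun z => meval (fun i => z 0 i) q).
  by exists q; split => //; exact: hol_mpoly_size.
move=> z; rewrite hol_mpolyE.
have -> (a d e : C) : Re (a + d + e) = Re a + Re d + Re e by case: a d e => ? ? [? ?] [? ?].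
rewrite -dotv_toR /= [toR z - _]addrC -/y0 quadDr !dotvDr /b' dotvDl quad_toR.
ring.
Qed.

Lemma derive1_quadratic (a b c : R) : derive1 (fun t : R => a + t * b + t ^+ 2 * c) 0 = b.
Proof.
rewrite derive1E.
have h1 : is_derive (0 : R) 1 (b \*: id) (b *: (1 : R)) by exact: is_deriveZ.
have h2 : is_derive (0 : R) 1 (c \*: (id ^+ 2 : R -> R)) (c *: ((2 * 0 ^+ 1) *: (1 : R))).
  by apply: is_deriveZ; exact: is_deriveX.
have := is_deriveD (is_deriveD (is_derive_cst a (0 : R) 1) h1) h2.
have regZ (p q : R) : p *: (q : R^o) = q * p by exact: mulrC.
rewrite (_ : _ + _ + _ = (fun t : R => a + t * b + t ^+ 2 * c)); last first.
  by apply/funext => t; rewrite !fctE /= !regZ.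
by move=> h; rewrite derive_val !regZ; ring.
Qed.

(** The derivative of [hform A] with respect to the conjugate of z_j. *)
Definition hgrad A z (j : 'I_n) : C := \sum_i A j i * z 0 i.

Lemma hgradD A z w j : hgrad A (z + w) j = hgrad A z j + hgrad A w j.
Proof. by rewrite /hgrad -big_split; apply: eq_bigr => i _; rewrite !mxE mulrDr. Qed.

Lemma hgradZ A (c : C) z j : hgrad A (c *: z) j = c * hgrad A z j.
Proof. by rewrite /hgrad mulr_sumr; apply: eq_bigr => i _; rewrite !mxE; ring. Qed.

Lemma hgrad_delta A i j : hgrad A (delta_mx 0 i) j = A j i.
Proof.
rewrite /hgrad (bigD1 i)//= big1 ?addr0 => [|k ki]; rewrite mxE eqxx /=.
  by rewrite eqxx mulr1.
by rewrite (negPf ki) mulr0.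
Qed.

Lemma hformD A z w : A \is hermsymmx -> Re (hform A (z + w)) =
  Re (hform A z) + 2 * Re (\sum_j hgrad A z j * Num.conj (w 0 j)) + Re (hform A w).
Proof.
move=> /hermsymmxP hA.
set X := \sum_j _.
have X1 : \sum_i \sum_j A j i * z 0 i * Num.conj (w 0 j) = X.
  by rewrite exchange_big; apply: eq_bigr => j _; rewrite mulr_suml.
have X2 : \sum_i \sum_j A j i * w 0 i * Num.conj (z 0 j) = Num.conj X.
  rewrite -X1 [in RHS]exchange_big /= rmorph_sum; apply: eq_bigr => i _.
  rewrite rmorph_sum; apply: eq_bigr => j _.
  by rewrite !rmorphM /= conjCK -hA; ring.
have -> : hform A (z + w) = hform A z + (X + Num.conj X) + hform A w.
  rewrite /hform -X2 -X1 -!big_split; apply: eq_bigr => i _ /=.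
  rewrite -!big_split; apply: eq_bigr => j _ /=.
  by rewrite !mxE rmorphD /=; ring.
by case: (hform A z) X {X1 X2} (hform A w) => a d [e f] [g k]; rewrite /Num.conj /=; ring.
Qed.

(** Along a real line the form is a quadratic polynomial in t, whose linear coefficient is read off
    from the expansion of [hform]. *)
Lemma real_deriv_hform A (p : Cn -> R) z v : A \is hermsymmx ->
  (forall z, (p z)%:C%C = hform A z) ->
  real_deriv v (fun w => (p w)%:C%C) z =
  (2 * Re (\sum_j hgrad A z j * Num.conj (v 0 j)))%:C%C.
Proof.
move=> hA pA; have pE w : p w = Re (hform A w) by rewrite -pA.
rewrite /real_deriv /=.
have -> : (fun t : R => p (z + t%:C%C *: v)) = (fun t : R => Re (hform A z) +
    t * (2 * Re (\sum_j hgrad A z j * Num.conj (v 0 j))) + t ^+ 2 * Re (hform A v)).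
  apply/funext => t; rewrite pE hformD// hformZ mul_conj ReM_real /= expr0n addr0.
  congr (_ + _ + _); rewrite mulrCA; congr (_ * _).
  rewrite -ReM_real mulr_sumr; congr complex.Re; apply: eq_bigr => j _.
  by rewrite mxE conj_scale_real; ring.
rewrite derive1_quadratic.
have -> : derive1 (fun _ : R => 0 : R) 0 = 0 by rewrite derive1_cst.
by [].
Qed.

Lemma sum_conj_delta A z (c : C) k :
  \sum_j hgrad A z j * Num.conj ((c *: delta_mx 0 k : Cn) 0 j) = hgrad A z k * Num.conj c.
Proof.
rewrite (bigD1 k)//= big1 ?addr0 => [|j jk]; rewrite !mxE eqxx /=.
  by rewrite eqxx mulr1.
by rewrite (negPf jk) mulr0 rmorph0 mulr0.
Qed.

Lemma dzbar_hform A (p : Cn -> R) z j : A \is hermsymmx ->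
  (forall z, (p z)%:C%C = hform A z) ->
  dzbar j (fun w => (p w)%:C%C) z = hgrad A z j.
Proof.
move=> hA pA; rewrite /dzbar !(real_deriv_hform _ _ hA pA).
rewrite sum_conj_delta -[delta_mx 0 j]scale1r sum_conj_delta rmorph1 mulr1.
have two : (2 : C) != 0 by rewrite pnatr_eq0.
apply: (mulIf two); rewrite divfK//.
case: (hgrad A z j) => a b; rewrite -mulr_natr /Num.conj.
by apply/eqP; rewrite eq_complex /=; apply/andP; split; apply/eqP; ring.
Qed.

Lemma derive1_affine (a b : R) : derive1 (fun t : R => a + t * b) 0 = b.
Proof.
have := derive1_quadratic a b 0.
by under eq_fun do rewrite mulr0 addr0.
Qed.

Lemma real_deriv_hgrad A z v j : real_deriv v (fun w => hgrad A w j) z = hgrad A v j.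
Proof.
rewrite /real_deriv.
have -> : (fun t : R => complex.Re (hgrad A (z + t%:C%C *: v) j)) =
    (fun t : R => Re (hgrad A z j) + t * Re (hgrad A v j)).
  by apply/funext => t; rewrite hgradD hgradZ; case: (hgrad A z j) (hgrad A v j) => a b [c d] /=; ring.
have -> : (fun t : R => complex.Im (hgrad A (z + t%:C%C *: v) j)) =
    (fun t : R => Im (hgrad A z j) + t * Im (hgrad A v j)).
  by apply/funext => t; rewrite hgradD hgradZ; case: (hgrad A z j) (hgrad A v j) => a b [c d] /=; ring.
by rewrite !derive1_affine; case: (hgrad A v j).
Qed.

Lemma MC_hform A (p : Cn -> R) z : A \is hermsymmx ->
  (forall z, (p z)%:C%C = hform A z) -> MC p z = Re (\det (2 *: A)).
Proof.
move=> hA pA; rewrite /MC; congr (complex.Re (\det (_ *: _))).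
apply/matrixP => j i; rewrite mxE.
have -> : dzbar j (fun w => (p w)%:C%C) = fun w => hgrad A w j.
  by apply/funext => w; exact: dzbar_hform.
rewrite /dz !real_deriv_hgrad hgradZ hgrad_delta.
have two : (2 : C) != 0 by rewrite pnatr_eq0.
apply: (mulIf two); rewrite divfK//.
by rewrite mulrA -expr2 sqr_i mulN1r opprK mulr_natr mulr2n.
Qed.

Lemma sqn_toR z : sqn (toR z) = \sum_i sqnormc (z 0 i).
Proof.
rewrite sqnE big_split_ord /=.
by rewrite -big_split; apply: eq_bigr => i _ /=; rewrite toR_l toR_r.
Qed.

Lemma sqn_toRZ (c : C) z : sqn (toR (c *: z)) = sqnormc c * sqn (toR z).
Proof.
by rewrite !sqn_toR mulr_sumr; apply: eq_bigr => i _; rewrite mxE sqnormcM.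
Qed.

Lemma sqnormc_le1 (c : C) : `|c| <= 1 -> sqnormc c <= 1.
Proof.
rewrite normc_def -[1]/(1%:C)%C lecR => h; rewrite /sqnormc.
by rewrite -[leLHS]sqr_sqrtr ?sqnormc_ge0// expr_le1// sqrtr_ge0.
Qed.

Lemma toRN z : toR (- z) = - toR z.
Proof.
by rewrite /toR opp_row_mx; congr row_mx; apply/rowP => k; rewrite !mxE; case: (z 0 k).
Qed.

Definition cis (t : R) : C := (cos t +i* sin t)%C.

Lemma sqnormc_cis t : sqnormc (cis t) = 1.
Proof. by rewrite /sqnormc /= cos2Dsin2. Qed.

Lemma continuous_toR_cis (x0 : V) (z : Cn) : continuous (fun t => x0 + toR (cis t *: z)).
Proof.
have -> : (fun t => x0 + toR (cis t *: z)) =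
    (fun t => x0 + (cos t *: toR z + sin t *: toR ('i%C *: z))).
  apply/funext => t; congr (_ + _); apply/rowP => k; rewrite !mxE.
  by case: (fintype.split k) => j; rewrite !mxE; case: (z 0 j) => a b /=; ring.
move=> t.
have h1 : cos s *: toR z @[s --> t] --> cos t *: toR z.
  by apply: cvgZr_tmp; exact: continuous_cos.
have h2 : sin s *: toR ('i%C *: z) @[s --> t] --> sin t *: toR ('i%C *: z).
  by apply: cvgZr_tmp; exact: continuous_sin.
exact: (cvgD (@cst_continuous R V x0 t) (cvgD h1 h2)).
Qed.

(* Adding up the mean value inequalities for [z], [- z], [i z] and [- i z] kills
   the linear and the pluriharmonic parts of the touching polynomial. *)
Lemma psh_hform_ge0 (Omega : set Cn) (u : Cn -> R) (w : V -> R) (x0 : V) b H :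
  open Omega -> psh Omega (EFin \o u) -> continuous w -> Omega (toC x0) ->
  (\forall x \near x0, w x = u (toC x)) ->
  (\forall h \near (0 : V), w (x0 + h) <= w x0 + dotv b h + quad H h) ->
  forall z, 0 <= Re (hform (hermpart H) z).
Proof.
move=> oO [_ _ mv] cw O0 wu wtouch z.
have : \forall h \near (0 : V), [/\ Omega (toC (x0 + h)), w (x0 + h) = u (toC (x0 + h)) &
    w (x0 + h) <= w x0 + dotv b h + quad H h].
  have O1 := (near_translate x0 (fun y => Omega (toC y))).1
    (open_nbhs_nbhs (conj (open_toC oO) O0)).
  have w1 := (near_translate x0 (fun y => w y = u (toC y))).1 wu.
  by near=> h; split; near: h.
move=> /near0_sqn[r r0 rP].
pose q := sqn (toR z).
have q0 : 0 <= q by exact: sqn_ge0.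
(* Rescales [z] so that the whole circle through it stays in the ball where the touching inequality
   holds; positivity of the form is invariant under scaling. *)
pose s := Num.sqrt (r ^+ 2 / (q + 1)).
have q1 : 0 < q + 1 by lra.
have s2 : s ^+ 2 = r ^+ 2 / (q + 1) by rewrite sqr_sqrtr// divr_ge0// ?sqr_ge0// ltW.
have s20 : 0 < s ^+ 2 by rewrite s2 divr_gt0// exprn_gt0.
pose y := s%:C%C *: z.
have yr : sqn (toR y) <= r ^+ 2.
  rewrite sqn_toRZ /sqnormc /= expr0n addr0 s2 mulrAC ler_pdivrMr// -/q.
  by rewrite ler_pM2l ?exprn_gt0//; lra.
have inr (c : C) : sqnormc c <= 1 -> sqn (toR (c *: y)) <= r ^+ 2.
  by move=> c1; rewrite sqn_toRZ; apply: le_trans yr; rewrite ler_piMl// sqn_ge0.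
have pi2 : 0 < 2 * pi :> R by rewrite mulr_gt0// pi_gt0.
have [F F_def] : exists F : C -> R -> R,
    F = fun c t => w (x0 + toR (cis t *: (c *: y))) by eexists.
have cF c : continuous (F c).
  rewrite F_def => t; apply: continuous_comp; first exact: continuous_toR_cis.
  exact: cw.
have mF c : sqnormc c = 1 -> w x0 <= mean (2 * pi) (F c).
  move=> c1.
  have disc (t : C) : `|t| <= 1 -> Omega (toC x0 + t *: (c *: y)).
    move=> /sqnormc_le1 t1.
    have /rP[+ _ _] : sqn (toR ((t * c) *: y)) <= r ^+ 2 by apply: inr; rewrite sqnormcM c1 mulr1.
    by rewrite toCD toRK scalerA.
  have := mv _ _ disc.
  have -> : (EFin \o u) (toC x0) = (w x0)%:E.
    have s0 : sqn (0 : V) <= r ^+ 2 by rewrite sqn0 sqr_ge0.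
    by have [_ + _] := rP 0 s0; rewrite addr0 /= => ->.
  have -> : (\int[lebesgue_measure]_(theta in `[0%R, (2 * pi)%R])
      (EFin \o u) (toC x0 + (cos theta +i* sin theta)%C *: (c *: y))%R =
      \int[lebesgue_measure]_(theta in `[0%R, (2 * pi)%R]) (EFin \o F c) theta)%E.
    apply: eq_integral => t _; rewrite /= F_def.
    have /rP[_ -> _] : sqn (toR (cis t *: (c *: y))) <= r ^+ 2.
      by rewrite sqn_toRZ sqnormc_cis mul1r; apply: inr; rewrite c1.
    by rewrite toCD toRK.
  have Fi : lebesgue_measure.-integrable `[0, 2 * pi] (EFin \o F c).
    apply: continuous_compact_integrable; first exact: segment_compact.
    exact: continuous_subspaceT.
  have Ff : (\int[lebesgue_measure]_(theta in `[0%R, (2 * pi)%R]) (EFin \o F c) theta)%E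
      \is a fin_num by exact: integrable_fin_num.
  rewrite -(fineK Ff).
  by rewrite -EFinM lee_fin mulrC.
have cD (f g : R -> R) : continuous f -> continuous g -> continuous (fun t => f t + g t).
  by move=> cf cg t; exact: (cvgD (cf t) (cg t)).
have c12 := cD _ _ (cF 1) (cF (-1)); have c34 := cD _ _ (cF 'i%C) (cF (- 'i%C)).
(* The sum of the four circle averages is attained at one angle [t], so the touching inequality is
   needed only at four points of one orbit under multiplication by i. *)
have [t _] := mean_mid pi2 (cD _ _ c12 c34).
rewrite (meanD pi2 c12 c34) (meanD pi2 (cF 1) (cF (-1))).
rewrite (meanD pi2 (cF 'i%C) (cF (- 'i%C))) => tE.
have n1 : sqnormc (1 : C) = 1 by rewrite /sqnormc /=; ring.
have n2 : sqnormc (-1 : C) = 1 by rewrite /sqnormc /=; ring.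
have n3 : sqnormc ('i%C : C) = 1 by rewrite /sqnormc /=; ring.
have n4 : sqnormc (- 'i%C : C) = 1 by rewrite /sqnormc /=; ring.
have := mF 1 n1; have := mF (-1) n2; have := mF 'i%C n3; have := mF (- 'i%C) n4.
pose zeta := cis t *: y.
have FE c : sqnormc c = 1 -> F c t <= w x0 + dotv b (toR (c *: zeta)) + quad H (toR (c *: zeta)).
  move=> c1; rewrite F_def (_ : cis t *: (c *: y) = c *: zeta); last first.
    by rewrite /zeta [LHS]scalerA [RHS]scalerA mulrC.
  have /rP[] // : sqn (toR (c *: zeta)) <= r ^+ 2.
  by rewrite /zeta scalerA; apply: inr; rewrite sqnormcM c1 sqnormc_cis mulr1.
have := quad_toR_i H zeta.
have -> : Re (hform (hermpart H) zeta) = s ^+ 2 * Re (hform (hermpart H) z).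
  rewrite /zeta /y !hformZ !mul_conj -!/(sqnormc _) sqnormc_cis mul1r ReM_real.
  by rewrite /sqnormc /= expr0n addr0.
have := FE 1 n1; have := FE (-1) n2; have := FE 'i%C n3; have := FE (- 'i%C) n4.
clear FE; clearbody zeta.
rewrite !scaleNr !scale1r !toRN !dotvN !quadN.
rewrite -(pmulr_rge0 _ s20); lra.
Unshelve. all: by end_near. Qed.

End ComplexJets.

(** * Comparison *)

Section Comparison.
Context {R : realType} {n : nat}.
Local Notation C := R[i].
Local Notation Cn := 'rV[R[i]]_n.
Local Notation V := 'rV[R]_(n + n).
Local Notation Re := (@complex.Re _).
Implicit Types (A B : 'M[C]_n) (z : Cn) (xi : 'M[C]_n) (x y h b c : V) (H : 'M[R]_(n + n)).

(** The coordinatewise projection onto the closed cube of centre [c] and half-side [r], that is,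
    onto a ball of the sup norm. *)
Definition clamp c (r : R) x : V :=
  \row_k Num.max (c 0 k - r) (Num.min (c 0 k + r) (x 0 k)).

Lemma clamp_lipschitz c r x y : `|clamp c r x - clamp c r y| <= `|x - y|.
Proof.
have lip (a d s t : R) : `|Num.max a (Num.min d s) - Num.max a (Num.min d t)| <= `|s - t|.
  have h1 : `|Num.min d s - Num.min d t| <= `|s - t|.
    by case: (leP d s) (leP d t) => ? [] ?; have := ler_norm (s - t);
      have := ler_norm (t - s); rewrite (distrC t) ler_norml => ? ?; apply/andP; split; lra.
  apply: le_trans h1; move: (Num.min d s) (Num.min d t) => p q.
  by case: (leP a p) (leP a q) => ? [] ?; have := ler_norm (p - q);
    have := ler_norm (q - p); rewrite (distrC q) ler_norml => ? ?; apply/andP; split; lra.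
apply: normv_le => // k; rewrite !mxE.
by apply: le_trans (lip _ _ _ _) _; have := normv_coord (x - y) k; rewrite !mxE.
Qed.

Lemma clamp_near c r x : 0 <= r -> `|clamp c r x - c| <= r.
Proof.
move=> r0; apply: normv_le => // k; rewrite !mxE ler_norml.
case: (leP (c 0 k + r) (x 0 k)) => ?.
  by case: (leP (c 0 k - r) (c 0 k + r)) => ?; apply/andP; split; lra.
by case: (leP (c 0 k - r) (x 0 k)) => ?; apply/andP; split; lra.
Qed.

Lemma clamp_id c r x : `|x - c| <= r -> clamp c r x = x.
Proof.
move=> xr; apply/rowP => k; rewrite mxE.
have := le_trans (normv_coord (x - c) k) xr; rewrite !mxE ler_norml => /andP[h1 h2].
case: (leP (c 0 k + r) (x 0 k)) => ?.
  by case: (leP (c 0 k - r) (c 0 k + r)) => ?; lra.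
by case: (leP (c 0 k - r) (x 0 k)) => ?; lra.
Qed.

(** Averaging and polynomial approximation are stated for functions continuous everywhere, while [u]
    and [v] are controlled only over [Omega]; near a point they are replaced by such extensions. *)
Lemma clamp_extension (g : V -> R) c (r : R) : 0 <= r ->
  (forall x, `|x - c| <= r -> {for x, continuous g}) ->
  exists2 w : V -> R, continuous w & forall x, `|x - c| <= r -> w x = g x.
Proof.
move=> r0 cg; exists (fun x => g (clamp c r x)) => [x|x xr]; last by rewrite clamp_id.
have cc : clamp c r @ x --> clamp c r x.
  apply/(@cvgrPdist_lt _ _ _ (nbhs x)) => e e0.
  apply/nbhs_ballP; exists e => //= y; rewrite -ball_normE /= => xy.
  by apply: le_lt_trans xy; exact: clamp_lipschitz.
exact: (continuous_comp cc (cg _ (clamp_near _ _ r0))).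
Qed.

Lemma hform_scale (a : C) A z : hform (a *: A) z = a * hform A z.
Proof.
rewrite /hform mulr_sumr; apply: eq_bigr => i _; rewrite mulr_sumr.
by apply: eq_bigr => j _; rewrite mxE; ring.
Qed.

Lemma hermsymmx_double A : A \is hermsymmx -> 2 *: A \is hermsymmx.
Proof.
move=> /hermsymmxP hA; apply/hermsymmxP => i j; rewrite !mxE rmorphM /= -hA.
by rewrite rmorph_nat.
Qed.

Lemma Re_hform_double A z : Re (hform (2 *: A) z) = 2 * Re (hform A z).
Proof. by rewrite hform_scale; case: (hform A z) => a d /=; ring. Qed.

Lemma hform_hermpartD H e z :
  Re (hform (hermpart (H + e%:M)) z) = Re (hform (hermpart H) z) + e * sqn (toR z).
Proof.
have := quad_toR_i H z; have := quad_toR_i (H + e%:M) z.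
rewrite !quadD -scalemx1 !quadZ !quad1 sqn_toRZ.
have -> : sqnormc ('i%C : C) = 1 by rewrite /sqnormc /=; ring.
lra.
Qed.

Lemma nonneg_hermitian_hform A : A \is hermsymmx ->
  (forall z, 0 <= Re (hform A z)) -> nonneg_hermitian A.
Proof.
move=> hA A0; split=> // v; rewrite -[v]trmxK.
move: (v^T) => {}v; have -> : ((v^T ^t* )%sesqui *m A *m v^T) 0 0 = hform A v.
  by rewrite hformE trmxK.
by rewrite hform_real// lecR.
Qed.

Lemma Tplus_hform A : A \is hermsymmx -> (forall z, 0 <= Re (hform A z)) ->
  Tplus (fun z => Re (hform A z)).
Proof.
move=> hA A0; exists A; split; first exact: nonneg_hermitian_hform.
by move=> z; rewrite -hform_real.
Qed.

Section Solutions.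
Context (Omega : set Cn) (f : Cn -> R -> R) (u v : Cn -> R).
Context (n0 : (0 < n)%N) (oO : open Omega).

(** After adding e |h|^2 the jet touches, its Hermitian part is non-negative by the sub-mean value
    property, and so it yields an admissible test polynomial. The trace inequality bounds the
    determinant, and e tends to 0. *)
Lemma subsolution_superjet w x0 b H (m : R) xi :
  viscosity_subsolution Omega f u -> continuous w -> Omega (toC x0) ->
  (\forall x \near x0, w x = u (toC x)) -> superjet w x0 b H ->
  0 <= m -> m ^+ n <= f (toC x0) (u (toC x0)) -> sqnormc (\det xi) = 1 ->
  n%:R * m <= \sum_k 2 * Re (hform (hermpart H) (row k xi)).
Proof.
move=> [_ upsh usub] cw O0 wu wj m0 mf xi1.
set S := \sum_k _; pose D := \sum_k 2 * sqn (toR (row k xi)).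
have D0 : 0 <= D by rewrite sumr_ge0// => k _; rewrite mulr_ge0// sqn_ge0.
apply/ler_addgt0Pl => e' e'0; rewrite addrC.
(* The added e |h|^2 changes the sum over the rows by exactly [e * D], hence by at most [e']. *)
pose e := e' / (D + 1); have D1 : 0 < D + 1 by lra.
have e0 : 0 < e by rewrite divr_gt0.
have eD : e * D <= e' by rewrite /e mulrAC ler_pdivrMr// ler_pM2l//; lra.
pose A := hermpart (H + e%:M).
have hA : A \is hermsymmx by exact: hermpart_herm.
have touch : \forall h \near (0 : V),
    w (x0 + h) <= w x0 + dotv b h + quad (H + e%:M) h.
  apply: filterS (wj e e0) => h.
  by rewrite quadD -scalemx1 quadZ quad1 addrA.
have A0 : forall z, 0 <= Re (hform A z) := psh_hform_ge0 oO upsh cw O0 wu touch.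
have wu0 : w x0 = u (toC x0) by exact: nbhs_singleton wu.
have [h hol hE] := jet_decomposition (toC x0) (w x0) b (H + e%:M).
have := usub _ (Tplus_hform hA A0) _ O0 _.
have th : touches_above (fun z => Re (hform A z) + Re (h z)) u (toC x0).
  split; first by rewrite hE subrr dotv0 quad0 !addr0.
  apply/nbhs_toC; apply/(near_translate x0 (fun x => u (toC x) <= _)).
  have w1 := (near_translate x0 (fun y => w y = u (toC y))).1 wu.
  near=> k; rewrite hE !toCK [x0 + k - x0]addrC addKr.
  have <- : w (x0 + k) = u (toC (x0 + k)) by near: k.
  by near: k.
move=> /(_ (ex_intro2 _ _ h hol th)).
rewrite (@MC_hform _ _ A)//; last by move=> z; rewrite -hform_real.
move=> fA; have {}fA := le_trans mf fA.
have A20 z : 0 <= Re (hform (2 *: A) z) by rewrite Re_hform_double mulr_ge0.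
have {}fA := le_trans fA (det_le_sum_hform n0 (hermsymmx_double hA) A20 xi1).
set T := \sum_k _ in fA.
have T0 : 0 <= T by rewrite sumr_ge0.
have nR : 0 < n%:R :> R by rewrite ltr0n.
have mT : m <= T / n%:R.
  by rewrite -(@ler_pXn2r _ n) ?nnegrE// divr_ge0// ltW.
rewrite mulrC -ler_pdivlMr//; apply: le_trans mT _; rewrite ler_pM2r ?invr_gt0//.
apply: (@le_trans _ _ (S + e * D)); last by rewrite lerD2l.
rewrite /T /S /D mulr_sumr -big_split /= le_eqVlt; apply/orP; left; apply/eqP.
by apply: eq_bigr => k _; rewrite Re_hform_double hform_hermpartD; ring.
Unshelve. all: by end_near. Qed.

(** The trace inequality for the identity matrix: it says that |z|^2 contributes at least [n] to
    each linear operator. *)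
Lemma sum_sqn_rows xi : sqnormc (\det xi) = 1 ->
  n%:R <= \sum_k sqn (toR (row k xi)) :> R.
Proof.
move=> xi1.
have h1 : (1%:M : 'M[C]_n) \is hermsymmx.
  by apply/hermsymmxP => i j; rewrite !mxE eq_sym; case: eqP => _; rewrite ?rmorph1 ?rmorph0.
have E z : Re (hform 1%:M z) = sqn (toR z).
  rewrite hformE mulmx1 mxE Re_sum sqn_toR; apply: eq_bigr => i _.
  by rewrite !mxE mulrC mul_conj.
have E0 z : 0 <= Re (hform 1%:M z) by rewrite E sqn_ge0.
have := det_le_sum_hform n0 h1 E0 xi1.
rewrite det1 (eq_bigr _ (fun k _ => E _)) /=.
have : 0 <= \sum_k sqn (toR (row k xi)) by rewrite sumr_ge0// => k _; exact: sqn_ge0.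
move: (\sum_k _) => S S0.
have nR : 0 < n%:R :> R by rewrite ltr0n.
have Sn0 : 0 <= S / n%:R by rewrite divr_ge0.
rewrite -{1}(expr1n R n) ler_pXn2r ?nnegrE//.
by rewrite ler_pdivlMr// mul1r.
Qed.

Context (f_nondecr : forall z, Omega z -> forall s t : R, s <= t -> f z s <= f z t).
Context (f_ge0 : forall z t, Omega z -> 0 <= f z t).

Let F x := f (toC x) (u (toC x)).

(** (e/2) |x|^2 adds e |xi_k|^2 to each term 2 hform(xi_k), in total at least n e. The outer factor
    2 is the one in [visc], the other being supplied by [tr_dirmx]. *)
Lemma visc_perturbed w x0 (e m r : R) xi :
  viscosity_subsolution Omega f u -> continuous w ->
  (forall x, `|x - x0| <= r -> [/\ Omega (toC x), w x = u (toC x) & m ^+ n <= F x]) ->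
  0 <= m -> 0 < e -> sqnormc (\det xi) = 1 ->
  visc (dirmx xi) (2 * (n%:R * (m + e))) [set x | `|x - x0| < r]
    (fun x => w x + e / 2 * sqn x).
Proof.
move=> usub cw rP m0 e0 xi1 x b H /= xr wj.
have [Ox wx mF] := rP x (ltW xr).
have wn : \forall y \near x, w y = u (toC y).
  have rx : 0 < r - `|x - x0| by rewrite subr_gt0.
  apply/nbhs_ballP; exists (r - `|x - x0|) => //= y; rewrite -ball_normE /= => xy.
  have /rP[] // : `|y - x0| <= r.
  by have := ler_distD x y x0; rewrite (distrC y x); lra.
have wj' : superjet w x (b - e *: x) (H + (- (e / 2))%:M).
  move=> d d0; apply: filterS (wj d d0) => h.
  rewrite sqnD dotvDl dotNv dotvZl quadD -scalemx1 quadZ quad1; lra.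
have := subsolution_superjet usub cw Ox wn wj' m0 mF xi1.
rewrite tr_dirmx.
have -> : \sum_k 2 * Re (hform (hermpart (H + (- (e / 2))%:M)) (row k xi)) =
    2 * (\sum_k Re (hform (hermpart H) (row k xi))) - e * \sum_k sqn (toR (row k xi)).
  rewrite !mulr_sumr -sumrB; apply: eq_bigr => k _.
  by rewrite hform_hermpartD; field.
have := ler_wpM2l (ltW e0) (sum_sqn_rows xi1); lra.
Qed.

(** At a point near [x0] the supersolution property bounds the determinant by f(v) <= f(u) < (a +
    e/4)^n, while regularizing [u] produces a test polynomial with determinant at least (m + e)^n,
    and m + e >= a + 3e/4. *)
Lemma no_interior_max x0 (e : R) :
  viscosity_subsolution Omega f u -> viscosity_supersolution Omega f v ->
  (forall x, Omega (toC x) -> {for x, continuous (fun x => u (toC x))}) ->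
  (forall x, Omega (toC x) -> {for x, continuous (fun x => v (toC x))}) ->
  {for x0, continuous F} ->
  0 < e -> Omega (toC x0) -> v (toC x0) < u (toC x0) ->
  (forall x, Omega (toC x) -> u (toC x) + e * sqn x - v (toC x) <=
     u (toC x0) + e * sqn x0 - v (toC x0)) -> False.
Proof.
move=> usub vsup uC vC FC e0 O0 vu0 gmax.
have [a a0 aF] := nth_root n0 (f_ge0 (u (toC x0)) O0).
(* A lower bound for the n-th root of [F] near [x0]. The maximum with 0 keeps it non-negative; if a
   - e/4 <= 0, then m^n = 0 is below [F] because f >= 0. *)
pose m := Num.max (a - e / 4) 0.
have m0 : 0 <= m by rewrite le_max lexx orbT.
have ma : a - e / 4 <= m by rewrite le_max lexx.
have [r r0 rP] : exists2 r : R, 0 < r & forall x, `|x - x0| <= r ->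
    [/\ Omega (toC x), v (toC x) < u (toC x), m ^+ n <= F x & F x < (a + e / 4) ^+ n].
  have On : \forall x \near x0, Omega (toC x).
    exact: open_nbhs_nbhs (conj (open_toC oO) O0).
  have vun : \forall x \near x0, v (toC x) < u (toC x).
    have d0 : 0 < (u (toC x0) - v (toC x0)) / 2 by rewrite divr_gt0// subr_gt0.
    have /(@cvgrPdist_lt _ _ _ (nbhs x0))/(_ _ d0) u1 := uC x0 O0.
    have /(@cvgrPdist_lt _ _ _ (nbhs x0))/(_ _ d0) v1 := vC x0 O0.
    apply: filterS2 u1 v1 => x; rewrite !ltr_norml => /andP[? ?] /andP[? ?]; lra.
  have Fl (d : R) : 0 < d -> \forall x \near x0, `|F x0 - F x| < d.
    by move=> d0; have /(@cvgrPdist_lt _ _ _ (nbhs x0))/(_ _ d0) := FC.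
  have F1 : \forall x \near x0, F x < (a + e / 4) ^+ n.
    have : 0 < (a + e / 4) ^+ n - F x0.
      by rewrite subr_gt0 /F -aF ltrXn2r ?nnegrE ?gtn_eqF//; lra.
    by move/Fl; apply: filterS => x; rewrite ltr_norml => /andP[? ?]; lra.
  have F2 : \forall x \near x0, m ^+ n <= F x.
    have [ae|ae] := leP (a - e / 4) 0.
      apply: filterS On => x Ox; rewrite /m (max_idPr ae) expr0n gtn_eqF//.
      exact: f_ge0.
    have : 0 < F x0 - m ^+ n.
      rewrite subr_gt0 /F -aF ltrXn2r ?nnegrE ?gtn_eqF//.
      by rewrite /m (max_idPl (ltW ae)); lra.
    by move/Fl; apply: filterS => x; rewrite ltr_norml => /andP[? ?]; lra.
  have : \forall x \near x0, [/\ Omega (toC x), v (toC x) < u (toC x),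
      m ^+ n <= F x & F x < (a + e / 4) ^+ n].
    by near=> x; split; near: x.
  move=> /nbhs_ballP[d /= d0 dP]; exists (d / 2) => [|x xd]; first by rewrite divr_gt0.
  by apply: dP; rewrite -ball_normE /= distrC; lra.
have [wu cwu wuE] : exists2 w : V -> R, continuous w &
    forall x, `|x - x0| <= r -> w x = u (toC x).
  by apply: clamp_extension (ltW r0) _ => x /rP[/uC].
have [wv cwv wvE] : exists2 w : V -> R, continuous w &
    forall x, `|x - x0| <= r -> w x = v (toC x).
  by apply: clamp_extension (ltW r0) _ => x /rP[/vC].
pose w x := wu x + e / 2 * sqn x.
have cw : continuous w.
  move=> x; have h : e / 2 * sqn t @[t --> x] --> e / 2 * sqn x.
    exact: (cvgM (@cst_continuous V R (e / 2) x) (@continuous_sqn R _ x)).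
  exact: (cvgD (cwu x) h).
have rP' x : `|x - x0| <= r -> [/\ Omega (toC x), wu x = u (toC x) & m ^+ n <= F x].
  by move=> xr; have [? _ ? _] := rP x xr; split => //; exact: wuE.
(* The regularized inequalities hold for |x - x0| < r/2, and q < r/2. *)
pose q := r / 3; have q0 : 0 < q by rewrite divr_gt0.
have q20 : 0 < e * q ^+ 2 by rewrite mulr_gt0// exprn_gt0.
have d0 : 0 < e * q ^+ 2 / 16 by rewrite divr_gt0.
have nn0 : (0 < n + n)%N by rewrite addn_gt0 n0.
have [U [cU Ut Uw Uv]] := regularization x0 nn0 cw r0 d0.
have inq h : sqn h <= q ^+ 2 -> `|(x0 + h) - x0| <= q.
  by rewrite [x0 + h]addrC addrK; apply: norm_le_sqn; exact: ltW.
have inr h : sqn h <= q ^+ 2 -> `|(x0 + h) - x0| <= r.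
  by move=> /inq; rewrite /q; lra.
(* [U] already contains one half of e |x|^2; the other half is added here, and -(e/4) |h|^2 makes
   the maximum at h = 0 strict. *)
pose G h := U (x0 + h) + (e / 2 * sqn (x0 + h) + (- (e / 4)) * sqn h) - wv (x0 + h).
have cG : continuous G.
  move=> h.
  have c1 : e / 2 * sqn (x0 + t) @[t --> h] --> e / 2 * sqn (x0 + h).
    have c0 : sqn (x0 + t) @[t --> h] --> sqn (x0 + h).
      exact: (continuous_translate (x := x0) (@continuous_sqn R _)).
    exact: (cvgM (@cst_continuous V R (e / 2) h) c0).
  have c2 : - (e / 4) * sqn t @[t --> h] --> - (e / 4) * sqn h.
    exact: (cvgM (@cst_continuous V R (- (e / 4)) h) (@continuous_sqn R _ h)).
  have c3 : U (x0 + t) @[t --> h] --> U (x0 + h) by exact: continuous_translate.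
  have c4 : wv (x0 + t) @[t --> h] --> wv (x0 + h) by exact: continuous_translate.
  exact: (cvgB (cvgD c3 (cvgD c1 c2)) c4).
have [y yq ymax] := eball_max q cG.
have [Oy vuy mFy Fy] := rP _ (inr y yq).
have s0 : sqn (0 : V) <= q ^+ 2 by rewrite sqn0 sqr_ge0.
(* On the sphere the term -(e/4) |h|^2 costs e q^2/4, more than the errors e q^2/16 of [U] at the
   two points compared. *)
have yq' : sqn y < q ^+ 2.
  rewrite lt_neqAle yq andbT; apply/negP => /eqP yE.
  have := ymax 0 s0; rewrite /G addr0 sqn0 yE.
  have := Uw _ (inr y yq); rewrite ler_norml => /andP[_].
  have := Uw _ (inr 0 s0); rewrite addr0 ler_norml => /andP[+ _].
  have := gmax _ Oy.
  rewrite (wvE (x0 + y) (inr y yq)) (wvE x0); last by rewrite subrr normr0 ltW.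
  rewrite /w (wuE (x0 + y) (inr y yq)) (wuE x0); last by rewrite subrr normr0 ltW.
  lra.
have [b [H Ht]] := Ut (x0 + y).
pose b' := b + e *: (x0 + y) - (e / 2) *: y.
(* The quadratic surplus e/2 - e/4 = e/4 of [G] absorbs the Taylor error of [U], so the second order
   part of the polynomial touching from below is exactly [H]. *)
have wvt : \forall h \near (0 : V),
    wv (x0 + y) + dotv b' h + quad H h <= wv (x0 + y + h).
  near=> h.
  have h1 : `|U (x0 + y + h) - U (x0 + y) - dotv b h - quad H h| <= e / 4 * sqn h.
    by near: h; apply: Ht; rewrite divr_gt0.
  have h2 : G (y + h) <= G y.
    by apply: ymax; near: h; exact: eball_near.
  move: h1 h2; rewrite /G [x0 + (y + h)]addrA ler_norml => /andP[h1 _].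
  rewrite (sqnD (x0 + y) h) (sqnD y h) /b' !dotvDl dotNv !dotvZl dotvDl; lra.
pose A := hermpart H.
have hA : A \is hermsymmx by exact: hermpart_herm.
have me : 0 < m + e by lra.
have [A20 Adet] : (forall z, 0 <= Re (hform (2 *: A) z)) /\ (m + e) ^+ n <= Re (\det (2 *: A)).
  apply: hform_lower_bound => //; first exact: hermsymmx_double.
  move=> xi xi1.
  rewrite (eq_bigr _ (fun k _ => Re_hform_double A (row k xi))) -mulr_sumr.
  have := Uv _ _ (dirmx_unit xi1) (visc_perturbed usub cwu rP' m0 e0 xi1).
  have yr2 : `|(x0 + y) - x0| < r / 2.
    by apply: le_lt_trans (inq y yq) _; rewrite /q; lra.
  move=> /(_ _ b H yr2 (taylor2_superjet Ht)); rewrite tr_dirmx.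
  by rewrite -/A; lra.
have A0 z : 0 <= Re (hform A z).
  by have := A20 z; rewrite Re_hform_double; lra.
have [h hol hE] := jet_decomposition (toC (x0 + y)) (wv (x0 + y)) b' H.
have [_ _ vtest] := vsup.
have th : touches_below (fun z => Re (hform A z) + Re (h z)) v (toC (x0 + y)).
  split; first by rewrite hE subrr dotv0 quad0 !addr0 wvE//; exact: inr.
  apply/nbhs_toC; apply/(near_translate (x0 + y) (fun x => _ <= v (toC x))).
  near=> k; rewrite hE !toCK [x0 + y + k]addrC addrK [k + _]addrC.
  have <- : wv (x0 + y + k) = v (toC (x0 + y + k)).
    rewrite -addrA; apply: wvE; apply: inr; near: k; exact: eball_near.
  by near: k.
have := vtest _ (Tplus_hform hA A0) _ Oy (ex_intro2 _ _ h hol th).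
rewrite (@MC_hform _ _ A)//; last by move=> z; rewrite -hform_real.
(* Monotonicity of f is applied at the touching point, where v < u by the choice of [r]. *)
move=> Av; have := le_lt_trans (le_trans (le_trans Adet Av) (f_nondecr Oy (ltW vuy))) Fy.
apply/negP; rewrite -leNgt; apply: lerXn2r; rewrite ?nnegrE; lra.
Unshelve. all: by end_near. Qed.

End Solutions.
End Comparison.

(** * Reduction to an interior maximum *)

Lemma continuous_pair_comp {S T U W : topologicalType} (f : T -> U -> W)
    (a : S -> T) (b : S -> U) s :
  {for (a s, b s), continuous (fun x : T * U => f x.1 x.2)} ->
  {for s, continuous a} -> {for s, continuous b} ->
  {for s, continuous (fun t => f (a t) (b t))}.
Proof.
move=> fc ac bc Q /fc [[A B] /= [nA nB] AB].
have na : \forall t \near s, A (a t) by exact: ac.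
have nb : \forall t \near s, B (b t) by exact: bc.
apply: (@filterS2 _ (nbhs s) _ _ _ _ _ na nb) => t At Bt.
exact: (AB (a t, b t)).
Qed.

Lemma continuous_within_toC {R : realType} {n : nat} (K : set 'rV[R[i]]_n)
    (g : 'rV[R[i]]_n -> R) :
  {within K, continuous g} ->
  {within [set x | K (toC x)], continuous (fun x => g (toC x))}.
Proof.
move=> /subspace_continuousP gc; apply/subspace_continuousP => x Kx Q Qg.
by have := gc _ Kx Q Qg; rewrite /= => /nbhs_toC.
Qed.

Lemma continuous_toC_interior {R : realType} {n : nat} (Omega : set 'rV[R[i]]_n)
    (g : 'rV[R[i]]_n -> R) : open Omega ->
  {within closure Omega, continuous g} ->
  forall x, Omega (toC x) -> {for x, continuous (fun x => g (toC x))}.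
Proof.
move=> oO gc x Ox Q Qg.
have /subspace_continuousP/(_ _ (subset_closure Ox) Q Qg) := gc.
move=> h; have on : nbhs (toC x) Omega by exact: open_nbhs_nbhs.
apply: (nbhs_toC x (fun z => Q (g z))).1.
apply: (@filterS2 _ (nbhs (toC x)) _ _ _ _ _ h on) => z /= Qz Oz.
exact: Qz (subset_closure Oz).
Qed.

(* [e] is so small that adding [e * sqn] keeps the maximum off the boundary. *)
Lemma perturbed_max_interior {R : realType} {n : nat} (Omega : set 'rV[R[i]]_n)
    (u v : 'rV[R[i]]_n -> R) z1 :
  bounded_set Omega -> {within closure Omega, continuous u} ->
  {within closure Omega, continuous v} ->
  (forall z, boundary Omega z -> u z <= v z) -> Omega z1 -> v z1 < u z1 ->
  exists (x0 : 'rV[R]_(n + n)) (e : R),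
    [/\ 0 < e, Omega (toC x0), v (toC x0) < u (toC x0) &
      forall x, Omega (toC x) -> u (toC x) + e * sqn x - v (toC x) <=
        u (toC x0) + e * sqn x0 - v (toC x0)].
Proof.
move=> bO uc vc uv Oz1 vu1.
have cK := compact_toC bO.
have K1 : closure Omega (toC (toR z1)) by rewrite toRK; exact: subset_closure.
have K0 : [set x | closure Omega (toC x)] !=set0 by exists (toR z1).
have memK x : closure Omega (toC x) -> x \in [set x | closure Omega (toC x)].
  exact: (@mem_set _ [set x | closure Omega (toC x)] x).
have [x2 _ x2max] := EVT_max_rV K0 cK
  (continuous_subspaceT (@continuous_sqn R (n + n))).
have [B B0 KB] : exists2 B, 0 < B & forall x, closure Omega (toC x) -> sqn x <= B.
  exists (sqn x2 + 1); first by rewrite ltr_wpDl// sqn_ge0.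
  move=> x Kx; have h : sqn x <= sqn x2 := x2max x (memK x Kx).
  by rewrite (le_trans h)// lerDl.
have [e e0 eB] : exists2 e, 0 < e & e * B = (u z1 - v z1) / 2.
  exists ((u z1 - v z1) / (2 * B)); first by rewrite divr_gt0 ?mulr_gt0// subr_gt0.
  by field; rewrite gt_eqF.
have gK : {within [set x | closure Omega (toC x)],
    continuous (fun x => u (toC x) + e * sqn x - v (toC x))}.
  have sqK : {within [set x | closure Omega (toC x)], continuous (fun x => e * sqn x)}.
    apply: continuous_subspaceT => x.
    exact: (cvgM (@cst_continuous _ R e x) (@continuous_sqn R _ x)).
  have uK := continuous_within_toC uc; have vK := continuous_within_toC vc.
  move=> x; exact: (cvgB (cvgD (uK x) (sqK x)) (vK x)).
have [x0 /set_mem Kx0 gmax] := EVT_max_rV K0 cK gK.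
(* Comparing the maximum with [z1], the gap u - v at [x0] is at least the gap at [z1] minus e B,
   that is, at least half of it. *)
have vu0 : v (toC x0) < u (toC x0).
  have h1 : u (toC (toR z1)) + e * sqn (toR z1) - v (toC (toR z1)) <=
    u (toC x0) + e * sqn x0 - v (toC x0) := gmax _ (memK _ K1).
  rewrite toRK in h1; have h2 := ler_wpM2l (ltW e0) (KB x0 Kx0).
  have h3 := mulr_ge0 (ltW e0) (sqn_ge0 (toR z1)).
  clear -vu1 eB h1 h2 h3; lra.
exists x0, e; split=> // [|x Ox]; last exact: gmax x (memK x (subset_closure Ox)).
apply: contrapT => nO; have := uv (toC x0); rewrite leNgt vu0.
suff h : boundary Omega (toC x0) by move=> /(_ h).
by split => // /interior_subset.
Qed.

Theorem theorem1p1 (R : realType) (n : nat) (hn : (0 < n)%N)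
    (Omega : set 'rV[R[i]]_n)
    (dom_Omega : is_domain Omega) (bnd_Omega : bounded_set Omega)
    (f : 'rV[R[i]]_n -> R -> R)
    (f_cont : {within Omega `*` [set: R],
                 continuous (fun x : 'rV[R[i]]_n * R => f x.1 x.2)})
    (f_ge0 : forall z t, Omega z -> 0 <= f z t)
    (f_nondecr : forall z, Omega z -> forall s t : R, s <= t -> f z s <= f z t)
    (u v : 'rV[R[i]]_n -> R)
    (u_cont : {within closure Omega, continuous u})
    (u_psh : psh Omega (EFin \o u))
    (v_cont : {within closure Omega, continuous v})
    (v_psh : psh Omega (EFin \o v))
    (u_sub : viscosity_subsolution Omega f u)
    (v_super : viscosity_supersolution Omega f v) :
  (forall z, boundary Omega z -> u z <= v z) ->
  forall z, Omega z -> u z <= v z.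
Proof.
move=> uv z1 Oz1; rewrite leNgt; apply/negP => vu1.
have [oO _ _] := dom_Omega.
have [x0 [e [e0 O0 vu0 gmax]]] :=
  perturbed_max_interior bnd_Omega u_cont v_cont uv Oz1 vu1.
have uC := continuous_toC_interior oO u_cont.
(* [f_cont] is continuity relative to this product; openness turns it into continuity at the point
   itself. *)
have oX : open (Omega `*` [set: R]).
  rewrite openE => -[z t] [/= Oz _]; exists (Omega, [set: R]) => //=.
  by split; [exact: open_nbhs_nbhs|exact: filterT].
have fc : {for (toC x0, u (toC x0)),
    continuous (fun x : 'rV[R[i]]_n * R => f x.1 x.2)}.
  move: f_cont; rewrite continuous_open_subspace// => h.
  exact: h (mem_set (conj O0 I)).
have F0 := continuous_pair_comp fc (@continuous_toC R n x0) (uC x0 O0).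
exact: (no_interior_max hn oO f_nondecr f_ge0 u_sub v_super uC
  (continuous_toC_interior oO v_cont) F0 e0 O0 vu0 gmax).
Qed.
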